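(* Let $T$ be a Ritt operator on a nonzero complex Hilbert space $H$, and put $C=C_{\mathrm R}(T)$, $M=M(T)=\sup_{n\ge0}\|T^n\|$. (i) For every $\zeta\in\mathbb T\setminus\{1\}$, $$\sup_{n\ge1}\|(\zeta-T^n)^{-1}\|\le1+\frac{CM}{|\zeta-1|}.$$ (ii) $\sup_{m\ge1}C_{\mathrm R}(T^m)\le CM+2$; in particular $\sup_{m\ge1}C_{\mathrm R}(T^m)\le C_{\mathrm R}(T)+2$ if $T$ is a contraction. (iii) Suppose that $T$ is a contraction. If $E,F$ are complex Hilbert spaces and $W\in A(\mathbb D;\mathcal B(E,F))$ satisfies $\|W(1)\|<\|W\|_\infty$, then $$\sup_{n\ge1}\|W(T^n)\|<\|W\|_\infty .$$ For matrix polynomials there is the following explicit bound. Let $W$ be an $r\times d$ matrix polynomial with $m:=\|W\|_\infty>\|W(1)\|$, and let $A$ be a $d\times d$ outer matrix polynomial with $m^2I_d-W(\zeta)^*W(\zeta)=A(\zeta)^*A(\zeta)$ for all $\zeta\in\mathbb T$. Write $$\det A(z)=c\prod_{j=1}^{h}(\alpha_j-z),\qquad H_A=\max_{z\in\mathbb T}\|\operatorname{adj}A(z)\|,$$ with zeros repeated according to multiplicity and empty products equal to $1$. Then $c\ne0$, $|\alpha_j|\ge1$ and $\alpha_j\ne1$ for all $j$, and with $$b_C(\alpha)=\begin{cases}(|\alpha|-1)^{-1},&|\alpha|>1,\\ 1+C/|\alpha-1|,&|\alpha|=1,\ \alpha\ne1,\end{cases}\qquad L_A=\frac{H_A}{|c|}\prod_{j=1}^{h}b_C(\alpha_j),$$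 one has $$\sup_{n\ge1}\|W(T^n)\|\le\sqrt{m^2-L_A^{-2}}<m .$$ For the displacement itself (still with $T$ a contraction), $$\sup_{n\ge1}\|I-T^n\|\le\begin{cases}\dfrac{2(C+1)}{C+2},&1\le C\le\sqrt2,\\[2mm] 2\sqrt{1-C^{-2}},&C\ge\sqrt2.\end{cases}$$
   Context: $\mathbb D$ is the open unit disc, $\mathbb T$ the unit circle. A bounded operator $T$ is a Ritt operator if $\sigma(T)\subset\overline{\mathbb D}$ and its Ritt constant $C_{\mathrm R}(T):=\sup_{|\lambda|>1}|\lambda-1|\,\|(\lambda-T)^{-1}\|$ is finite. A contraction is an operator of norm at most $1$. $A(\mathbb D;\mathcal B(E,F))$ is the Banach space of functions $W:\overline{\mathbb D}\to\mathcal B(E,F)$ that are continuous in operator norm on $\overline{\mathbb D}$ and holomorphic on $\mathbb D$, with norm $\|W\|_\infty=\max_{\zeta\in\mathbb T}\|W(\zeta)\|$. For a contraction $S\in\mathcal B(H)$ and an operator-valued polynomial $W(z)=\sum_jW_jz^j$, put $W(S)=\sum_jW_j\otimes S^j:E\otimes H\to F\otimes H$ (completed Hilbert tensor products). One has $\|W(S)\|\le\|W\|_\infty$, operator-valued polynomials are dense in $A(\mathbb D;\mathcal B(E,F))$, and $W(S)$ is defined for all $W\in A(\mathbb D;\mathcal B(E,F))$ by continuous extension. For an $r\times d$ matrix polynomial this is $W(S)=\sum_jW_j\otimes S^j:H^d\to H^r$. A $d\times d$ matrix polynomial $A$ is outer if $A\,H^2(\mathbb C^d)$ is dense in $H^2(\mathcal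 M)$ for some subspace $\mathcal M\subset\mathbb C^d$, where $H^2(\mathcal M)$ is the $\mathcal M$-valued Hardy space on $\mathbb D$. (A factor $A$ as required exists by the matrix Fejér–Riesz theorem.) $\operatorname{adj}A$ is the adjugate matrix. *)

(* Defs.v *)
From HB Require Import structures.
From mathcomp Require Import all_boot all_order all_algebra.
From mathcomp Require Import complex.
From mathcomp Require Import all_classical all_reals all_analysis.

Set Implicit Arguments.
Unset Strict Implicit.
Unset Printing Implicit Defensive.

Import Order.TTheory GRing.Theory Num.Theory.
Import numFieldNormedType.Exports.

Local Open Scope classical_set_scope.
Local Open Scope complex_scope.
Local Open Scope sesquilinear_scope.
Local Open Scope ring_scope.

(* The library norm of a module over R[i] is an element of R[i]; suprema are
   taken in R, so norms are used through their real part. *)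
Definition nrm (R : rcfType) (V : normedZmodType R[i]) (x : V) : R :=
  complex.Re `|x|.

Section NrmTheory.
Variable R : rcfType.

Lemma nrmE (V : normedZmodType R[i]) (x : V) : `|x| = (nrm x)%:C.
Proof.
have := normr_ge0 x; rewrite /nrm; move: `|x| => [a b].
rewrite lecE/= => /andP[/eqP b0 _]. by rewrite b0.
Qed.

Lemma nrm_ge0 (V : normedZmodType R[i]) (x : V) : 0 <= nrm x.
Proof. by have := normr_ge0 x; rewrite nrmE -[0]/(0%:C) lecR. Qed.

Lemma nrm0 (V : normedZmodType R[i]) : nrm (0 : V) = 0.
Proof. by rewrite /nrm normr0. Qed.

Lemma nrm0_eq0 (V : normedZmodType R[i]) (x : V) : nrm x = 0 -> x = 0.
Proof. by move=> x0; apply: normr0_eq0; rewrite nrmE x0. Qed.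

Lemma ler_nrmD (V : normedZmodType R[i]) (x y : V) : nrm (x + y) <= nrm x + nrm y.
Proof. by rewrite -lecR rmorphD/= -!nrmE ler_normD. Qed.

Lemma nrmZ (V : normedModType R[i]) (a : R[i]) (x : V) :
  nrm (a *: x) = nrm a * nrm x.
Proof. by apply: (@complexI R); rewrite rmorphM/= -!nrmE normrZ. Qed.

End NrmTheory.

(* A complex Hilbert space: a Banach space whose norm comes from a scalar
   product (linear in the first variable). *)
HB.mixin Record CompleteNormedModule_isHilbert (R : realType) H
    of CompleteNormedModule R[i] H := {
  hdot : {dot H for (@Num.conj R[i])};
  hdot_norm : forall x : H, hdot x x = `|x| ^+ 2
}.

#[short(type="hilbertType")]
HB.structure Definition Hilbert (R : realType) :=
  {H of CompleteNormedModule R[i] H & CompleteNormedModule_isHilbert R H}.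

Section BoundedOperators.
Variables (R : realType) (E F : normedModType R[i]).

Definition bounded_linear (f : E -> F) : Prop :=
  linear f /\ exists c : R, forall x, nrm (f x) <= c * nrm x.

Definition bounded_linear_pred : {pred E -> F} := fun f => `[< bounded_linear f >].

Fact bounded_linear_submod : submod_closed bounded_linear_pred.
Proof.
split=> [|a f g /asboolP[lf [c fc]] /asboolP[lg [d gd]]]; apply/asboolP; split.
- by move=> a x y; rewrite /= scaler0 addr0.
- by exists 0 => x; rewrite mul0r nrm0.
- move=> b x y; rewrite !fctE lf lg !scalerDr !scalerA -!addrA; congr (_ + _).
    by rewrite mulrC.
  by rewrite addrCA.
- exists (nrm a * c + d) => x; rewrite !fctE (le_trans (ler_nrmD _ _))// mulrDl.
  by rewrite lerD// nrmZ -mulrA ler_wpM2l ?nrm_ge0.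
Qed.

HB.instance Definition _ :=
  GRing.isSubmodClosed.Build R[i] (E -> F) bounded_linear_pred bounded_linear_submod.

Record boundedop := BoundedOp {
  boundedop_fun :> E -> F;
  _ : boundedop_fun \in bounded_linear_pred }.

HB.instance Definition _ := [isSub for boundedop_fun].
HB.instance Definition _ := [Choice of boundedop by <:].
HB.instance Definition _ := [SubChoice_isSubLmodule of boundedop by <:].

Definition opnorm (f : boundedop) : R :=
  sup [set nrm (f x) | x in [set x | nrm x <= 1]].

Fact boundedop_linear (f : boundedop) : linear f.
Proof. by case: f => f /= /asboolP[]. Qed.

HB.instance Definition _ (f : boundedop) :=
  GRing.isLinear.Build R[i] E F *:%R f (boundedop_linear f).

Lemma boundedop_bounded (f : boundedop) :
  exists c : R, forall x, nrm (f x) <= c * nrm x.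
Proof. by case: f => f /= /asboolP[]. Qed.

Lemma boundedopP (f g : boundedop) : f =1 g -> f = g.
Proof. by move=> fg; apply/val_inj/funext. Qed.

Let opnorm_has_sup (f : boundedop) :
  has_sup [set nrm (f x) | x in [set x | nrm x <= 1]].
Proof.
split; first by exists (nrm (f 0)), 0; rewrite //= nrm0 ler01.
have [c cf] := boundedop_bounded f; exists `|c| => _ [x /= x1 <-].
rewrite (le_trans (cf x))// (le_trans (ler_norm _))// normrM.
by rewrite ler_piMr// ger0_norm ?nrm_ge0.
Qed.

Lemma opnorm_ge0 (f : boundedop) : 0 <= opnorm f.
Proof.
apply: ub_le_sup; first by case: (opnorm_has_sup f).
by exists 0; rewrite /= ?linear0 nrm0 ?ler01.
Qed.

Lemma nrm_boundedop (f : boundedop) x : nrm (f x) <= opnorm f * nrm x.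
Proof.
have [->|x0] := eqVneq x 0; first by rewrite linear0 !nrm0 mulr0.
have nx0 : 0 < nrm x.
  by rewrite lt_def nrm_ge0 andbT; apply: contra_neq x0; exact: nrm0_eq0.
have nV : nrm ((nrm x)^-1%:C : R[i]) = (nrm x)^-1.
  by rewrite /nrm normc_def/= expr0n/= addr0 sqrtr_sqr ger0_norm// invr_ge0 nrm_ge0.
rewrite -ler_pdivrMr// mulrC -nV -nrmZ -linearZ.
apply: ub_le_sup; first by case: (opnorm_has_sup f).
by eexists; [|reflexivity]; rewrite /= nrmZ nV mulVf// gt_eqF.
Qed.

Lemma opnorm_le (f : boundedop) (c : R) :
  0 <= c -> (forall x, nrm (f x) <= c * nrm x) -> opnorm f <= c.
Proof.
move=> c0 cf; apply: ge_sup; first by case: (opnorm_has_sup f).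
by move=> _ [x /= x1 <-]; rewrite (le_trans (cf x))// ler_piMr.
Qed.

Let opnormD (f g : boundedop) :
  (opnorm (f + g))%:C <= (opnorm f)%:C + (opnorm g)%:C.
Proof.
rewrite -rmorphD lecR; apply: opnorm_le; first by rewrite addr_ge0 ?opnorm_ge0.
by move=> x; rewrite (le_trans (ler_nrmD _ _))// mulrDl lerD ?nrm_boundedop.
Qed.

Let opnormZ (a : R[i]) (f : boundedop) :
  (opnorm (a *: f))%:C = `|a| * (opnorm f)%:C.
Proof.
have le_opnormZ b g : opnorm (b *: g) <= nrm b * opnorm g.
  apply: opnorm_le; first by rewrite mulr_ge0 ?nrm_ge0 ?opnorm_ge0.
  by move=> x; rewrite nrmZ -mulrA ler_wpM2l ?nrm_ge0 ?nrm_boundedop.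
rewrite nrmE -rmorphM; congr (_%:C); apply/eqP; rewrite eq_le le_opnormZ/=.
have [->|a0] := eqVneq a 0; first by rewrite nrm0 mul0r opnorm_ge0.
have na0 : 0 < nrm a.
  by rewrite lt_def nrm_ge0 andbT; apply: contra_neq a0; exact: nrm0_eq0.
rewrite mulrC -ler_pdivlMr// -[X in opnorm X <= _](scalerK a0).
rewrite (le_trans (le_opnormZ _ _))// mulrC ler_wpM2l ?opnorm_ge0//.
by rewrite /nrm normfV nrmE -fmorphV.
Qed.

Let opnorm0_eq0 (f : boundedop) : (opnorm f)%:C = 0 -> f = 0.
Proof.
move=> /complexI f0; apply: boundedopP => x; apply: nrm0_eq0.
by apply/eqP; rewrite eq_le nrm_ge0 andbT (le_trans (nrm_boundedop _ _))// f0 mul0r.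
Qed.

HB.instance Definition _ :=
  @Lmodule_isNormed.Build R[i] boundedop (fun f => (opnorm f)%:C)
    opnormD opnormZ opnorm0_eq0.

Lemma nrm_opnorm (f : boundedop) : nrm f = opnorm f.
Proof. by []. Qed.

End BoundedOperators.

Notation "''B' ( E , F )" := (boundedop E F) (format "''B' ( E ,  F )") : type_scope.

Section Composition.
Variables (R : realType) (E F G : normedModType R[i]).

Fact boundedop_comp_subproof (g : 'B(F, G)) (f : 'B(E, F)) :
  (g \o f : E -> G) \in @bounded_linear_pred R E G.
Proof.
apply/asboolP; split=> [a x y|]; first by rewrite /= !linearP.
exists (opnorm g * opnorm f) => x; rewrite (le_trans (nrm_boundedop _ _))// -mulrA.
by rewrite ler_wpM2l ?opnorm_ge0 ?nrm_boundedop.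
Qed.

Definition boundedop_comp (g : 'B(F, G)) (f : 'B(E, F)) : 'B(E, G) :=
  BoundedOp (boundedop_comp_subproof g f).

Fact boundedop_id_subproof : (idfun : E -> E) \in @bounded_linear_pred R E E.
Proof. by apply/asboolP; split=> [a x y//|]; exists 1 => x; rewrite mul1r. Qed.

Definition boundedop_id : 'B(E, E) := BoundedOp boundedop_id_subproof.

End Composition.

Section Ring.
Variables (R : realType) (E : normedModType R[i]).

Let compA : associative (@boundedop_comp R E E E).
Proof. by move=> f g h; exact: boundedopP. Qed.
Let comp1l : left_id (@boundedop_id R E) (@boundedop_comp R E E E).
Proof. by move=> f; exact: boundedopP. Qed.
Let comp1r : right_id (@boundedop_id R E) (@boundedop_comp R E E E).
Proof. by move=> f; exact: boundedopP. Qed.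
Let compDl : left_distributive (@boundedop_comp R E E E) +%R.
Proof. by move=> f g h; exact: boundedopP. Qed.
Let compDr : right_distributive (@boundedop_comp R E E E) +%R.
Proof. by move=> f g h; apply: boundedopP => x /=; rewrite linearD. Qed.

HB.instance Definition _ := GRing.Zmodule_isPzRing.Build 'B(E, E)
  compA comp1l comp1r compDl compDr.

End Ring.

Section Ritt.
Variables (R : realType) (H : normedModType R[i]).
Implicit Types (S X T : 'B(H, H)) (z : R[i]).
Local Open Scope ereal_scope.

Definition is_inverse S X : Prop := (X * S = 1)%R /\ (S * X = 1)%R.

Definition spectrum T : set R[i] :=
  [set z | ~ exists X, is_inverse (z *: (1 : 'B(H, H)) - T)%R X].

(* The norm of the inverse of S, equal to +oo when S is not invertible. *)
Definition inverse_norm S : \bar R :=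
  ereal_inf [set (nrm X)%:E | X in [set X | is_inverse S X]].

Definition ritt_const T : \bar R :=
  ereal_sup [set (nrm (z - 1)%R)%:E * inverse_norm (z *: (1 : 'B(H, H)) - T)%R
            | z in [set z | (1 < nrm z)%R]].

Definition is_ritt T : Prop :=
  spectrum T `<=` [set z | (nrm z <= 1)%R] /\ ritt_const T < +oo.

Definition power_bound T : \bar R :=
  ereal_sup [set (nrm (T ^+ n)%R)%:E | n in [set: nat]].

End Ritt.

Section HilbertTensor.
Variable R : realType.

(* The completed tensor product of Hilbert spaces, characterized up to unitary
   equivalence. *)
Record hilbert_tensor (E H : hilbertType R) := HilbertTensor {
  tensor_space :> hilbertType R;
  tensor : {bilinear E -> H -> tensor_space};
  tensor_dot : forall e e' h h',
    hdot (tensor e h) (tensor e' h') = hdot e e' * hdot h h';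
  tensor_dense :
    closure [set \sum_(p <- s) tensor p.1 p.2 | s in [set: seq (E * H)]] = setT }.

End HilbertTensor.

Definition unit_circle (R : realType) : set R[i] := [set z | nrm z = 1].
Arguments unit_circle : clear implicits.

Section DiskAlgebra.
Variables (R : realType) (E F : hilbertType R).

Definition disk_algebra (W : R[i]^o -> 'B(E, F)) : Prop :=
  {within [set z | nrm z <= 1], continuous W} /\
  (forall z, nrm z < 1 -> derivable W z 1).

Definition disk_norm (W : R[i] -> 'B(E, F)) : R :=
  sup [set nrm (W z) | z in unit_circle R].

Definition oppoly (N : nat) (P : 'I_N -> 'B(E, F)) (z : R[i]) : 'B(E, F) :=
  \sum_(j < N) z ^+ j *: P j.

Variables (H : hilbertType R) (EH : hilbert_tensor E H) (FH : hilbert_tensor F H).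

Definition is_oppoly_calc (N : nat) (P : 'I_N -> 'B(E, F)) (S : 'B(H, H))
    (X : 'B(EH, FH)) : Prop :=
  forall e h, X (tensor EH e h) = \sum_(j < N) tensor FH (P j e) ((S ^+ j) h).

Definition is_disk_calc (W : R[i] -> 'B(E, F)) (S : 'B(H, H))
    (X : 'B(EH, FH)) : Prop :=
  forall eps : R, 0 < eps ->
  exists (N : nat) (P : 'I_N -> 'B(E, F)) (Y : 'B(EH, FH)),
    [/\ is_oppoly_calc P S Y,
        disk_norm (fun z => oppoly P z - W z) < eps & nrm (Y - X) < eps].

(* W(S): the value at W of the closure of the calculus of operator-valued
   polynomials.  For W in the disk algebra and S a contraction there is exactly
   one X such that is_disk_calc W S X. *)
Definition disk_calc (W : R[i] -> 'B(E, F)) (S : 'B(H, H)) : 'B(EH, FH) :=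
  xget 0 [set X | is_disk_calc W S X].

End DiskAlgebra.

Section MatrixPolynomials.
Variable R : realType.

Definition l2norm (V : normedZmodType R[i]) (d : nat) (x : 'I_d -> V) : R :=
  Num.sqrt (\sum_(i < d) nrm (x i) ^+ 2).

Definition l2opnorm (V V' : normedZmodType R[i]) (d r : nat)
    (f : ('I_d -> V) -> 'I_r -> V') : R :=
  sup [set l2norm (f x) | x in [set x | l2norm x <= 1]].

Definition mxnorm (r d : nat) (B : 'M[R[i]]_(r, d)) : R :=
  l2opnorm (fun (x : 'I_d -> R[i]) i => \sum_(k < d) B i k * x k).

Definition mxeval (r d : nat) (W : 'M[{poly R[i]}]_(r, d)) (z : R[i]) :
  'M[R[i]]_(r, d) := map_mx (horner_eval z) W.

Definition mxpoly_norm (r d : nat) (W : 'M[{poly R[i]}]_(r, d)) : R :=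
  sup [set mxnorm (mxeval W z) | z in unit_circle R].

Definition poly_calc (H : normedModType R[i]) (p : {poly R[i]}) (S : 'B(H, H)) :
  'B(H, H) := \sum_(j < size p) p`_j *: S ^+ j.

(* W(S) = \sum_j W_j \otimes S^j : H^d -> H^r *)
Definition mxpoly_calc (H : normedModType R[i]) (r d : nat)
    (W : 'M[{poly R[i]}]_(r, d)) (S : 'B(H, H)) (x : 'I_d -> H) : 'I_r -> H :=
  fun i => \sum_(k < d) poly_calc (W i k) S (x k).

End MatrixPolynomials.

Section Hardy.
Variables (R : realType) (d : nat).
Local Notation Cd := 'cV[R[i]]_d.

Definition vnorm (v : Cd) : R := l2norm (fun i => v i ord0).

(* H^2(M), an element f(z) = \sum_k z^k a_k being given by its sequence a of
   Taylor coefficients at 0. *)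
Definition hardy2 (M : {vspace Cd}) (a : nat -> Cd) : Prop :=
  (forall k, a k \in M) /\ cvgn (series (fun k => vnorm (a k) ^+ 2)).

Definition hardy2_norm (a : nat -> Cd) : R :=
  Num.sqrt (limn (series (fun k => vnorm (a k) ^+ 2))).

Definition hardy2_value (a : nat -> Cd) (z : R[i]) : Cd :=
  \col_i limn (series (fun k => z ^+ k * a k i ord0 : R[i]^o)).

Definition hardy2_mul (A : 'M[{poly R[i]}]_d) (f g : nat -> Cd) : Prop :=
  forall z, nrm z < 1 -> hardy2_value g z = mxeval A z *m hardy2_value f z.

Definition is_outer (A : 'M[{poly R[i]}]_d) : Prop :=
  exists M : {vspace Cd},
    (forall f, hardy2 fullv f -> exists2 g, hardy2 M g & hardy2_mul A f g) /\
    (forall g eps, hardy2 M g -> 0 < eps ->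
       exists f g', [/\ hardy2 fullv f, hardy2 M g', hardy2_mul A f g' &
                        hardy2_norm (fun k => g' k - g k) < eps]).

End Hardy.

Section Constants.
Variable R : realType.

Definition root_bound (C : R) (a : R[i]) : R :=
  if 1 < nrm a then (nrm a - 1)^-1 else 1 + C / nrm (a - 1).

Definition adj_max (d : nat) (A : 'M[{poly R[i]}]_d) : R :=
  sup [set mxnorm (\adj (mxeval A z)) | z in unit_circle R].

Definition outer_const (C : R) (d : nat) (A : 'M[{poly R[i]}]_d)
    (c : R[i]) (alpha : seq R[i]) : R :=
  adj_max A / nrm c * \prod_(a <- alpha) root_bound C a.

Definition displacement_bound (C : R) : R :=
  if C <= Num.sqrt 2 then 2 * (C + 1) / (C + 2) else 2 * Num.sqrt (1 - C ^- 2).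

End Constants.

(* Main.v *)
(* For |l| >= 1, l <> 1, and y in H, put x = (l - T^n) y and, for each w with
   w^n = l, u_w = sum_(j < n) w^-j T^j y. Then (w - T) u_w = (w / l) x, so the Ritt
   condition bounds u_w. Parseval's identity over the n-th roots w of l, applied to
   this family and to the scalar family obtained for T = 1, gives
   |l - 1| |T^n y| <= C M |x| with no loss, and (i), (ii) and the displacement bound
   follow from it.

   For the matrix bound, von Neumann's inequality for the column (W, A) gives
   |W(S) x|^2 + |A(S) x|^2 <= m^2 |x|^2 for S = T^n, and A(S) is bounded below
   because adj A(S) A(S) = det A(S) is a product of factors alpha - S.

   For general W there is no outer factor. It is replaced by a finite family of
   scalar polynomials Q_i, independent of n, with sum |Q_i|^2 <= 1/2 on the arc away
   from 1 and |x|^2 <= sum |Q_i(S) x|^2: such a family exists because the resolvent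
   of S is bounded on that arc uniformly in n. *)

Require Import Defs.
From HB Require Import structures.
From mathcomp Require Import all_boot all_order all_algebra.
From mathcomp Require Import complex.
From mathcomp Require Import all_classical all_reals all_analysis.
From mathcomp Require Import ring lra.
From mathcomp Require cyclic separable cyclotomic.

Set Implicit Arguments.
Unset Strict Implicit.
Unset Printing Implicit Defensive.

Import Order.TTheory GRing.Theory Num.Theory.
Import numFieldNormedType.Exports.

Local Open Scope classical_set_scope.
Local Open Scope complex_scope.
Local Open Scope sesquilinear_scope.
Local Open Scope ring_scope.

(** * Positive sesquilinear forms *)

(** Parseval's identity loses nothing because the weights match: [|T^n y| <= M |T^j y|] for every
    [j < n], so the same sum of [|w|^(-2j)] appears for the orbit of [y] and for the constant
    sequence, and cancels. Von Neumann's inequality is needed for whole matrices of polynomials. It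
    is obtained from finite Fourier transforms in the form [|x|^2 - |S x|^2], which may have a
    kernel; this is why the forms below are only semi-definite and live on bare modules. The
    constant 1/2 required of the family [Q_i] is where the strict inequality comes from: rows
    [tau Q_i] added to [W] raise the squared maximum on the arc by at most [tau^2 / 2], but on the
    operator side they take up at least [tau^2 |x|^2], so [tau^2 / 2] is gained. Near 1, where the
    [Q_i] may be large, the gap between [|W(1)|] and the maximum absorbs them. *)

Section PositiveForms.
Variables (R : realType) (V : lmodType R[i]).
Local Notation C := R[i].

(** Three forms are meant: the scalar product of a Hilbert space, that of the complex numbers, and
    the defect form of a contraction. *)
Definition psd_form (f : V -> V -> C) : Prop :=
  [/\ forall z, linear_for *%R (f^~ z), forall x y, f y x = (f x y)^* &
      forall x, 0 <= f x x].

Variable f : V -> V -> C.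
Hypothesis fP : psd_form f.

Lemma psd_linearl z : linear_for *%R (f^~ z). Proof. by case: fP. Qed.
Lemma psdC x y : f y x = (f x y)^*. Proof. by case: fP. Qed.
Lemma psd_ge0 x : 0 <= f x x. Proof. by case: fP. Qed.

Lemma psdDl x y z : f (x + y) z = f x z + f y z.
Proof. by have := psd_linearl z 1 x y; rewrite scale1r mul1r. Qed.
Lemma psd0l z : f 0 z = 0.
Proof. by apply: (addrI (f 0 z)); rewrite -psdDl !addr0. Qed.
Lemma psdZl a x z : f (a *: x) z = a * f x z.
Proof. by have := psd_linearl z a x 0; rewrite /= addr0 psd0l addr0. Qed.
Lemma psdBl x y z : f (x - y) z = f x z - f y z.
Proof. by rewrite psdDl -scaleN1r psdZl mulN1r. Qed.
Lemma psd_suml (I : Type) (r : seq I) (P : pred I) (x : I -> V) z :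
  f (\sum_(i <- r | P i) x i) z = \sum_(i <- r | P i) f (x i) z.
Proof. by apply: (big_morph (f^~ z)) => [x1 x2|]; rewrite ?psdDl ?psd0l. Qed.
Lemma psdDr x y z : f z (x + y) = f z x + f z y.
Proof. by rewrite psdC psdDl rmorphD/= -!psdC. Qed.
Lemma psd0r z : f z 0 = 0. Proof. by rewrite psdC psd0l conjC0. Qed.
Lemma psdZr a x z : f z (a *: x) = a^* * f z x.
Proof. by rewrite psdC psdZl rmorphM/= -psdC. Qed.
Lemma psdBr x y z : f z (x - y) = f z x - f z y.
Proof. by rewrite psdC psdBl rmorphB/= -!psdC. Qed.
Lemma psd_sumr (I : Type) (r : seq I) (P : pred I) (x : I -> V) z :
  f z (\sum_(i <- r | P i) x i) = \sum_(i <- r | P i) f z (x i).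
Proof. by apply: (big_morph (f z)) => [x1 x2|]; rewrite ?psdDr ?psd0r. Qed.

Lemma psd_null x y : f x x = 0 -> f x y = 0.
Proof.
move=> fx0; pose a := f x y; apply/eqP; rewrite -normr_eq0.
apply: contraT => a0; have {}a0 : 0 < `|a| by rewrite lt_def a0 normr_ge0.
(* The degenerate case of Cauchy-Schwarz: as [f x x = 0], the multiple of [x] can be chosen so that
   the form takes the value [f y y - (f y y + 1) = -1]. *)
have := psd_ge0 (y - ((f y y + 1) / (2 * `|a| ^+ 2) * a^*) *: x).
set b := (f y y + 1) / _; have b_real : b^* = b.
  by rewrite geC0_conj// divr_ge0 ?addr_ge0 ?psd_ge0// mulr_ge0 ?exprn_ge0.
have bE : b * `|a| ^+ 2 = (f y y + 1) / 2.
  by rewrite /b; field; rewrite gt_eqF.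
clearbody b; rewrite psdBl !psdBr !psdZl !psdZr fx0 (psdC x y) -/a !rmorphM/= b_real conjCK !mulr0 subr0.
have -> : b * a * a^* = (f y y + 1) / 2.
  by rewrite -mulrA -normCK.
have -> : b * a^* * a = (f y y + 1) / 2.
  by rewrite -mulrA [_^* * _]mulrC -normCK.
rewrite -addrA -opprD -splitr opprD addrA subrr sub0r oppr_ge0.
by rewrite ler10.
Qed.

(** Gram-Schmidt for a degenerate form: a vector whose residue is null adds nothing to [t], so
    expansions hold only up to null vectors, which pair to 0 with everything by [psd_null]. *)
Lemma psd_orthonormalize (s : seq V) : exists t : seq V,
  (forall i j, (i < size t)%N -> (j < size t)%N -> f t`_i t`_j = (i == j)%:R) /\
  (forall x, x \in s ->
     let r := x - \sum_(i < size t) f x t`_i *: t`_i in f r r = 0).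
Proof.
elim: s => [|x s [t [tP IH]]]; first by exists [::].
pose r := x - \sum_(i < size t) f x t`_i *: t`_i.
have r_orth j : (j < size t)%N -> f r t`_j = 0.
  move=> jt; rewrite psdBl psd_suml (bigD1 (Ordinal jt))//= psdZl tP// eqxx mulr1.
  rewrite big1 ?addr0 ?subrr// => i /eqP ij; rewrite psdZl tP//.
  by case: eqP => [e|_]; [case: ij; apply: val_inj|rewrite mulr0].
have [r0|r0] := eqVneq (f r r) 0.
  by exists t; split=> // y; rewrite inE => /orP[/eqP->//|/IH].
pose c := (sqrtC (f r r))^-1; pose u := c *: r.
have c_real : c^* = c.
  by apply/CrealP; rewrite rpredV ger0_real// sqrtC_ge0 psd_ge0.
have u1 : f u u = 1.
  rewrite psdZl psdZr c_real mulrA -expr2 exprVn sqrtCK mulVf//.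
have u_orth j : (j < size t)%N -> f u t`_j = 0.
  by move=> jt; rewrite psdZl r_orth// mulr0.
have u_orth' j : (j < size t)%N -> f t`_j u = 0.
  by move=> jt; rewrite psdC u_orth// conjC0.
exists (u :: t); split.
- move=> [|i] [|j]//=; rewrite ?ltnS => it jt; rewrite ?u_orth ?u_orth' ?tP//.
- move=> y; rewrite inE /= big_ord_recl /=.
  case: eqVneq => [-> _|_ /= ys].
    have -> : f x u *: u = r.
      have -> : x = r + \sum_(i < size t) f x t`_i *: t`_i by rewrite subrK.
      rewrite psdDl psd_suml big1 ?addr0; last by move=> i _; rewrite psdZl u_orth' ?mulr0.
      rewrite psdZr c_real /u scalerA mulrAC -expr2 exprVn sqrtCK mulVf ?scale1r//.
    by rewrite opprD addrCA -/r addNr psd0l.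
  have := IH _ ys; rewrite /=; set r' := y - _ => r'0.
  have yu : f y u = 0.
    have -> : y = r' + \sum_(i < size t) f y t`_i *: t`_i by rewrite subrK.
    rewrite psdDl psd_null// add0r psd_suml big1// => i _.
    by rewrite psdZl u_orth' ?mulr0.
  by rewrite yu scale0r add0r.
Qed.

Lemma psd_parseval (t : seq V) (x : V) :
  (forall i j, (i < size t)%N -> (j < size t)%N -> f t`_i t`_j = (i == j)%:R) ->
  (let r := x - \sum_(i < size t) f x t`_i *: t`_i in f r r = 0) ->
  f x x = \sum_(i < size t) `|f x t`_i| ^+ 2.
Proof.
move=> tP /=; set r := x - _ => r0.
rewrite -[X in f X _](subrK (\sum_(i < size t) f x t`_i *: t`_i)) -/r.
rewrite psdDl psd_null// add0r psd_suml; apply: eq_bigr => i _.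
by rewrite psdZl (psdC x) normCK.
Qed.

Lemma psd_null_sum (I : finType) (c : I -> C) (x : I -> V) :
  (forall i, f (x i) (x i) = 0) -> f (\sum_i c i *: x i) (\sum_i c i *: x i) = 0.
Proof.
by move=> x0; rewrite psd_suml big1// => i _; rewrite psdZl psd_null ?mulr0.
Qed.

(* The norm inequality on [C^K] passes to any positive form, because Gram
   matrices are sums of rank one matrices. *)
Lemma psd_matrix_le (I K : finType) (B : I -> K -> C) (m : C) (x : K -> V) :
  (forall v : K -> C,
    \sum_i `|\sum_k B i k * v k| ^+ 2 <= m * \sum_k `|v k| ^+ 2) ->
  \sum_i f (\sum_k B i k *: x k) (\sum_k B i k *: x k) <= m * \sum_k f (x k) (x k).
Proof.
move=> Bm; have [t [tP xt]] := psd_orthonormalize [seq x k | k <- index_enum K].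
have {}xt k := xt (x k) (map_f x (mem_index_enum k)).
have {}xt k : f (x k) (x k) = \sum_(i < size t) `|f (x k) t`_i| ^+ 2 /\
    let r := x k - \sum_(i < size t) f (x k) t`_i *: t`_i in f r r = 0.
  by split; [exact: psd_parseval|exact: xt].
have Bt i : let y := \sum_k B i k *: x k in
    f y y = \sum_(j < size t) `|\sum_k B i k * f (x k) t`_j| ^+ 2.
  move=> y; rewrite (psd_parseval tP) /=.
    by apply: eq_bigr => j _; rewrite psd_suml; do 2 f_equal; apply: eq_bigr => k _; rewrite psdZl.
  have -> : y - \sum_(i < size t) f y t`_i *: t`_i =
      \sum_k B i k *: (x k - \sum_(i < size t) f (x k) t`_i *: t`_i).
    rewrite /y; under [RHS]eq_bigr do rewrite scalerBr scaler_sumr; rewrite sumrB exchange_big/=; congr (_ - _).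
    apply: eq_bigr => j _; rewrite psd_suml scaler_suml; apply: eq_bigr => k _.
    by rewrite psdZl scalerA.
  by apply: (psd_null_sum (B i)) => k; case: (xt k).
under eq_bigr do rewrite Bt; rewrite exchange_big/=.
under [X in _ <= _ * X]eq_bigr => k _ do rewrite (proj1 (xt k)).
rewrite [X in _ <= _ * X]exchange_big/= mulr_sumr; apply: ler_sum => j _.
exact: (Bm (fun k => f (x k) t`_j)).
Qed.

End PositiveForms.

(** * Norms, roots of unity and Parseval's identity *)

Section Nrm.
Variable R : realType.
Local Notation C := R[i].
Implicit Types (V : normedZmodType C) (a b z : C).

Lemma nrmN V (x : V) : nrm (- x) = nrm x. Proof. by rewrite /nrm normrN. Qed.
Lemma nrmBC V (x y : V) : nrm (x - y) = nrm (y - x).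
Proof. by rewrite /nrm distrC. Qed.
Lemma ler_nrmB V (x y : V) : nrm x - nrm y <= nrm (x - y).
Proof. by rewrite lerBlDr -[X in nrm X <= _](subrK y) ler_nrmD. Qed.
Lemma nrm_eq0 V (x : V) : (nrm x == 0) = (x == 0).
Proof. by apply/eqP/eqP => [/nrm0_eq0//|->]; rewrite nrm0. Qed.
Lemma nrm_gt0 V (x : V) : (0 < nrm x) = (x != 0).
Proof. by rewrite lt_def nrm_ge0 andbT nrm_eq0. Qed.
Lemma ler_nrm_sum V (I : Type) (r : seq I) (P : pred I) (x : I -> V) :
  nrm (\sum_(i <- r | P i) x i) <= \sum_(i <- r | P i) nrm (x i).
Proof.
elim/big_rec2: _ => [|i y z _ le_yz]; first by rewrite nrm0.
by rewrite (le_trans (ler_nrmD _ _))// lerD2l.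
Qed.
Lemma nrmM a b : nrm (a * b) = nrm a * nrm b.
Proof. by apply: (@complexI R); rewrite rmorphM/= -!nrmE normrM. Qed.
Lemma nrm1 : nrm (1 : C) = 1. Proof. by rewrite /nrm normr1. Qed.
Lemma nrmX a n : nrm (a ^+ n) = nrm a ^+ n.
Proof. by elim: n => [|n IH]; rewrite ?nrm1// !exprS nrmM IH. Qed.
Lemma nrmV a : nrm a^-1 = (nrm a)^-1.
Proof. by apply: (@complexI R); rewrite fmorphV/= -!nrmE normfV. Qed.
Lemma nrm_real (x : R) : nrm (x%:C : C) = `|x|.
Proof. by rewrite /nrm normc_def/= expr0n/= addr0 sqrtr_sqr. Qed.
Lemma nrm_nat n : nrm (n%:R : C) = n%:R.
Proof. by rewrite -(rmorph_nat (real_complex R)) nrm_real ger0_norm. Qed.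
Lemma nrmCK a : ((nrm a) ^+ 2)%:C = a * a^*.
Proof. by rewrite -normCK nrmE rmorphXn. Qed.
Lemma Re_le_nrm a : complex.Re a <= nrm a.
Proof.
rewrite (le_trans (ler_norm _))// /nrm normc_def/= -sqrtr_sqr ler_wsqrtr//.
by rewrite lerDl sqr_ge0.
Qed.
Lemma nrm_sqr a : nrm a ^+ 2 = complex.Re a ^+ 2 + complex.Im a ^+ 2.
Proof. by rewrite /nrm normc_def/= sqr_sqrtr// addr_ge0 ?sqr_ge0. Qed.

Lemma nrm_horner_le (p : {poly C}) z : nrm z = 1 -> nrm p.[z] <= \sum_(j < size p) nrm p`_j.
Proof.
move=> z1; rewrite horner_coef (le_trans (ler_nrm_sum _ _ _))//.
by apply: ler_sum => j _; rewrite nrmM nrmX z1 expr1n mulr1.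
Qed.

End Nrm.

Section HilbertForms.
Variable R : realType.
Local Notation C := R[i].

Lemma hdot_psd (H : hilbertType R) : psd_form (fun x y : H => hdot x y).
Proof.
split=> [z a x y|x y|x]; first by rewrite linearPl.
- by rewrite (@hermC _ _ _ _ hdot y x) expr0 mul1r.
- by rewrite hdot_norm exprn_ge0.
Qed.

Lemma mulc_psd : psd_form (fun x y : C^o => x * y^*).
Proof.
split=> [z a x y|x y|x]; first by rewrite mulrDl mulrA.
- by rewrite rmorphM/= conjCK mulrC.
- by rewrite -normCK exprn_ge0.
Qed.

Lemma hdotE (H : hilbertType R) (x : H) : hdot x x = (nrm x ^+ 2)%:C.
Proof. by rewrite hdot_norm nrmE rmorphXn. Qed.

End HilbertForms.

Section RootsOfUnity.
Variable R : realType.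
Local Notation C := R[i].

Lemma prim_root_exists n : (0 < n)%N -> exists z : C, n.-primitive_root z.
Proof.
pose p : {poly C} := 'X^n - 1; have [r Dp] := closed_field_poly_normal p.
move=> n_gt0; rewrite (monicP _) ?monicXnsubC // scale1r in Dp.
have rn1: all n.-unity_root r by apply/allP=> z; rewrite -root_prod_XsubC -Dp.
have sz_r: (n < (size r).+1)%N.
  by rewrite -(size_prod_XsubC r id) -Dp size_XnsubC.
have [|z] := hasP (cyclic.has_prim_root n_gt0 rn1 _ sz_r); last by exists z.
by rewrite -separable.separable_prod_XsubC -Dp cyclotomic.separable_Xn_sub_1// pnatr_eq0 -lt0n.
Qed.

Variables (N : nat) (e : C).
Hypothesis eP : N.-primitive_root e.

Lemma prim_root_nrm t : nrm (e ^+ t) = 1.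
Proof.
have N0 := prim_order_gt0 eP.
rewrite nrmX; have /eqP -> : nrm e == 1; last by rewrite expr1n.
by rewrite -(pexpr_eq1 N0) ?nrm_ge0// -nrmX prim_expr_order// nrm1.
Qed.

Lemma prim_root_conj t : (e ^+ t)^* = (e ^+ t)^-1.
Proof. by rewrite invC_norm nrmE prim_root_nrm expr1n invr1 mul1r. Qed.

Lemma prim_root_orth n n' : (n < N)%N -> (n' < N)%N ->
  \sum_(t < N) (e ^+ t) ^+ n * ((e ^+ t) ^+ n')^* = (n == n')%:R * N%:R.
Proof.
move=> nN n'N; have N0 := prim_order_gt0 eP.
have e0 t : e ^+ t != 0 by rewrite -nrm_gt0 prim_root_nrm.
pose z := e ^+ n / e ^+ n'.
have zE t : (e ^+ t) ^+ n * ((e ^+ t) ^+ n')^* = z ^+ t.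
  by rewrite -!exprM prim_root_conj /z expr_div_n -!exprM ![(t * _)%N]mulnC.
under eq_bigr do rewrite zE.
have [nn'|nn'] := eqVneq n n'.
  have -> : z = 1 by rewrite /z nn' divff.
  by rewrite mul1r; under eq_bigr do rewrite expr1n; rewrite sumr_const card_ord.
rewrite mul0r; have z1 : z != 1.
  apply: contra nn' => /eqP z1; have /eqP := divr1_eq z1.
  by rewrite (eq_prim_root_expr eP) !modn_small.
apply/(mulfI (_ : z - 1 != 0)); first by rewrite subr_eq0.
have zN : z ^+ N = 1.
  by rewrite /z expr_div_n -!exprM ![(_ * N)%N]mulnC !exprM (prim_expr_order eP) !expr1n divr1.
by rewrite mulr0 -subrX1 zN subrr.
Qed.

Lemma psd_dft (V : lmodType C) (f : V -> V -> C) (fP : psd_form f) (G : nat -> V) :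
  \sum_(t < N) f (\sum_(n < N) (e ^+ t) ^+ n *: G n) (\sum_(n < N) (e ^+ t) ^+ n *: G n)
  = N%:R * \sum_(n < N) f (G n) (G n).
Proof.
under eq_bigr => t _.
  rewrite (psd_suml fP); under eq_bigr => n _.
    rewrite (psdZl fP) (psd_sumr fP) mulr_sumr.
    under eq_bigr do rewrite (psdZr fP) mulrA.
    over.
  over.
rewrite exchange_big/= mulr_sumr; apply: eq_bigr => n _.
rewrite exchange_big/= (bigD1 n)//= -mulr_suml prim_root_orth// eqxx mul1r.
rewrite big1 ?addr0// => n' n'n; rewrite -mulr_suml prim_root_orth//.
by rewrite eq_sym (negPf n'n : (val n' == val n) = false) mul0r mul0r.
Qed.

Lemma nrm_dft (V : normedModType C) (f : V -> V -> C) (fP : psd_form f)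
    (fE : forall x, f x x = (nrm x ^+ 2)%:C) (G : nat -> V) :
  \sum_(t < N) nrm (\sum_(n < N) (e ^+ t) ^+ n *: G n) ^+ 2
  = N%:R * \sum_(n < N) nrm (G n) ^+ 2.
Proof.
apply: (@complexI R); rewrite rmorphM/= !rmorph_sum/= rmorph_nat.
under eq_bigr do rewrite -fE.
by rewrite (psd_dft fP); congr (_ * _); apply: eq_bigr => n _; rewrite fE.
Qed.

End RootsOfUnity.

(** * From the resolvent of an operator to that of its powers *)

Section PowerLowerBound.
Variables (R : realType).
Local Notation C := R[i].

(** For [s j = T^j y] the left side is [(w - T) u], with [u] the sum of the [w^-j T^j y]; the
    constant sequence 1 gives the scalar companion. *)
Lemma geometric_telescope (V : lmodType C) (w : C) (s : nat -> V) n : w != 0 ->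
  w *: (\sum_(j < n) w ^- j *: s j) - \sum_(j < n) w ^- j *: s j.+1
  = (w ^- n * w) *: (w ^+ n *: s 0 - s n).
Proof.
move=> w0; rewrite scaler_sumr -sumrB.
rewrite -(big_mkord xpredT (fun j => w *: (w ^- j *: s j) - w ^- j *: s j.+1)).
rewrite (eq_bigr (fun j => (- (w *: (w ^- j.+1 *: s j.+1))) - (- (w *: (w ^- j *: s j))))).
  rewrite telescope_sumr// expr0 invr1 scale1r opprK addrC.
  rewrite scalerBr !scalerA; congr (_ *: _ - _ *: _); last by rewrite mulrC.
  by rewrite mulrAC mulVf ?mul1r// expf_neq0.
move=> j _; rewrite opprK [RHS]addrC; congr (_ - _); rewrite scalerA; congr (_ *: _).
by rewrite exprS invfM mulrA divff// mul1r.
Qed.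

Variables (H : hilbertType R) (T : 'B(H, H)) (c M : R).
Hypothesis c0 : 0 <= c.
Hypothesis M0 : 0 <= M.
Hypothesis Tc : forall w v, 1 <= nrm w -> w != 1 ->
  nrm (w - 1) * nrm v <= c * nrm (w *: v - T v).
Hypothesis TM : forall n v, nrm ((T ^+ n) v) <= M * nrm v.

(* The resolvent bound at the n-th roots w of l controls the Fourier
   transform of the orbit of y; Parseval's identity, used both for the orbit and
   for the constant sequence 1, sums these bounds without loss. *)
Lemma ritt_power_le n l y : (0 < n)%N -> 1 <= nrm l -> l != 1 ->
  nrm (l - 1) * nrm ((T ^+ n) y) <= c * M * nrm (l *: y - (T ^+ n) y).
Proof.
move=> n0 l1 lN1; have [e eP] := prim_root_exists R n0.
have l0 : l != 0 by rewrite -nrm_gt0 (lt_le_trans ltr01).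
have [w0 w0n] : exists w0 : C, w0 ^+ n = l.
  by exists (n.-root l); rewrite rootCK.
have w00 : w0 != 0 by apply: contra l0 => /eqP w00; rewrite -w0n w00 expr0n gtn_eqF.
have e0 t : e ^+ t != 0 by rewrite -nrm_gt0 (prim_root_nrm eP).
pose w t := w0 / e ^+ t.
have wn t : w t ^+ n = l.
  by rewrite /w expr_div_n w0n -exprM mulnC exprM (prim_expr_order eP) expr1n divr1.
have w_neq0 t : w t != 0 by rewrite mulf_neq0// invr_neq0.
have w_neq1 t : w t != 1.
  by apply: contra lN1 => /eqP w1; rewrite -(wn t) w1 expr1n.
have w1 t : 1 <= nrm (w t) by rewrite -(expr_ge1 n0) ?nrm_ge0// -nrmX wn.
pose x := l *: y - (T ^+ n) y.
(* The weights [r] do not depend on the root [w t], so [u t] and [d t] are the Fourier transforms at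
   [e^t] of the sequences [r_j T^j y] and [r_j]. *)
pose r j := w0 ^- j.
pose u t := \sum_(j < n) (e ^+ t) ^+ j *: (r j *: (T ^+ j) y).
pose d t := \sum_(j < n) (e ^+ t) ^+ j *: (r j : C^o).
have wVj t j : (e ^+ t) ^+ j * r j = w t ^- j.
  by rewrite /w /r expr_div_n invfM invrK mulrC.
have uE t : w t *: u t - T (u t) = (l^-1 * w t) *: x.
  have -> : u t = \sum_(j < n) w t ^- j *: (T ^+ j) y.
    by apply: eq_bigr => j _; rewrite scalerA wVj.
  have -> : T (\sum_(j < n) w t ^- j *: (T ^+ j) y) = \sum_(j < n) w t ^- j *: (T ^+ j.+1) y.
    by rewrite (linear_sum T); apply: eq_bigr => j _; rewrite linearZ/= exprS.
  by rewrite (geometric_telescope (fun j => (T ^+ j) y))// wn.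
have dE t : w t * d t - d t = l^-1 * w t * (l - 1).
  have -> : d t = \sum_(j < n) w t ^- j *: (1 : C^o).
    by apply: eq_bigr => j _; rewrite -wVj /GRing.scale/= mulr1.
  have := geometric_telescope (fun j => (1 : C^o)) n (w_neq0 t).
  by rewrite wn /GRing.scale/= mulr1 mulrA.
(* The factor [w t - 1] of the Ritt condition, which varies with the root, is removed by
   [(w t - 1) d t = (w t / l) (l - 1)]. *)
have ud t : nrm (l - 1) * nrm (u t) <= c * nrm x * nrm (d t).
  have w10 : 0 < nrm (w t - 1) by rewrite nrm_gt0 subr_eq0.
  rewrite -(ler_pM2l w10) mulrCA.
  have -> : nrm (w t - 1) * (c * nrm x * nrm (d t)) = c * nrm x * nrm (l^-1 * w t * (l - 1)).
    have -> : l^-1 * w t * (l - 1) = (w t - 1) * d t by rewrite -dE mulrBl mul1r.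
    by rewrite [in RHS]nrmM mulrCA.
  rewrite nrmM [X in _ <= X]mulrA [X in _ <= X]mulrC; apply: ler_wpM2l; first exact: nrm_ge0.
  rewrite (le_trans (Tc _ (w1 t) (w_neq1 t)))// uE !nrmZ nrmM; lra.
have : nrm (l - 1) ^+ 2 * (n%:R * \sum_(j < n) nrm (r j *: (T ^+ j) y) ^+ 2) <=
       (c * nrm x) ^+ 2 * (n%:R * \sum_(j < n) nrm (r j : C^o) ^+ 2).
  rewrite -(nrm_dft eP (hdot_psd H) (@hdotE _ H) (fun j => r j *: (T ^+ j) y)).
  rewrite -(nrm_dft eP (mulc_psd R) (fun z => esym (nrmCK z)) (fun j => r j)).
  rewrite !mulr_sumr; apply: ler_sum => t _; rewrite -!exprMn ler_sqr ?nnegrE ?mulr_ge0 ?nrm_ge0//.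
  exact: ud.
set A := \sum_(j < n) _; set B := \sum_(j < n) _.
have AB : nrm ((T ^+ n) y) ^+ 2 * B <= M ^+ 2 * A.
  rewrite !mulr_sumr; apply: ler_sum => j _.
  have -> : M ^+ 2 * nrm (r j *: (T ^+ j) y) ^+ 2 = (M * nrm ((T ^+ j) y)) ^+ 2 * nrm (r j) ^+ 2.
    by rewrite nrmZ; ring.
  apply: ler_wpM2r; first by rewrite exprn_ge0// nrm_ge0.
  rewrite ler_sqr ?nnegrE ?mulr_ge0 ?nrm_ge0//.
  have -> : (T ^+ n) y = (T ^+ (n - j)) ((T ^+ j) y).
    by rewrite -[LHS]/((T ^+ n) y) -{1}(subnK (ltnW (ltn_ord j))) exprD.
  exact: TM.
have B0 : 0 < B.
  rewrite /B; case: (n) n0 => // k _; rewrite big_ord_recl ltr_pwDl//.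
    by rewrite exprn_gt0// nrm_gt0 /r expr0 invr1 oner_neq0.
  by rewrite sumr_ge0// => i _; rewrite exprn_ge0 ?nrm_ge0.
have nR : 0 < n%:R :> R by rewrite ltr0n.
rewrite mulrCA [X in _ <= X]mulrCA ler_pM2l// => lAB.
rewrite -(@ler_sqr _ (_ * _)) ?nnegrE ?mulr_ge0 ?nrm_ge0//.
rewrite -(ler_pM2r B0) -/x.
have -> : (nrm (l - 1) * nrm ((T ^+ n) y)) ^+ 2 * B = nrm (l - 1) ^+ 2 * (nrm ((T ^+ n) y) ^+ 2 * B).
  by ring.
rewrite (le_trans (ler_wpM2l _ AB)) ?exprn_ge0 ?nrm_ge0//.
rewrite mulrCA (le_trans (ler_wpM2l _ lAB)) ?exprn_ge0// le_eqVlt; apply/orP; left.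
by apply/eqP; ring.
Qed.

End PowerLowerBound.

(** * Polynomial calculus and inverses *)

Section PolyCalc.
Variables (R : realType) (H : normedModType R[i]).
Local Notation C := R[i].
Implicit Types (f g S : 'B(H, H)) (p q : {poly C}).

Lemma boundedop_sumE (E F : normedModType C) (I : Type) (r : seq I) (P : pred I) (f : I -> 'B(E, F)) x :
  (\sum_(i <- r | P i) f i) x = \sum_(i <- r | P i) f i x.
Proof. exact: (big_morph (fun g : 'B(E, F) => g x)). Qed.

Lemma poly_calc_wide p S n : (size p <= n)%N ->
  poly_calc p S = \sum_(j < n) p`_j *: S ^+ j.
Proof.
move=> pn; rewrite /poly_calc -!(big_mkord xpredT (fun j => p`_j *: S ^+ j)).
rewrite [RHS](big_cat_nat (n := size p))//= [X in _ = _ + X]big_nat_cond [X in _ = _ + X]big1 ?addr0//.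
by move=> j /andP[/andP[pj _] _]; rewrite nth_default ?scale0r.
Qed.

Lemma poly_calcE p S n x : (size p <= n)%N ->
  poly_calc p S x = \sum_(j < n) p`_j *: (S ^+ j) x.
Proof. by move=> pn; rewrite (poly_calc_wide S pn) boundedop_sumE. Qed.

Lemma poly_calc_linear a p q S :
  poly_calc (a *: p + q) S = a *: poly_calc p S + poly_calc q S.
Proof.
pose n := maxn (size (a *: p + q)) (maxn (size p) (size q)).
rewrite !(@poly_calc_wide _ _ n) /n ?leq_max ?leqnn ?orbT//.
rewrite scaler_sumr -big_split; apply: eq_bigr => j _.
by rewrite coefD coefZ scalerDl scalerA.
Qed.

Lemma poly_calc0 S : poly_calc 0 S = 0.
Proof. by rewrite /poly_calc size_poly0 big_ord0. Qed.
Lemma poly_calcD p q S : poly_calc (p + q) S = poly_calc p S + poly_calc q S.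
Proof. by have := poly_calc_linear 1 p q S; rewrite !scale1r. Qed.
Lemma poly_calcZ a p S : poly_calc (a *: p) S = a *: poly_calc p S.
Proof. by have := poly_calc_linear a p 0 S; rewrite !addr0 poly_calc0 addr0. Qed.
Lemma poly_calcB p q S : poly_calc (p - q) S = poly_calc p S - poly_calc q S.
Proof. by rewrite poly_calcD -scaleN1r poly_calcZ scaleN1r. Qed.
Lemma poly_calc1 S : poly_calc 1 S = 1.
Proof. by rewrite /poly_calc size_poly1 big_ord1 coef1 scale1r expr0. Qed.
Lemma poly_calc_sum (I : Type) (r : seq I) (P : pred I) (p : I -> {poly C}) S :
  poly_calc (\sum_(i <- r | P i) p i) S = \sum_(i <- r | P i) poly_calc (p i) S.
Proof.
by apply: (big_morph (fun p => poly_calc p S)) => [p1 p2|]; rewrite ?poly_calcD ?poly_calc0.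
Qed.

Lemma boundedop_scaleAl a f g : (a *: f) * g = a *: (f * g).
Proof. exact: boundedopP. Qed.
Lemma boundedop_scaleAr a f g : f * (a *: g) = a *: (f * g).
Proof. by apply: boundedopP => x; rewrite -[LHS]/(f (a *: g x)) linearZ. Qed.

Lemma poly_calcXM q S : poly_calc ('X * q) S = S * poly_calc q S.
Proof.
rewrite (@poly_calc_wide _ _ (size q).+1); last first.
  by have := size_polyMleq 'X q; rewrite size_polyX.
rewrite big_ord_recl coefXM scale0r add0r mulr_sumr; apply: eq_bigr => j _.
by rewrite coefXM/= boundedop_scaleAr exprS.
Qed.

Lemma poly_calcX S : poly_calc 'X S = S.
Proof. by rewrite -['X]mulr1 poly_calcXM poly_calc1 mulr1. Qed.

Lemma poly_calcC c S : poly_calc c%:P S = c *: (1 : 'B(H, H)).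
Proof. by rewrite -[c%:P]mulr1 mul_polyC poly_calcZ poly_calc1. Qed.

Lemma poly_calcM p q S : poly_calc (p * q) S = poly_calc p S * poly_calc q S.
Proof.
elim/poly_ind: p q => [|p c IH] q; first by rewrite mul0r poly_calc0 mul0r.
rewrite mulrDl -mulrA poly_calcD IH poly_calcXM mul_polyC poly_calcZ.
rewrite poly_calcD IH poly_calcX poly_calcC mulrDl -mulrA.
by rewrite boundedop_scaleAl mul1r.
Qed.

Lemma poly_calcXn n S : poly_calc ('X^n) S = S ^+ n.
Proof. by elim: n => [|n IH]; rewrite ?poly_calc1// !exprS poly_calcM IH poly_calcX. Qed.

End PolyCalc.

Section Archimedean.
Variable R : realType.

Lemma gt0_complex (e : R[i]) : 0 < e -> exists2 e' : R, 0 < e' & e = e'%:C.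
Proof.
case: e => a b; rewrite ltcE/= => /andP[/eqP b0 a0]; exists a => //.
by rewrite b0.
Qed.

Lemma expr_small (q e : R) : 0 <= q -> q < 1 -> 0 < e ->
  exists N, forall n, (N <= n)%N -> q ^+ n < e.
Proof.
move=> q0 q1 e0; have : `|q| < 1 by rewrite ger0_norm.
move=> /cvg_expr/cvgrPdist_lt/(_ _ e0)[N _ NP]; exists N => n Nn.
by have := NP n Nn; rewrite /= sub0r normrN ger0_norm// exprn_ge0.
Qed.

Lemma geometric_sum_le (q : R) n : 0 <= q -> q < 1 -> \sum_(k < n) q ^+ k <= (1 - q)^-1.
Proof.
move=> q0 q1; rewrite -[X in _ <= X]div1r ler_pdivlMr ?subr_gt0// mulrC.
by rewrite -opprB mulNr -subrX1 opprB lerBlDr lerDl exprn_ge0.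
Qed.

End Archimedean.

Section Inverses.
Variables (R : realType) (H : hilbertType R).
Local Notation C := R[i].
Implicit Types (f g T X : 'B(H, H)).

Lemma nrm_opX f n v : nrm ((f ^+ n) v) <= nrm f ^+ n * nrm v.
Proof.
elim: n v => [|n IH] v; first by rewrite expr0 mul1r.
rewrite exprS -[X in nrm X]/(f ((f ^+ n) v)) (le_trans (nrm_boundedop _ _))//.
by rewrite exprS -mulrA ler_wpM2l// opnorm_ge0.
Qed.

Lemma bounded_below_inverse f (K : R) :
  (forall v, nrm v <= K * nrm (f v)) -> (forall y, exists x, f x = y) ->
  exists X, is_inverse f X.
Proof.
move=> fK /choice[g fg].
have f_inj x y : f x = f y -> x = y.
  move=> fxy; apply/eqP; rewrite -subr_eq0 -nrm_eq0 eq_le nrm_ge0 andbT.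
  by rewrite (le_trans (fK _))// linearB/= fxy subrr nrm0 mulr0.
have gP : g \in @bounded_linear_pred R H H.
  apply/asboolP; split=> [a x y|]; first by apply: f_inj; rewrite linearP/= !fg.
  by exists K => x; rewrite -{2}(fg x).
exists (BoundedOp gP); split; apply: boundedopP => x; last exact: fg.
by apply: f_inj; exact: (fg (f x)).
Qed.

(** Of the Neumann series only surjectivity is kept: injectivity and the norm of the inverse come
    later from lower bounds, through [bounded_below_inverse]. *)
Lemma neumann_surj f : nrm f < 1 -> forall y, exists x, x - f x = y.
Proof.
move=> f1 y; pose u n : H := (f ^+ n) y; pose q := nrm f.
have q0 : 0 <= q by exact: nrm_ge0.
have tail m n : nrm (\sum_(m <= k < n) u k) <= q ^+ m * (nrm y / (1 - q)).
  have [nm|/ltnW mn] := leqP n m.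
    by rewrite big_geq// nrm0 mulr_ge0 ?exprn_ge0// divr_ge0 ?nrm_ge0// subr_ge0 ltW.
  rewrite (le_trans (ler_nrm_sum _ _ _))//.
  have : \sum_(m <= k < n) nrm (u k) <= (\sum_(m <= k < n) q ^+ k) * nrm y.
    by rewrite mulr_suml; apply: ler_sum => k _; exact: nrm_opX.
  move/le_trans; apply; rewrite mulrCA mulrC; apply: ler_wpM2l; first exact: nrm_ge0.
  rewrite -[X in \sum_(X <= _ < _) _]add0n big_addn.
  rewrite (eq_bigr (fun k => q ^+ m * q ^+ k)); last by move=> k _; rewrite exprD mulrC.
  rewrite -mulr_sumr; apply: ler_wpM2l; first exact: exprn_ge0.
  by rewrite big_mkord geometric_sum_le.
have y0 : 0 <= nrm y / (1 - q) by rewrite divr_ge0 ?nrm_ge0// subr_ge0 ltW.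
have small e : 0 < e -> exists N, forall n, (N <= n)%N -> q ^+ n * (nrm y / (1 - q)) < e.
  move=> e0; have [|N NP] := @expr_small R q (e / (nrm y / (1 - q) + 1)) q0 f1.
    by rewrite divr_gt0// ltr_wpDl.
  exists N => n /NP; rewrite ltr_pdivlMr ?ltr_wpDl//; apply: le_lt_trans.
  by rewrite ler_wpM2l ?exprn_ge0// lerDl.
have : cvg (series u @ \oo).
  apply/cauchy_cvgP/cauchy_seriesP => e /gt0_complex[e' e'0 ->].
  have [N NP] := small _ e'0; exists ([set k | (N <= k)%N], setT).
    by split; [exists N|exact: filterT].
  by move=> [m n] [/= Nm _]; rewrite nrmE ltcR (le_lt_trans (tail _ _))// NP.
move=> /cvg_ex[x ux]; exists x; apply/eqP; rewrite -subr_eq0 -nrm_eq0 eq_le nrm_ge0 andbT.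
apply/ler_addgt0Pr => e e0; rewrite add0r; pose e2 := e / 4.
have e20 : 0 < e2 by rewrite divr_gt0.
have [N1 N1P] := small _ e20; move/cvgrPdist_lt : ux => /(_ (e2%:C)).
rewrite ltcR => /(_ e20)[N2 _ N2P]; pose n := maxn N1 N2.
pose s := series u n; have xs : nrm (x - s) < e2.
  by have := N2P n (leq_maxr _ _); rewrite nrmE ltcR.
(* By telescoping, the partial sum [s] solves the equation up to [f^n y]; since [f] does not
   increase norms, the limit [x] solves it up to [3 e2 < e]. *)
have sE : s - f s = y - (f ^+ n) y.
  rewrite /s /series/= linear_sum/= -sumrB.
  rewrite (eq_bigr (fun k => (- u k.+1) - (- u k))); last first.
    by move=> k _; rewrite opprK addrC /u exprS.
  by rewrite telescope_sumr// opprK addrC /u expr0.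
have -> : x - f x - y = (x - s) - f (x - s) - (f ^+ n) y.
  have -> : x - f x - y = x - f x - (s - f s) - (f ^+ n) y.
    by rewrite sE [in RHS]opprD opprK addrA addrK.
  rewrite (linearB f)/=; congr (_ - _). by rewrite !opprD !opprK addrACA.
have fn : nrm ((f ^+ n) y) < e2.
  apply: le_lt_trans (N1P n (leq_maxl _ _)).
  rewrite (le_trans (nrm_opX _ _ _))// ler_wpM2l ?exprn_ge0//.
  rewrite ler_pdivlMr ?subr_gt0// ler_piMr ?nrm_ge0// gerBl//.
have fxs : nrm (f (x - s)) <= nrm (x - s).
  by rewrite (le_trans (nrm_boundedop _ _))// ler_piMl ?nrm_ge0// ltW.
have := ler_nrmD (x - s - f (x - s)) (- (f ^+ n) y).
have := ler_nrmD (x - s) (- f (x - s)).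
rewrite !nrmN => h1 h2; rewrite (le_trans h2)//.
have : e = 4 * e2 by rewrite /e2; field.
lra.
Qed.

End Inverses.

(** * Ritt operators and their powers *)

Section RittResolvent.
Variables (R : realType) (H : hilbertType R).
Local Notation C := R[i].
Implicit Types (S T X : 'B(H, H)).

Lemma inverse_normE S X : is_inverse S X -> inverse_norm S = (nrm X)%:E.
Proof.
move=> [XS SX]; rewrite /inverse_norm.
rewrite (_ : [set _ | _ in _] = [set (nrm X)%:E]) ?ereal_inf1//.
apply/seteqP; split=> [_ [Y [/= YS SY] <-]|_ ->]; last by exists X.
by rewrite -(mulr1 Y) -SX mulrA YS mul1r.
Qed.

Lemma inverse_norm_lty S : (inverse_norm S < +oo)%E -> exists X, is_inverse S X.
Proof.
move=> S_oo; apply: contrapT => /forallNP noX; move: S_oo.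
rewrite /inverse_norm (_ : [set X | _] = set0) ?image_set0 ?ereal_inf0//.
by apply/seteqP; split=> // X /noX.
Qed.

Lemma inverse_norm_ge0 S : (0 <= inverse_norm S)%E.
Proof. by apply: le_ereal_inf_tmp => _ [X _ <-]; rewrite lee_fin nrm_ge0. Qed.

Lemma resolventE (w : C) T v : (w *: (1 : 'B(H, H)) - T) v = w *: v - T v.
Proof. by []. Qed.

Lemma ritt_const_ge0 T : (0 <= ritt_const T)%E.
Proof.
apply: le_trans (ereal_sup_ubound _); last first.
  by exists 2%:R => //=; rewrite nrm_nat ltr1n.
by rewrite mule_ge0 ?inverse_norm_ge0// lee_fin nrm_ge0.
Qed.

Variable T : 'B(H, H).
Hypothesis T_fin : (ritt_const T < +oo)%E.
Local Notation c := (fine (ritt_const T)).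

Lemma ritt_constE : ritt_const T = c%:E.
Proof. by rewrite fineK// ge0_fin_numE ?ritt_const_ge0. Qed.

Lemma ritt_c_ge0 : 0 <= c.
Proof. by rewrite fine_ge0 ?ritt_const_ge0. Qed.

Lemma resolvent_outside w : 1 < nrm w ->
  exists2 X, is_inverse (w *: (1 : 'B(H, H)) - T) X & nrm (w - 1) * nrm X <= c.
Proof.
move=> w1; have w10 : 0 < nrm (w - 1).
  rewrite nrm_gt0 subr_eq0; apply: contraTneq w1 => ->.
  by rewrite nrm1 ltxx.
have wc : ((nrm (w - 1)%R)%:E * inverse_norm (w *: (1 : 'B(H, H)) - T)%R <= c%:E)%E.
  by rewrite -ritt_constE; apply: ereal_sup_ubound; exists w.
have [|X XP] := @inverse_norm_lty (w *: (1 : 'B(H, H)) - T).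
  rewrite ltNge leye_eq; apply/negP => /eqP wX; move: wc.
  by rewrite wX gt0_muley ?lte_fin// leye_eq.
by exists X => //; move: wc; rewrite (inverse_normE XP) -EFinM lee_fin.
Qed.

(** The Ritt constant speaks only of [|w| > 1]. Stated as a lower bound for [w - T], its estimate
    passes to the circle by letting [z = (1 + d) w] tend to [w]. *)
Lemma resolvent_le w v : 1 <= nrm w -> w != 1 ->
  nrm (w - 1) * nrm v <= c * nrm (w *: v - T v).
Proof.
move=> w1 w_neq1; apply/ler_addgt0Pr => e e0.
(* Moving from [w] to [z] changes each side by a multiple of [|z - w| = e / k]; the total error
   [(1 + c) |v| e / k] is at most [e], and the summand 1 keeps [k] positive. *)
pose k := (1 + c) * nrm v + 1.
have k0 : 0 < k by rewrite ltr_wpDl// mulr_ge0 ?nrm_ge0// addr_ge0 ?ritt_c_ge0.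
pose d := e / (k * nrm w); have w0 : 0 < nrm w by rewrite (lt_le_trans ltr01).
have d0 : 0 < d by rewrite divr_gt0// mulr_gt0.
pose z := w + d%:C * w.
have zw : nrm (d%:C * w) = e / k.
  by rewrite nrmM nrm_real gtr0_norm// /d; field; rewrite !gt_eqF.
have z1 : 1 < nrm z.
  rewrite /z -{1}[w]mul1r -mulrDl nrmM -(rmorph1 (real_complex R)) -rmorphD/= nrm_real.
  rewrite ger0_norm ?addr_ge0 ?(ltW d0)// (lt_le_trans (_ : 1 < 1 + d)) ?ltrDl//.
  by rewrite ler_peMr// addr_ge0 ?(ltW d0).
have [X [XP _] Xc] := resolvent_outside z1.
have vE : v = X (z *: v - T v) by rewrite -[LHS]/((1 : 'B(H, H)) v) -XP.
have h1 : nrm (z - 1) * nrm v <= c * nrm (z *: v - T v).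
  rewrite {1}vE (le_trans (ler_wpM2l (nrm_ge0 _) (nrm_boundedop _ _)))// mulrA.
  by rewrite ler_wpM2r ?nrm_ge0.
have h2 : nrm (z *: v - T v) <= nrm (w *: v - T v) + e / k * nrm v.
  rewrite -zw -nrmZ (_ : z *: v - T v = (w *: v - T v) + (d%:C * w) *: v) ?ler_nrmD//.
  by rewrite /z scalerDl addrAC.
have h3 : nrm (w - 1) <= nrm (z - 1) + e / k.
  rewrite -zw -[X in _ <= _ + X]nrmN (_ : w - 1 = z - 1 + - (d%:C * w)) ?ler_nrmD//.
  by rewrite /z addrAC addrK.
have v0 := nrm_ge0 v; have c0 := ritt_c_ge0.
have h4 : e / k * ((1 + c) * nrm v) <= e.
  by rewrite mulrAC ler_pdivrMr// ler_wpM2l ?(ltW e0)// lerDl.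
have := ler_wpM2r v0 h3; have := ler_wpM2l c0 h2; nra.
Qed.

(** With [X] the inverse of [z - T] for some [z] outside the disc, [(w - T) X = 1 - (z - w) X]; this
    is onto when [z] is close to [w], because [X] stays bounded as [z] tends to [w]. *)
Lemma resolvent_surj w : 1 <= nrm w -> w != 1 -> forall y, exists x, w *: x - T x = y.
Proof.
move=> w1 w_neq1 y; have w10 : 0 < nrm (w - 1) by rewrite nrm_gt0 subr_eq0.
have w0 : 0 < nrm w by rewrite (lt_le_trans ltr01).
have c0 := ritt_c_ge0.
(* Then [|z - 1| >= |w - 1| - e = (2 c + 1) e], whence [e |X| <= c / (2 c + 1) < 1]. *)
pose e := nrm (w - 1) / (2 * (c + 1)).
have e0 : 0 < e by rewrite divr_gt0// mulr_gt0// ltr_wpDl.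
pose d := e / nrm w; have d0 : 0 < d by rewrite divr_gt0.
pose z := w + d%:C * w.
have zw : nrm (d%:C * w) = e.
  by rewrite nrmM nrm_real gtr0_norm// /d mulfVK// gt_eqF.
have z1 : 1 < nrm z.
  rewrite /z -{1}[w]mul1r -mulrDl nrmM -(rmorph1 (real_complex R)) -rmorphD/= nrm_real.
  rewrite ger0_norm ?addr_ge0 ?(ltW d0)// (lt_le_trans (_ : 1 < 1 + d)) ?ltrDl//.
  by rewrite ler_peMr// addr_ge0 ?(ltW d0).
have [X [_ XP] Xc] := resolvent_outside z1.
have h3 : nrm (w - 1) <= nrm (z - 1) + e.
  rewrite -zw -[X in _ <= _ + X]nrmN (_ : w - 1 = z - 1 + - (d%:C * w)) ?ler_nrmD//.
  by rewrite /z addrAC addrK.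
have e2 : 2 * (c + 1) * e = nrm (w - 1) by rewrite /e mulrC mulfVK// gt_eqF// mulr_gt0// ltr_wpDl.
have Z1 : nrm ((d%:C * w) *: X) < 1.
  rewrite nrmZ zw; have X0 := nrm_ge0 X.
  rewrite ltNge; apply/negP => eX; nra.
have [u uE] := neumann_surj Z1 y.
exists (X u); rewrite -uE.
have -> : w *: X u - T (X u) = (z *: X u - T (X u)) - (d%:C * w) *: X u.
  by rewrite /z scalerDl addrAC addrK.
by rewrite -resolventE -[X in X - _ = _]/((_ * X) u) XP.
Qed.

Lemma poly_calc_surj (r : seq C) :
  (forall w, w \in r -> 1 <= nrm w /\ w != 1) ->
  forall y, exists x, poly_calc (\prod_(w <- r) ('X - w%:P)) T x = y.
Proof.
elim: r => [|w r IH] rP y; first by exists y; rewrite big_nil poly_calc1.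
have [w1 w_neq1] := rP w (mem_head _ _).
have [x xE] := resolvent_surj w1 w_neq1 (- y).
have [|x' x'E] := IH _ x; first by move=> z zr; apply: rP; rewrite inE zr orbT.
exists x'; rewrite big_cons poly_calcM poly_calcB poly_calcX poly_calcC.
rewrite -[LHS]/((T - w *: (1 : 'B(H, H))) (poly_calc _ T x')) x'E.
by rewrite -[LHS]/(T x - w *: x) -opprB xE opprK.
Qed.

(** ['X^n - l] splits into factors ['X - w] with [w^n = l]; all these roots have modulus at least 1
    and differ from 1, so every factor gives an operator that is onto. *)
Lemma power_resolvent_surj n l : (0 < n)%N -> 1 <= nrm l -> l != 1 ->
  forall y, exists x, l *: x - (T ^+ n) x = y.
Proof.
move=> n0 l1 l_neq1 y; pose p : {poly C} := 'X^n - l%:P.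
have [r Dp] := closed_field_poly_normal p.
rewrite (monicP _) ?monicXnsubC // scale1r in Dp.
have [|x xE] := @poly_calc_surj r _ (- y).
  move=> w; rewrite -root_prod_XsubC -Dp /root !hornerE subr_eq0 => /eqP wn.
  split; first by rewrite -(expr_ge1 n0) ?nrm_ge0// -nrmX wn.
  by apply: contra l_neq1 => /eqP w1; rewrite -wn w1 expr1n.
exists x; move: xE; rewrite -Dp poly_calcB poly_calcXn poly_calcC.
by rewrite -[LHS]/((T ^+ n) x - l *: x) => /(congr1 -%R); rewrite opprB opprK.
Qed.

Variable M : R.
Hypothesis M0 : 0 <= M.
Hypothesis TM : forall n v, nrm ((T ^+ n) v) <= M * nrm v.

Lemma ritt_power n l y : (0 < n)%N -> 1 <= nrm l -> l != 1 ->
  nrm (l - 1) * nrm ((T ^+ n) y) <= c * M * nrm (l *: y - (T ^+ n) y).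
Proof. exact: (ritt_power_le ritt_c_ge0 M0 resolvent_le TM). Qed.

(** Split [l y = (l y - T^n y) + T^n y] and apply [ritt_power] to the second term. The division by
    [|l|] keeps [|l - 1|] times the bound finite for large [l]: it is at most
    [(|l| + 1 + c M) / |l| <= c M + 2]. *)
Lemma power_resolvent_le n l y : (0 < n)%N -> 1 <= nrm l -> l != 1 ->
  nrm y <= (1 + c * M / nrm (l - 1)) / nrm l * nrm (l *: y - (T ^+ n) y).
Proof.
move=> n0 l1 l_neq1; have l10 : 0 < nrm (l - 1) by rewrite nrm_gt0 subr_eq0.
have l0 : 0 < nrm l by rewrite (lt_le_trans ltr01).
rewrite mulrAC ler_pdivlMr// mulrC -nrmZ mulrDl mul1r.
have -> : l *: y = (l *: y - (T ^+ n) y) + (T ^+ n) y by rewrite subrK.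
rewrite (le_trans (ler_nrmD _ _))// addrK lerD2l mulrAC ler_pdivlMr// mulrC.
exact: ritt_power.
Qed.

Lemma power_resolvent n l : (0 < n)%N -> 1 <= nrm l -> l != 1 ->
  exists2 X, is_inverse (l *: (1 : 'B(H, H)) - T ^+ n) X &
    nrm X <= (1 + c * M / nrm (l - 1)) / nrm l.
Proof.
move=> n0 l1 l_neq1.
have [X XP] := @bounded_below_inverse _ _ (l *: (1 : 'B(H, H)) - T ^+ n) _
  (fun y => power_resolvent_le y n0 l1 l_neq1) (power_resolvent_surj n0 l1 l_neq1).
exists X => //; apply: opnorm_le.
  by rewrite divr_ge0 ?nrm_ge0// addr_ge0// divr_ge0 ?nrm_ge0// mulr_ge0 ?ritt_c_ge0.
move=> x; apply: le_trans (power_resolvent_le (X x) n0 l1 l_neq1) _.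
suff -> : l *: X x - (T ^+ n) (X x) = x by [].
by rewrite -[LHS]/(((l *: (1 : 'B(H, H)) - T ^+ n) * X) x) (proj2 XP).
Qed.

End RittResolvent.

Section RittPowers.
Variables (R : realType) (H : hilbertType R) (T : 'B(H, H)).
Local Notation C := R[i].
Hypothesis T_fin : (ritt_const T < +oo)%E.
Local Notation c := (fine (ritt_const T)).

(** Positivity excludes the convention [0 * +oo = 0]: when the power bound is infinite, the
    right-hand sides of (i) and (ii) are then [+oo]. *)
Lemma ritt_c_gt0 : (exists x : H, x != 0) -> 0 < c.
Proof.
move=> [x x0]; have n2 : (1 : R) < nrm (2%:R : C) by rewrite nrm_nat ltr1n.
have [X [_ XP] Xc] := resolvent_outside T_fin n2.
apply: lt_le_trans Xc; rewrite (_ : 2%:R - 1 = 1 :> C); last by rewrite -[2%:R]/(1 + 1) addrK.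
rewrite nrm1 mul1r nrm_gt0; apply: contraNneq x0 => X0; move: XP; rewrite X0 mulr0 => e.
by rewrite -[x]/((1 : 'B(H, H)) x) -e.
Qed.

Lemma power_bound_ge0 : (0 <= power_bound T)%E.
Proof.
apply: (@le_trans _ _ (nrm (T ^+ 0)%R)%:E); first by rewrite lee_fin nrm_ge0.
by apply: ereal_sup_ubound; exists 0%N.
Qed.

Lemma power_boundE v n : (power_bound T < +oo)%E ->
  nrm ((T ^+ n) v) <= fine (power_bound T) * nrm v.
Proof.
move=> M_fin; rewrite (le_trans (nrm_boundedop _ _))// ler_wpM2r ?nrm_ge0//.
rewrite -lee_fin fineK ?ge0_fin_numE ?power_bound_ge0//.
by apply: ereal_sup_ubound; exists n.
Qed.

Lemma contraction_power S n v : nrm S <= 1 -> nrm (((S : 'B(H, H)) ^+ n) v) <= nrm v.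
Proof.
move=> S1; rewrite (le_trans (nrm_opX _ _ _))// ler_piMl ?nrm_ge0//.
by rewrite exprn_ile1// nrm_ge0.
Qed.

Lemma ritt_const_power (M : R) n : 0 <= M ->
  (forall n v, nrm ((T ^+ n) v) <= M * nrm v) -> (0 < n)%N ->
  (ritt_const (T ^+ n)%R <= (c * M + 2)%R%:E)%E.
Proof.
move=> M0 TM n0; apply: ge_ereal_sup => _ [z /= z1 <-].
have z_neq1 : z != 1 by apply: contraTneq z1 => ->; rewrite nrm1 ltxx.
have z10 : 0 < nrm (z - 1) by rewrite nrm_gt0 subr_eq0.
have [X XP XM] := power_resolvent T_fin M0 TM n0 (ltW z1) z_neq1.
rewrite (inverse_normE XP) -EFinM lee_fin.
rewrite (le_trans (ler_wpM2l (nrm_ge0 _) XM))//.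
have z0 : 0 < nrm z by rewrite (lt_trans ltr01).
rewrite mulrA ler_pdivrMr// mulrDr mulr1 mulrCA divff ?gt_eqF// mulr1.
have : nrm (z - 1) <= nrm z + 1 by rewrite (le_trans (ler_nrmD _ _))// nrmN nrm1.
have := ritt_c_ge0 T => c0; have := mulr_ge0 c0 M0; nra.
Qed.

Lemma power_resolvent_sup (zeta : C) : (exists x : H, x != 0) ->
  nrm zeta = 1 -> zeta != 1 ->
  (ereal_sup [set inverse_norm (zeta *: (1 : 'B(H, H)) - T ^+ n)%R | n in [set n : nat | (0 < n)%N]]
     <= 1 + ritt_const T * power_bound T * ((nrm (zeta - 1)%R)^-1)%:E)%E.
Proof.
move=> H0 z1 z_neq1; have c0 := ritt_c_gt0 H0.
have z10 : 0 < nrm (zeta - 1) by rewrite nrm_gt0 subr_eq0.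
have [M_oo|M_fin] := leP +oo%E (power_bound T).
  move: M_oo; rewrite leye_eq => /eqP ->; rewrite (ritt_constE T_fin).
  by rewrite gt0_muley ?lte_fin// gt0_mulye ?lte_fin ?invr_gt0// addey ?leey.
have ME : power_bound T = (fine (power_bound T))%:E.
  by rewrite fineK// ge0_fin_numE ?power_bound_ge0.
apply: ge_ereal_sup => _ [n /= n0 <-].
have M0 : 0 <= fine (power_bound T) by rewrite fine_ge0 ?power_bound_ge0.
have [|X XP XM] := power_resolvent T_fin M0 (fun n v => power_boundE v n M_fin) n0 _ z_neq1.
  by rewrite z1.
rewrite (inverse_normE XP) ME (ritt_constE T_fin) -!EFinM -EFinD lee_fin.
by rewrite (le_trans XM)// z1 divr1.
Qed.

Lemma ritt_const_power_sup : (exists x : H, x != 0) ->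
  (ereal_sup [set ritt_const (T ^+ k)%R | k in [set n : nat | (0 < n)%N]]
     <= ritt_const T * power_bound T + 2%:E)%E.
Proof.
move=> H0; have c0 := ritt_c_gt0 H0.
have [M_oo|M_fin] := leP +oo%E (power_bound T).
  move: M_oo; rewrite leye_eq => /eqP ->; rewrite (ritt_constE T_fin).
  by rewrite gt0_muley ?lte_fin// leey.
have ME : power_bound T = (fine (power_bound T))%:E.
  by rewrite fineK// ge0_fin_numE ?power_bound_ge0.
apply: ge_ereal_sup => _ [n /= n0 <-].
have M0 : 0 <= fine (power_bound T) by rewrite fine_ge0 ?power_bound_ge0.
rewrite ME (ritt_constE T_fin) -EFinM -EFinD.
by apply: ritt_const_power => // k v; exact: power_boundE.
Qed.

Hypothesis T1 : nrm T <= 1.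

Lemma ritt_const_power_contraction_sup :
  (ereal_sup [set ritt_const (T ^+ k)%R | k in [set n : nat | (0 < n)%N]]
     <= ritt_const T + 2%:E)%E.
Proof.
apply: ge_ereal_sup => _ [n /= n0 <-]; rewrite (ritt_constE T_fin) -EFinD -[X in (X + _)%:E]mulr1.
by apply: ritt_const_power => // k v; rewrite mul1r contraction_power.
Qed.

Lemma parallelogram (x y : H) :
  nrm (x - y) ^+ 2 + nrm (x + y) ^+ 2 = 2 * nrm x ^+ 2 + 2 * nrm y ^+ 2.
Proof.
have fP := hdot_psd H; apply: (@complexI R).
have : hdot (x - y) (x - y) + hdot (x + y) (x + y) = 2%:R * hdot x x + 2%:R * hdot y y.
  rewrite (psdBl fP) (psdDl fP) !(psdBr fP) !(psdDr fP); ring.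
by rewrite !hdotE -!(rmorph_nat (real_complex R)) -!(rmorphM (real_complex R)) -!(rmorphD (real_complex R)).
Qed.

(** The point [l = -1] of [ritt_power] gives [2 a <= c s], where [a = |T^n y|], [b = |y|],
    [s = |y + T^n y|]. With [d = |y - T^n y|] the parallelogram law yields
    [d^2 <= 2 b^2 + (2 - 4 / c^2) a^2]. If [c^2 >= 2] the worst case is [a = b]. Otherwise this
    bound decreases in [a] while [d <= a + b] increases; they meet at [a = c b / (c + 2)]. *)
Lemma displacement_le n : (0 < n)%N ->
  nrm ((1 : 'B(H, H)) - T ^+ n) <= displacement_bound c.
Proof.
move=> n0; have c0 := ritt_c_ge0 T.
have c22 : 0 < c + 2 by rewrite ltr_wpDl.
have key y : let a := nrm ((T ^+ n) y) in let s := nrm (y + (T ^+ n) y) in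
    a <= nrm y /\ 2 * a <= c * s.
  split; first exact: contraction_power.
  have N1 : 1 <= nrm (-1 : C) by rewrite nrmN nrm1.
  have N_neq1 : (-1 : C) != 1 by rewrite -subr_eq0 -opprD oppr_eq0 -[1 + 1]/(2%:R : C) pnatr_eq0.
  have := ritt_power T_fin ler01 (fun n v => _ : nrm ((T ^+ n) v) <= 1 * nrm v) y n0 N1 N_neq1.
  rewrite mulr1 scaleN1r -!opprD !nrmN -[1 + 1]/(2%:R : C) nrm_nat.
  by apply=> k v; rewrite mul1r contraction_power.
have D0 : 0 <= displacement_bound c.
  rewrite /displacement_bound; case: ifP => _; last by rewrite mulr_ge0// sqrtr_ge0.
  by rewrite divr_ge0 ?(ltW c22)// mulr_ge0// addr_ge0.
apply: opnorm_le => // y; rewrite -[X in nrm X]/(y - (T ^+ n) y).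
have [] := key y; have := parallelogram y ((T ^+ n) y).
have := ler_nrmD y (- (T ^+ n) y); rewrite nrmN.
have := nrm_ge0 y; have := nrm_ge0 ((T ^+ n) y); have := nrm_ge0 (y + (T ^+ n) y).
have := nrm_ge0 (y - (T ^+ n) y).
move: (nrm y) (nrm ((T ^+ n) y)) (nrm (y + _)) (nrm (y - _)) => b a s d d0 s0 a0 b0 dab E ab acs.
have cs2 : 4 * a ^+ 2 <= c ^+ 2 * s ^+ 2.
  rewrite (_ : 4 * a ^+ 2 = (2 * a) ^+ 2) -?exprMn; last by ring.
  by rewrite ler_sqr ?nnegrE ?mulr_ge0.
have dE : d ^+ 2 = 2 * b ^+ 2 + 2 * a ^+ 2 - s ^+ 2 by lra.
(* Multiplied by [c^2], since at this point [c] may be 0. *)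
have cd : c ^+ 2 * d ^+ 2 <= 2 * c ^+ 2 * b ^+ 2 + 2 * a ^+ 2 * (c ^+ 2 - 2) by rewrite dE; nra.
rewrite /displacement_bound; have c2E : c <= Num.sqrt 2 = (c ^+ 2 <= 2).
  by rewrite -{2}[2](@sqr_sqrtr R)// ler_sqr ?nnegrE ?sqrtr_ge0.
rewrite c2E; case: (leP (c ^+ 2) 2) => c2 /=; first last.
  have c_gt0 : 0 < c ^+ 2 by lra.
  have cV : 0 <= 1 - c ^- 2 by rewrite subr_ge0 invf_le1//; lra.
  rewrite -ler_sqr ?nnegrE ?mulr_ge0 ?sqrtr_ge0//.
  rewrite !exprMn sqr_sqrtr// -(ler_pM2l c_gt0) (le_trans cd)//.
  have -> : c ^+ 2 * (2 ^+ 2 * (1 - c ^- 2) * b ^+ 2) = 4 * (c ^+ 2 - 1) * b ^+ 2.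
    by field; rewrite -sqrf_eq0 gt_eqF.
  have ab2 : a ^+ 2 <= b ^+ 2 by rewrite ler_sqr ?nnegrE.
  nra.
rewrite mulrAC ler_pdivlMr//.
(* Below the crossing point the triangle inequality is enough; above it [cd] is used, with the
   nonnegative factor [2 - c^2]. *)
have [small|big] := leP (a * (c + 2)) (c * b); first nra.
have c_gt0 : 0 < c.
  by rewrite lt_def c0 andbT; apply: contraTneq big => c00; nra.
rewrite -ler_sqr ?nnegrE ?mulr_ge0 ?addr_ge0//.
rewrite -(@ler_pM2l _ (c ^+ 2)) ?exprn_gt0//.
have big2 : (c * b) ^+ 2 <= (a * (c + 2)) ^+ 2.
  by rewrite ler_sqr ?nnegrE ?mulr_ge0 ?addr_ge0// ltW.
have c2' : 0 <= 2 - c ^+ 2 by rewrite subr_ge0.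
have h1 := ler_wpM2l c2' big2.
have h2 := ler_wpM2r (sqr_ge0 (c + 2)) cd.
have -> : c ^+ 2 * (d * (c + 2)) ^+ 2 = c ^+ 2 * d ^+ 2 * (c + 2) ^+ 2 by ring.
rewrite (le_trans h2)//.
rewrite (_ : c ^+ 2 * (2 * (c + 1) * b) ^+ 2 = 2 * c ^+ 2 * b ^+ 2 * (c + 2) ^+ 2 - 2 * ((2 - c ^+ 2) * (c * b) ^+ 2)); last by ring.
by rewrite (_ : (2 * c ^+ 2 * b ^+ 2 + 2 * a ^+ 2 * (c ^+ 2 - 2)) * (c + 2) ^+ 2 = 2 * c ^+ 2 * b ^+ 2 * (c + 2) ^+ 2 - 2 * ((2 - c ^+ 2) * (a * (c + 2)) ^+ 2)); [lra|ring].
Qed.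

End RittPowers.

(** * Von Neumann's inequality *)

Section VonNeumann.
Variable R : realType.
Local Notation C := R[i].

Lemma big_ord_shift (V : nmodType) (F : nat -> V) N j :
  (forall b, (b < j)%N -> F b = 0) -> (forall b, (N <= b)%N -> F b = 0) ->
  \sum_(n < N) F (n + j)%N = \sum_(b < N) F b.
Proof.
move=> F0 FN; rewrite -(big_mkord xpredT (fun n => F (n + j)%N)) -(big_mkord xpredT F).
have -> : \sum_(0 <= b < N) F b = \sum_(0 <= b < N + j) F b.
  rewrite [RHS](big_cat_nat (n := N)) ?leq_addr//= [X in _ = _ + X]big_nat_cond.
  by rewrite [X in _ = _ + X]big1 ?addr0// => b /andP[/andP[Nb _] _]; exact: FN.
rewrite [RHS](big_cat_nat (n := j)) ?leq_addl//= [X in _ = X + _]big_nat_cond.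
rewrite [X in _ = X + _]big1 ?add0r => [|b /andP[/andP[_ bj] _]]; last exact: F0.
by rewrite -{2}[j]add0n big_addn addnK.
Qed.

Lemma nrm_sqrC (V : normedZmodType C) (x : V) : (nrm x ^+ 2)%:C = `|x| ^+ 2.
Proof. by rewrite nrmE rmorphXn. Qed.

Lemma nrmC_le (I K : finType) (B : I -> K -> C) (m : R) :
  (forall v : K -> C,
    \sum_i nrm (\sum_k B i k * v k) ^+ 2 <= m * \sum_k nrm (v k) ^+ 2) ->
  forall v : K -> C,
    \sum_i `|\sum_k B i k * v k| ^+ 2 <= m%:C * \sum_k `|v k| ^+ 2.
Proof.
move=> Bm v; have := Bm v; rewrite -lecR rmorphM/= !rmorph_sum/=.
under eq_bigr do rewrite nrm_sqrC.
by under [X in _ <= _ * X]eq_bigr do rewrite nrm_sqrC.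
Qed.

Section Toeplitz.
Variables (V : lmodType C) (f : V -> V -> C).
Hypothesis fP : psd_form f.
Variables (I K : finType) (W : I -> K -> {poly C}) (m : R) (D : nat).
Hypothesis Wm : forall (zeta : C) (v : K -> C), nrm zeta = 1 ->
  \sum_i nrm (\sum_k (W i k).[zeta] * v k) ^+ 2 <= m * \sum_k nrm (v k) ^+ 2.
Hypothesis WD : forall i k, (size (W i k) <= D)%N.

(* [W] acts on finitely supported sequences as an upper triangular Toeplitz
   operator; on the Fourier side this is multiplication by the matrices
   [W(zeta)], [zeta] ranging over the N-th roots of unity. *)
Lemma toeplitz_le N (h : K -> nat -> V) :
  (forall k b, (b < D)%N -> h k b = 0) -> (forall k b, (N <= b)%N -> h k b = 0) ->
  \sum_(n < N) \sum_i (let y := \sum_k \sum_(j < D) (W i k)`_j *: h k (n + j)%N in f y y)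
  <= m%:C * \sum_(n < N) \sum_k f (h k n) (h k n).
Proof.
case: N => [|N'] h0 hN; first by rewrite !big_ord0 mulr0.
set N := N'.+1 in hN *; have [e eP] := prim_root_exists R (isT : (0 < N)%N).
pose g i n := \sum_k \sum_(j < D) (W i k)`_j *: h k (n + j)%N.
pose hh k t := \sum_(n < N) (e ^+ t) ^+ n *: h k n.
have e0 t : e ^+ t != 0 by rewrite -nrm_gt0 (prim_root_nrm eP).
(* A shift by [j] multiplies the transform by [(e^t)^-j]; the zeros of [h] below [D] and from [N] on
   exclude any wrap-around. *)
have gE i t : \sum_(n < N) (e ^+ t) ^+ n *: g i n = \sum_k (W i k).[(e ^+ t)^-1] *: hh k t.
  under eq_bigr do rewrite scaler_sumr; rewrite exchange_big/=; apply: eq_bigr => k _.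
  under eq_bigr do rewrite scaler_sumr; rewrite exchange_big/=.
  rewrite (horner_coef_wide _ (WD i k)) scaler_suml; apply: eq_bigr => j _.
  pose F b := (e ^+ t) ^+ b *: h k b.
  rewrite -[hh k t](@big_ord_shift _ F N j); last 2 first.
  - by move=> b bj; rewrite /F h0 ?scaler0// (ltn_trans bj).
  - by move=> b Nb; rewrite /F hN ?scaler0.
  rewrite scaler_sumr; apply: eq_bigr => n _; rewrite /F !scalerA; congr (_ *: _).
  by rewrite exprD exprVn; field; rewrite expf_neq0.
have N0 : 0 < N%:R :> C by rewrite ltr0n.
rewrite -(ler_pM2l N0) [X in _ * X <= _]exchange_big/= [X in X <= _]mulr_sumr.
under [X in X <= _]eq_bigr => i _ do rewrite -(psd_dft eP fP (g i)).
rewrite [X in _ <= _ * (_ * X)]exchange_big/= mulrCA [N%:R * _]mulr_sumr.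
under [X in _ <= _ * X]eq_bigr => k _ do rewrite -(psd_dft eP fP (h k)).
rewrite [X in X <= _]exchange_big/= [X in _ <= _ * X]exchange_big/= [X in _ <= X]mulr_sumr; apply: ler_sum => t _.
under eq_bigr do rewrite gE.
apply: psd_matrix_le => //; apply: nrmC_le => v; apply: Wm.
by rewrite nrmV (prim_root_nrm eP) invr1.
Qed.

End Toeplitz.

Variables (H : hilbertType R) (I K : finType) (W : I -> K -> {poly C}) (m : R).
Hypothesis m0 : 0 <= m.
Hypothesis Wm : forall (zeta : C) (v : K -> C), nrm zeta = 1 ->
  \sum_i nrm (\sum_k (W i k).[zeta] * v k) ^+ 2 <= m * \sum_k nrm (v k) ^+ 2.
Implicit Types S : 'B(H, H).

Lemma defect_psd S : nrm S <= 1 ->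
  psd_form (fun x y : H => hdot x y - hdot (S x) (S y)).
Proof.
move=> S1; have fP := hdot_psd H; split=> [z a x y|x y|x].
- by rewrite /= linearP/= !(psdDl fP) !(psdZl fP); ring.
- by rewrite /= rmorphB/= -!(psdC fP).
- rewrite /= !hdotE subr_ge0 lecR ler_sqr ?nnegrE ?nrm_ge0//.
  by rewrite (le_trans (nrm_boundedop _ _))// ler_piMl ?nrm_ge0.
Qed.

(* The defect form [|x|^2 - |S x|^2] telescopes along orbits, so that [x] is
   represented isometrically by the sequence [S^a x] in that form, on which [S]
   acts as the backward shift. *)
Lemma strict_von_neumann S (x : K -> H) : nrm S < 1 ->
  \sum_i nrm (\sum_k poly_calc (W i k) S (x k)) ^+ 2 <= m * \sum_k nrm (x k) ^+ 2.
Proof.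
move=> S1; have fP := defect_psd (ltW S1); set f := (fun _ _ => _) in fP.
pose D := \max_(p : I * K) size (W p.1 p.2).
have WD i k : (size (W i k) <= D)%N.
  exact: (@leq_bigmax _ (fun p : I * K => size (W p.1 p.2)) (i, k)).
pose w i := \sum_k poly_calc (W i k) S (x k).
have fE n y : f ((S ^+ n) y) ((S ^+ n) y) =
    (- (nrm ((S ^+ n.+1) y) ^+ 2) - (- (nrm ((S ^+ n) y) ^+ 2)))%:C.
  by rewrite /f !hdotE (exprS S n) opprK [in RHS]addrC rmorphB.
have ftel n y : \sum_(a < n) f ((S ^+ a) y) ((S ^+ a) y) =
    (nrm y ^+ 2 - nrm ((S ^+ n) y) ^+ 2)%:C.
  under eq_bigr do rewrite fE; rewrite -rmorph_sum/=.
  rewrite -(big_mkord xpredT (fun a => - (nrm ((S ^+ a.+1) y) ^+ 2) - (- (nrm ((S ^+ a) y) ^+ 2)))).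
  by rewrite (telescope_sumr (fun a => - (nrm ((S ^+ a) y) ^+ 2)))// expr0 opprK addrC.
have key n : \sum_i (nrm (w i) ^+ 2 - nrm ((S ^+ n) (w i)) ^+ 2) <= m * \sum_k nrm (x k) ^+ 2.
  (* The [D] leading places are the padding demanded by [toeplitz_le]; the orbit is continued to
     [n + D] powers so that the [n] output entries starting at [D] are exactly the [S^a (w i)]. *)
  pose N := (D + (n + D))%N.
  pose h k b : H := if (D <= b < N)%N then (S ^+ (b - D)) (x k) else 0.
  have h0 k b : (b < D)%N -> h k b = 0 by rewrite /h ltnNge => /negPf ->.
  have hN k b : (N <= b)%N -> h k b = 0 by rewrite /h andbC ltnNge => ->.
  have := toeplitz_le fP Wm WD h0 hN.
  have hD k a : (a < n + D)%N -> h k (D + a)%N = (S ^+ a) (x k).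
    by move=> aN; rewrite /h leq_addr/= ltn_add2l aN addKn.
  have hsum k : \sum_(b < N) f (h k b) (h k b) = (nrm (x k) ^+ 2 - nrm ((S ^+ (n + D)) (x k)) ^+ 2)%:C.
    rewrite -ftel /N big_split_ord/= big1 ?add0r.
      by apply: eq_bigr => a _; rewrite hD.
    by move=> b _; rewrite h0// (psd0l fP).
  rewrite [X in _ <= _ * X]exchange_big/=; under [X in _ <= _ * X]eq_bigr do rewrite hsum.
  rewrite /N big_split_ord/= => le1; rewrite -lecR.
  apply: le_trans (le_trans le1 _); last first.
    rewrite -rmorph_sum/= -rmorphM/= lecR ler_wpM2l// ler_sum// => k _.
    by rewrite lerBlDr lerDl sqr_ge0.
  (* The output entries outside these [n] places are nonnegative and are dropped. *)
  rewrite big_split_ord/= addrCA; apply: ler_wpDr.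
    apply: addr_ge0; apply: sumr_ge0 => b _; apply: sumr_ge0 => i _; exact: (psd_ge0 fP).
  rewrite exchange_big/= rmorph_sum/=; apply: ler_sum => i _.
  rewrite -ftel; apply: ler_sum => a _ /=.
  rewrite le_eqVlt; apply/orP; left; apply/eqP.
  have -> : (S ^+ a) (w i) = \sum_k \sum_(j < D) (W i k)`_j *: h k (D + a + j)%N.
    rewrite (linear_sum (S ^+ a)); apply: eq_bigr => k _.
    rewrite (poly_calcE _ _ (WD i k)) (linear_sum (S ^+ a)); apply: eq_bigr => j _.
    rewrite linearZ/= -addnA hD; last by rewrite -addnS leq_add// ltnW.
    by rewrite exprD.
  by [].
apply/ler_addgt0Pr => e e0; set B := m * _ in key *.
pose A := \sum_i nrm (w i) ^+ 2.
have A0 : 0 <= A by apply: sumr_ge0 => i _; rewrite sqr_ge0.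
have q1 : nrm S ^+ 2 < 1 by rewrite expr_lt1 ?nrm_ge0.
have [|n nP] := expr_small (sqr_ge0 (nrm S)) q1 (_ : 0 < e / (A + 1)).
  by rewrite divr_gt0// ltr_wpDl.
have := key n; rewrite sumrB -/A lerBlDr => /le_trans; apply; rewrite lerD2l.
apply: (@le_trans _ _ (\sum_i (e / (A + 1)) * nrm (w i) ^+ 2)).
  apply: ler_sum => i _; apply: (@le_trans _ _ ((nrm S ^+ n * nrm (w i)) ^+ 2)).
    by rewrite ler_sqr ?nnegrE ?mulr_ge0 ?exprn_ge0 ?nrm_ge0// nrm_opX.
  by rewrite exprMn ler_wpM2r ?sqr_ge0// exprAC ltW// nP.
rewrite -mulr_sumr -/A mulrAC ler_pdivrMr ?ltr_wpDl//.
by rewrite ler_wpM2l ?(ltW e0)// lerDl.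
Qed.

(** The strict case is applied to [r S] with [r = 1 - d]; passing to the limit is explicit, by
    [1 - r^j <= j d] on each coefficient. *)
Theorem von_neumann S (x : K -> H) : nrm S <= 1 ->
  \sum_i nrm (\sum_k poly_calc (W i k) S (x k)) ^+ 2 <= m * \sum_k nrm (x k) ^+ 2.
Proof.
move=> S1; pose D := \max_(p : I * K) size (W p.1 p.2).
have WD i k : (size (W i k) <= D)%N.
  exact: (@leq_bigmax _ (fun p : I * K => size (W p.1 p.2)) (i, k)).
pose w i := \sum_k poly_calc (W i k) S (x k).
pose u i j := \sum_k (W i k)`_j *: (S ^+ j) (x k).
pose U i := \sum_(j < D) nrm (u i j).
have U0 i : 0 <= U i by apply: sumr_ge0 => j _; rewrite nrm_ge0.
have wE i : w i = \sum_(j < D) u i j.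
  rewrite exchange_big/=; apply: eq_bigr => k _; exact: poly_calcE.
apply/ler_addgt0Pr => e e0; set B := m * _.
pose Z := \sum_i 2 * nrm (w i) * U i.
have Z0 : 0 <= Z by apply: sumr_ge0 => i _; rewrite !mulr_ge0 ?nrm_ge0.
pose d := e / (e + D%:R * Z + 1).
have dd : 0 < e + D%:R * Z + 1 by rewrite ltr_wpDl// addr_ge0 ?mulr_ge0// ltW.
have d0 : 0 < d by rewrite divr_gt0.
have d1 : d < 1.
  by rewrite ltr_pdivrMr// mul1r -addrA ltrDl ltr_wpDl// mulr_ge0.
pose r := 1 - d; have r0 : 0 <= r by rewrite subr_ge0 ltW.
have r1 : r < 1 by rewrite gtrBl.
have dZ : D%:R * d * Z <= e.
  rewrite mulrAC /d mulrA ler_pdivrMr// mulrC ler_wpM2l ?(ltW e0)//.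
  lra.
pose s : 'B(H, H) := r%:C *: S.
have s1 : nrm s < 1.
  rewrite nrmZ nrm_real ger0_norm//; apply: le_lt_trans r1.
  by rewrite ler_piMr.
have sX n y : (s ^+ n) y = (r%:C ^+ n) *: (S ^+ n) y.
  elim: n => [|n IH]; first by rewrite !expr0 scale1r.
  rewrite exprS -[LHS]/(r%:C *: S ((s ^+ n) y)) IH linearZ scalerA -exprS.
  by rewrite (exprS S n).
pose ws i := \sum_k poly_calc (W i k) s (x k).
have wsE i : ws i = \sum_(j < D) r%:C ^+ j *: u i j.
  rewrite /ws; under eq_bigr do rewrite (poly_calcE _ _ (WD _ _)).
  rewrite exchange_big/=; apply: eq_bigr => j _; rewrite scaler_sumr.
  by apply: eq_bigr => k _; rewrite sX !scalerA mulrC.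
have wws i : nrm (w i) <= nrm (ws i) + D%:R * d * U i.
  rewrite -[w i](subrK (ws i)) addrC (le_trans (ler_nrmD _ _))// lerD2l.
  rewrite wE wsE -sumrB (le_trans (ler_nrm_sum _ _ _))// mulr_sumr.
  apply: ler_sum => j _; rewrite -{1}[u i j]scale1r -scalerBl nrmZ ler_wpM2r ?nrm_ge0//.
  rewrite -rmorphXn -(rmorph1 (real_complex R)) -rmorphB/= nrm_real ger0_norm; last first.
    by rewrite subr_ge0 exprn_ile1// ltW.
  rewrite -opprB subrX1 -mulNr opprB (_ : 1 - r = d); last by rewrite /r opprB addrC subrK.
  rewrite mulrC ler_wpM2r ?(ltW d0)//.
  rewrite (le_trans (_ : _ <= \sum_(a < j) 1))//.
    by apply: ler_sum => a _; rewrite exprn_ile1// ltW.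
  by rewrite sumr_const card_ord ler_nat ltnW.
have := strict_von_neumann x s1; rewrite -/B -[X in X <= _]/(\sum_i nrm (ws i) ^+ 2) => le1.
apply: (@le_trans _ _ (\sum_i nrm (ws i) ^+ 2 + D%:R * d * Z)); last exact: lerD.
rewrite mulr_sumr -big_split/=; apply: ler_sum => i _; rewrite -/(w i).
have c0 : 0 <= D%:R * d * U i by rewrite mulr_ge0 ?U0// mulr_ge0 ?ler0n ?(ltW d0).
have -> : D%:R * d * (2 * nrm (w i) * U i) = 2 * nrm (w i) * (D%:R * d * U i) by ring.
have := wws i; have := nrm_ge0 (ws i); have := nrm_ge0 (w i).
move: (nrm (w i)) (nrm (ws i)) (D%:R * d * U i) c0 => a b c c0 a0 b0 abc.
(* From [a <= b + c] follows [a^2 <= b^2 + 2 a c]: square [a - c <= b] if [c <= a]; otherwise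
   [a^2 <= 2 a c] already. *)
have [ca|ac] := leP c a; nra.
Qed.

End VonNeumann.

(** * Matrix polynomials *)

Section L2Norms.
Variable R : realType.
Local Notation C := R[i].

Lemma l2norm_ge0 (V : normedZmodType C) d (x : 'I_d -> V) : 0 <= l2norm x.
Proof. exact: sqrtr_ge0. Qed.

Lemma l2norm_sqr (V : normedZmodType C) d (x : 'I_d -> V) :
  l2norm x ^+ 2 = \sum_i nrm (x i) ^+ 2.
Proof. by rewrite sqr_sqrtr// sumr_ge0// => i _; rewrite sqr_ge0. Qed.

Lemma l2norm_le (V V' : normedZmodType C) d r (x : 'I_d -> V) (y : 'I_r -> V') (k : R) :
  0 <= k -> \sum_i nrm (y i) ^+ 2 <= k ^+ 2 * \sum_i nrm (x i) ^+ 2 ->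
  l2norm y <= k * l2norm x.
Proof.
move=> k0 yx; rewrite -ler_sqr ?nnegrE ?mulr_ge0 ?l2norm_ge0//.
by rewrite exprMn !l2norm_sqr.
Qed.

Lemma l2norm0 (V : normedZmodType C) d : l2norm (fun _ : 'I_d => 0 : V) = 0.
Proof. by rewrite /l2norm big1 ?sqrtr0// => i _; rewrite nrm0 expr0n. Qed.

Lemma nrm_le_l2norm (V : normedZmodType C) d (x : 'I_d -> V) i : nrm (x i) <= l2norm x.
Proof.
rewrite -ler_sqr ?nnegrE ?l2norm_ge0 ?nrm_ge0// l2norm_sqr (bigD1 i)//= lerDl.
by rewrite sumr_ge0// => j _; rewrite sqr_ge0.
Qed.

Lemma l2opnorm_le (V V' : normedZmodType C) d r (f : ('I_d -> V) -> 'I_r -> V') (k : R) :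
  0 <= k -> (forall x, l2norm (f x) <= k * l2norm x) -> l2opnorm f <= k.
Proof.
move=> k0 fk; apply: ge_sup.
  by exists (l2norm (f (fun=> 0))), (fun=> 0); rewrite //= l2norm0 ler01.
by move=> _ [x /= x1 <-]; rewrite (le_trans (fk x))// ler_piMr.
Qed.

Lemma sum_sqr_le (I : finType) (b : I -> R) : (forall i, 0 <= b i) ->
  \sum_i b i ^+ 2 <= (\sum_i b i) ^+ 2.
Proof.
move=> b0; rewrite expr2 mulr_sumr; apply: ler_sum => i _; rewrite expr2 ler_wpM2r//.
by rewrite (bigD1 i)//= lerDl sumr_ge0.
Qed.

Variables (r d : nat).
Implicit Types (B : 'M[C]_(r, d)) (v : 'I_d -> C).

Definition mxapp B v : 'I_r -> C := fun i => \sum_k B i k * v k.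

Lemma mxapp_le_sum B v : l2norm (mxapp B v) <= (\sum_i \sum_k nrm (B i k)) * l2norm v.
Proof.
have s0 i : 0 <= \sum_k nrm (B i k) by apply: sumr_ge0 => k _; rewrite nrm_ge0.
apply: l2norm_le; first by apply: sumr_ge0.
rewrite -(l2norm_sqr v) (le_trans _ (ler_wpM2r (sqr_ge0 _) (sum_sqr_le s0)))//.
rewrite mulr_suml; apply: ler_sum => i _; rewrite -exprMn.
rewrite ler_sqr ?nnegrE ?mulr_ge0 ?nrm_ge0 ?l2norm_ge0//.
rewrite (le_trans (ler_nrm_sum _ _ _))// mulr_suml; apply: ler_sum => k _.
by rewrite nrmM ler_wpM2l ?nrm_ge0// nrm_le_l2norm.
Qed.

Lemma mxnorm_has_sup B : has_sup [set l2norm (mxapp B x) | x in [set x | l2norm x <= 1]].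
Proof.
split; first by exists (l2norm (mxapp B (fun=> 0))), (fun=> 0); rewrite //= l2norm0 ler01.
exists (\sum_i \sum_k nrm (B i k)) => _ [x /= x1 <-].
rewrite (le_trans (mxapp_le_sum _ _))// ler_piMr// sumr_ge0// => i _.
by rewrite sumr_ge0// => k _; rewrite nrm_ge0.
Qed.

Lemma mxnorm_ge0 B : 0 <= mxnorm B.
Proof.
apply: (@le_trans _ _ (l2norm (mxapp B (fun=> 0)))); first exact: l2norm_ge0.
apply: ub_le_sup; first by case: (mxnorm_has_sup B).
by exists (fun=> 0); rewrite //= l2norm0 ler01.
Qed.

Lemma mxnormP B v : l2norm (mxapp B v) <= mxnorm B * l2norm v.
Proof.
have [v0|v0] := eqVneq (l2norm v) 0.
  by rewrite v0 mulr0 (le_trans (mxapp_le_sum _ _))// v0 mulr0.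
have {}v0 : 0 < l2norm v by rewrite lt_def v0 l2norm_ge0.
rewrite -ler_pdivrMr//.
have scal (a : R) n (y : 'I_n -> C) : 0 <= a ->
    l2norm (fun i => a%:C * y i) = a * l2norm y.
  move=> a0; apply/eqP; rewrite -(@eqrXn2 _ 2) ?mulr_ge0 ?l2norm_ge0//.
  rewrite exprMn !l2norm_sqr mulr_sumr; apply/eqP; apply: eq_bigr => i _.
  by rewrite nrmM nrm_real ger0_norm// exprMn.
have vV0 : 0 <= (l2norm v)^-1 by rewrite invr_ge0 ltW.
have -> : l2norm (mxapp B v) / l2norm v = l2norm (mxapp B (fun k => (l2norm v)^-1%:C * v k)).
  rewrite mulrC -scal//; congr l2norm; apply: boolp.funext => i.
  by rewrite /mxapp mulr_sumr; apply: eq_bigr => k _; rewrite mulrCA.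
apply: ub_le_sup; first by case: (mxnorm_has_sup B).
by eexists; [|reflexivity]; rewrite /= scal// mulVf// gt_eqF.
Qed.

Lemma mxnorm_le_sum B : mxnorm B <= \sum_i \sum_k nrm (B i k).
Proof.
apply: l2opnorm_le; last exact: mxapp_le_sum.
by apply: sumr_ge0 => i _; apply: sumr_ge0 => k _; rewrite nrm_ge0.
Qed.

Lemma mxpoly_norm_has_sup (W : 'M[{poly C}]_(r, d)) :
  has_sup [set mxnorm (mxeval W z) | z in unit_circle R].
Proof.
split; first by exists (mxnorm (mxeval W 1)), 1 => //=; rewrite /unit_circle/= nrm1.
exists (\sum_i \sum_k \sum_(j < size (W i k)) nrm (W i k)`_j) => _ [z /= z1 <-].
rewrite (le_trans (mxnorm_le_sum _))//; apply: ler_sum => i _; apply: ler_sum => k _.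
by rewrite mxE nrm_horner_le.
Qed.

Lemma mxpoly_norm_ge (W : 'M[{poly C}]_(r, d)) z :
  nrm z = 1 -> mxnorm (mxeval W z) <= mxpoly_norm W.
Proof.
move=> z1; apply: ub_le_sup; last by exists z.
by case: (mxpoly_norm_has_sup W).
Qed.

Lemma mxpoly_norm_ge0 (W : 'M[{poly C}]_(r, d)) : 0 <= mxpoly_norm W.
Proof. by rewrite (le_trans (mxnorm_ge0 (mxeval W 1)))// mxpoly_norm_ge// nrm1. Qed.

Lemma mxpoly_normP (W : 'M[{poly C}]_(r, d)) z v : nrm z = 1 ->
  \sum_i nrm (\sum_k (W i k).[z] * v k) ^+ 2 <= mxpoly_norm W ^+ 2 * \sum_k nrm (v k) ^+ 2.
Proof.
move=> z1; rewrite -(l2norm_sqr v) -exprMn.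
have -> : \sum_i nrm (\sum_k (W i k).[z] * v k) ^+ 2 = l2norm (mxapp (mxeval W z) v) ^+ 2.
  rewrite l2norm_sqr; apply: eq_bigr => i _; congr (nrm _ ^+ 2).
  by apply: eq_bigr => k _; rewrite mxE.
rewrite ler_sqr ?nnegrE ?mulr_ge0 ?l2norm_ge0 ?mxpoly_norm_ge0//.
by rewrite (le_trans (mxnormP _ _))// ler_wpM2r ?l2norm_ge0// mxpoly_norm_ge.
Qed.

End L2Norms.

Section MatrixCalculus.
Variables (R : realType) (H : hilbertType R).
Local Notation C := R[i].
Implicit Types S : 'B(H, H).

Lemma mxpoly_calcM r d n (B : 'M[{poly C}]_(r, d)) (A : 'M[{poly C}]_(d, n)) S x i :
  mxpoly_calc (B *m A) S x i = mxpoly_calc B S (mxpoly_calc A S x) i.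
Proof.
rewrite /mxpoly_calc.
under [RHS]eq_bigr do rewrite (linear_sum (poly_calc _ _)).
rewrite [RHS]exchange_big/=; apply: eq_bigr => k _.
rewrite mxE poly_calc_sum boundedop_sumE; apply: eq_bigr => j _.
by rewrite poly_calcM.
Qed.

Lemma mxpoly_calc_adj d (A : 'M[{poly C}]_d) S x i :
  mxpoly_calc (\adj A) S (mxpoly_calc A S x) i = poly_calc (\det A) S (x i).
Proof.
rewrite -mxpoly_calcM mul_adj_mx /mxpoly_calc (bigD1 i)//= mxE eqxx mulr1n.
rewrite big1 ?addr0// => k /negPf ki.
by rewrite mxE eq_sym ki mulr0n poly_calc0.
Qed.

Lemma trC_sqnorm n (u : 'cV[C]_n) : (u ^t* *m u) ord0 ord0 = \sum_i `|u i ord0| ^+ 2.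
Proof. by rewrite mxE; apply: eq_bigr => i _; rewrite !mxE mulrC normCK. Qed.

Lemma trCM m n p (A : 'M[C]_(m, n)) (B : 'M[C]_(n, p)) :
  (A *m B) ^t* = B ^t* *m A ^t*.
Proof. by rewrite trmx_mul map_mxM. Qed.

(** The factorization says that the column [(W, A)] is a multiple of an isometry; [m] stands for the
    square of the norm here. *)
Lemma mx_complement_norm r d (W : 'M[C]_(r, d)) (A : 'M[C]_d) (m : R) (v : 'I_d -> C) :
  m%:C%:M - W ^t* *m W = A ^t* *m A ->
  \sum_i nrm (\sum_k W i k * v k) ^+ 2 + \sum_i nrm (\sum_k A i k * v k) ^+ 2
  = m * \sum_k nrm (v k) ^+ 2.
Proof.
move=> mWA; pose u : 'cV[C]_d := \col_k v k.
have E n (B : 'M[C]_(n, d)) : (\sum_i nrm (\sum_k B i k * v k) ^+ 2)%:C = (u ^t* *m (B ^t* *m B) *m u) ord0 ord0.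
  rewrite !mulmxA -trCM -mulmxA trC_sqnorm rmorph_sum/=; apply: eq_bigr => i _.
  by rewrite nrm_sqrC mxE; congr (`|_| ^+ 2); apply: eq_bigr => k _; rewrite mxE.
apply: (@complexI R); rewrite rmorphD/= !E -mWA mulmxBr mulmxBl [X in _ + X]mxE.
rewrite addrCA [X in _ + (_ + X)]mxE subrr addr0 mul_mx_scalar -scalemxAl mxE trC_sqnorm.
rewrite rmorphM/= rmorph_sum/=; congr (_ * _); apply: eq_bigr => k _.
by rewrite mxE nrm_sqrC.
Qed.

Variables (r d : nat) (W : 'M[{poly C}]_(r, d)) (A : 'M[{poly C}]_d) (m : R).
Hypothesis m0 : 0 <= m.
Hypothesis WA : forall zeta : C, nrm zeta = 1 ->
  (m ^+ 2)%:C%:M - (mxeval W zeta) ^t* *m mxeval W zeta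
  = (mxeval A zeta) ^t* *m mxeval A zeta.

Lemma mxpoly_complement_le S x : nrm S <= 1 ->
  \sum_i nrm (mxpoly_calc W S x i) ^+ 2 + \sum_i nrm (mxpoly_calc A S x i) ^+ 2
  <= m ^+ 2 * \sum_k nrm (x k) ^+ 2.
Proof.
move=> S1; pose WW (i : 'I_r + 'I_d) k := match i with inl i => W i k | inr i => A i k end.
have := @von_neumann _ H _ _ WW (m ^+ 2) (sqr_ge0 m) _ S x S1.
rewrite big_sumType/=; apply=> zeta v z1; rewrite big_sumType/= -(mx_complement_norm v (WA z1)).
rewrite le_eqVlt; apply/orP; left; apply/eqP.
by congr (_ + _); apply: eq_bigr => i _; congr (nrm _ ^+ 2); apply: eq_bigr => k _; rewrite mxE.
Qed.

Lemma adj_max_le S (x : 'I_d -> H) : nrm S <= 1 ->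
  \sum_i nrm (mxpoly_calc (\adj A) S x i) ^+ 2 <= adj_max A ^+ 2 * \sum_k nrm (x k) ^+ 2.
Proof.
move=> S1; have -> : adj_max A = mxpoly_norm (\adj A).
  by rewrite /adj_max /mxpoly_norm; under eq_imagel do rewrite /mxeval -map_mx_adj.
apply: (@von_neumann _ H _ _ (fun i k => (\adj A) i k)) => //; first exact: sqr_ge0.
by move=> z v; exact: mxpoly_normP.
Qed.

Hypothesis W1 : mxnorm (mxeval W 1) < m.

(** On a vector killed by [A(1)], [W(1)] would attain the factor [m], against [|W(1)| < m]. *)
Lemma complement_det1_neq0 : (\det A).[1] != 0.
Proof.
have -> : (\det A).[1] = \det (mxeval A 1).
  by rewrite -[LHS]/(horner_eval 1 (\det A)) -det_map_mx.
rewrite -det_tr; apply/det0P => -[v v0 vA].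
have Av i : \sum_k (mxeval A 1) i k * v ord0 k = 0.
  have := congr1 (fun M : 'rV[C]_d => M ord0 i) vA; rewrite mxE [X in _ = X]mxE; apply: etrans.
  by apply: eq_bigr => k _; rewrite [in RHS]mulrC [(_^T)%R _ _]mxE.
have := mx_complement_norm (fun k => v ord0 k) (WA (nrm1 R)).
rewrite [X in _ + X]big1 ?addr0 => [|i _]; last by rewrite Av nrm0 expr0n.
have [k vk] : exists k, v ord0 k != 0 by apply/rV0Pn.
rewrite -(l2norm_sqr (fun k => v ord0 k)) -(l2norm_sqr (mxapp (mxeval W 1) (fun k => v ord0 k))).
have l0 : 0 < l2norm (fun k => v ord0 k).
  by rewrite (lt_le_trans _ (nrm_le_l2norm _ k))// nrm_gt0.
rewrite -exprMn => /eqP; rewrite eqrXn2 ?mulr_ge0 ?l2norm_ge0// => /eqP e.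
have := mxnormP (mxeval W 1) (fun k => v ord0 k); rewrite e ler_pM2r// leNgt.
by rewrite W1.
Qed.

End MatrixCalculus.

(** * Outer matrix polynomials *)

Section PowerSeries.
Variable R : realType.
Local Notation C := R[i].

Lemma nrm_le_ReIm (z : C) : nrm z <= `|complex.Re z| + `|complex.Im z|.
Proof.
rewrite -ler_sqr ?nnegrE ?nrm_ge0 ?addr_ge0// nrm_sqr sqrrD !real_normK ?num_real//.
by rewrite -addrA [X in _ <= _ + X]addrC addrA lerDl mulrn_wge0// mulr_ge0.
Qed.

Lemma Im_le_nrm (z : C) : `|complex.Im z| <= nrm z.
Proof.
rewrite -ler_sqr ?nnegrE ?nrm_ge0// nrm_sqr real_normK ?num_real//.
by rewrite lerDr sqr_ge0.
Qed.

Lemma absRe_le_nrm (z : C) : `|complex.Re z| <= nrm z.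
Proof.
rewrite -ler_sqr ?nnegrE ?nrm_ge0// nrm_sqr real_normK ?num_real//.
by rewrite lerDl sqr_ge0.
Qed.

Lemma cvg_nrmP (V : normedModType C) (s : nat -> V) (l : V) :
  s @ \oo --> l <-> forall e : R, 0 < e -> \forall n \near \oo, nrm (l - s n) < e.
Proof.
split=> [/cvgrPdist_lt sl e e0|sl].
  have := sl e%:C; rewrite ltcR => /(_ e0); apply: filterS => n.
  by rewrite nrmE ltcR.
apply/cvgrPdist_lt => e /gt0_complex[e' e'0 ->].
by apply: filterS (sl _ e'0) => n; rewrite nrmE ltcR.
Qed.

Lemma cvg_complex (s : nat -> C^o) (a b : R) :
  (fun n => complex.Re (s n)) @ \oo --> a -> (fun n => complex.Im (s n)) @ \oo --> b ->
  s @ \oo --> ((a +i* b)%C : C^o).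
Proof.
move=> /cvgrPdist_lt sa /cvgrPdist_lt sb; apply/cvg_nrmP => e e0.
have e2 : 0 < e / 2 by rewrite divr_gt0.
near=> n; rewrite (le_lt_trans (nrm_le_ReIm _))// [e]splitr ltrD//.
  by rewrite raddfB/=; near: n; exact: sa.
by rewrite raddfB/=; near: n; exact: sb.
Unshelve. all: by end_near. Qed.

Lemma real_series_cvg (u : nat -> R) (K q : R) : 0 <= K -> 0 <= q -> q < 1 ->
  (forall k, `|u k| <= K * q ^+ k) -> cvgn (series u).
Proof.
move=> K0 q0 q1 uK; apply: normed_cvg.
apply: (@series_le_cvg _ (fun k => `|u k|) (geometric K q)) => // [k|].
  by rewrite /= mulr_ge0// exprn_ge0.
by apply: is_cvg_geometric_series; rewrite ger0_norm.
Qed.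

Lemma complex_series_cvg (u : nat -> C) (K q : R) : 0 <= K -> 0 <= q -> q < 1 ->
  (forall k, nrm (u k) <= K * q ^+ k) -> cvgn (series (u : nat -> C^o)).
Proof.
move=> K0 q0 q1 uK.
have ReS : cvgn (series (fun k => complex.Re (u k))).
  by apply: (real_series_cvg K0 q0 q1) => k; exact: le_trans (absRe_le_nrm _) (uK k).
have ImS : cvgn (series (fun k => complex.Im (u k))).
  by apply: (real_series_cvg K0 q0 q1) => k; exact: le_trans (Im_le_nrm _) (uK k).
move: ReS ImS => /cvg_ex[a ua] /cvg_ex[b ub].
apply/cvg_ex; exists ((a +i* b)%C); apply: cvg_complex.
  by apply: cvg_trans ua; apply: near_eq_cvg; apply: nearW => n; rewrite /series/= raddf_sum.
by apply: cvg_trans ub; apply: near_eq_cvg; apply: nearW => n; rewrite /series/= raddf_sum.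
Qed.

Lemma cvg_nrm_le (V : normedModType C) (s : nat -> V) (l : V) (B : R) :
  s @ \oo --> l -> (forall n, nrm (s n) <= B) -> nrm l <= B.
Proof.
move=> /cvg_nrmP sl sB; apply/ler_addgt0Pr => e e0.
have [n _ nP] := sl e e0; rewrite -[l](subrK (s n)) addrC (le_trans (ler_nrmD _ _))//.
by rewrite lerD// ltW// nP//=.
Qed.

Lemma cvg_finsum (V : normedModType C) (I : Type) (r : seq I) (F : I -> nat -> V) (l : I -> V) :
  (forall i, F i @ \oo --> l i) ->
  (fun n => \sum_(i <- r) F i n) @ \oo --> \sum_(i <- r) l i.
Proof.
move=> Fl; elim: r => [|i r IH].
  by rewrite big_nil; under eq_fun do rewrite big_nil; exact: cvg_cst.
by rewrite big_cons; under eq_fun do rewrite big_cons; exact: cvgD.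
Qed.

End PowerSeries.

Section Hardy.
Variables (R : realType) (d : nat).
Local Notation C := R[i].
Local Notation Cd := 'cV[C]_d.
Implicit Types (b f g : nat -> Cd) (M : {vspace Cd}) (v : 'I_d -> C).

Lemma vnorm_hardy2 M b k : hardy2 M b -> vnorm (b k) <= hardy2_norm b.
Proof.
move=> [_ bS]; pose u k := vnorm (b k) ^+ 2.
have u0 j : 0 <= u j by rewrite sqr_ge0.
have ser : {homo series u : n m / (n <= m)%N >-> n <= m}.
  by apply: nondecreasing_series => n _; rewrite u0.
have uk : u k <= limn (series u).
  apply: le_trans (nondecreasing_cvgn_le ser bS k.+1).
  rewrite /series/= big_nat_recr//= lerDr sumr_ge0//.
have l0 : 0 <= limn (series u) by rewrite (le_trans (u0 k)).
by rewrite -ler_sqr ?nnegrE ?sqrtr_ge0// [X in _ <= X]sqr_sqrtr.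
Qed.

Lemma hardy2_norm_ge0 b : 0 <= hardy2_norm b. Proof. exact: sqrtr_ge0. Qed.

Lemma hardy2_value_cvg M b z v : hardy2 M b -> nrm z < 1 ->
  series (fun k => z ^+ k * \sum_i v i * b k i ord0 : C^o) @ \oo -->
  (\sum_i v i * hardy2_value b z i ord0 : C^o).
Proof.
move=> bM z1.
have comp i : series (fun k => z ^+ k * b k i ord0 : C^o) @ \oo --> (hardy2_value b z i ord0 : C^o).
  rewrite mxE; have : cvgn (series (fun k => z ^+ k * b k i ord0 : C^o)).
    apply: (@complex_series_cvg _ _ (hardy2_norm b) (nrm z)) => //; rewrite ?hardy2_norm_ge0 ?nrm_ge0//.
    move=> k; rewrite nrmM nrmX mulrC ler_wpM2r ?exprn_ge0 ?nrm_ge0//.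
    by rewrite (le_trans _ (vnorm_hardy2 k bM))// (nrm_le_l2norm (fun i => b k i ord0)).
  by [].
have -> : series (fun k => z ^+ k * \sum_i v i * b k i ord0 : C^o) =
    (fun n => \sum_i (v i : C^o) * series (fun k => z ^+ k * b k i ord0 : C^o) n).
  apply/funext => n; rewrite /series/=; under eq_bigr do rewrite mulr_sumr.
  rewrite exchange_big/=; apply: eq_bigr => i _; rewrite mulr_sumr.
  by apply: eq_bigr => k _; rewrite mulrCA.
apply: (cvg_finsum (F := fun i n => (v i : C^o) * series (fun k => z ^+ k * b k i ord0 : C^o) n)) => i.
by apply: cvgMl_tmp; exact: comp.
Qed.

Definition const_hardy (u : Cd) : nat -> Cd := fun k => if k is 0%N then u else 0.

Lemma const_hardyP M u : u \in M -> hardy2 M (const_hardy u).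
Proof.
move=> uM; split=> [[|k]//=|]; first by rewrite mem0v.
apply/cvg_ex; exists (vnorm u ^+ 2).
rewrite -cvg_shiftS /=; apply: cvg_near_cst; apply: nearW => n.
rewrite /series/= big_nat_recl//= big1 ?addr0// => k _.
by rewrite /vnorm /l2norm big1 ?sqrtr0 ?expr0n// => i _; rewrite mxE nrm0 expr0n.
Qed.

Lemma const_hardy_value M u z v : u \in M -> nrm z < 1 ->
  \sum_i v i * hardy2_value (const_hardy u) z i ord0 = \sum_i v i * u i ord0.
Proof.
move=> uM z1; have := hardy2_value_cvg (v := v) (const_hardyP uM) z1.
move=> h; apply: (cvg_unique (@norm_hausdorff _ C^o) h).
rewrite /mkset -cvg_shiftS /=; apply: cvg_near_cst; apply: nearW => n.
rewrite /series/= big_nat_recl//= expr0 mul1r [X in _ + X]big1 ?addr0// => k _.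
by rewrite big1 ?mulr0// => i _; rewrite mxE mulr0.
Qed.

(** Continuity of point evaluation on the Hardy space. Bounding every Taylor coefficient by the norm
    and summing a geometric series gives a cruder constant than Cauchy-Schwarz would, which is
    enough. *)
Lemma hardy2_value_le M f g z v (e : R) : hardy2 M f -> hardy2 M g -> nrm z < 1 ->
  hardy2_norm (fun k => f k - g k) < e ->
  nrm (\sum_i v i * hardy2_value f z i ord0 - \sum_i v i * hardy2_value g z i ord0)
  <= (\sum_i nrm (v i)) * e / (1 - nrm z).
Proof.
move=> fM gM z1 fge.
have V0 : 0 <= \sum_i nrm (v i) by apply: sumr_ge0 => i _; rewrite nrm_ge0.
have fgM : hardy2 M (fun k => f k - g k).
  case: fM gM => [fM fS] [gM gS]; split=> [k|]; first by rewrite memvB.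
  apply: (@series_le_cvg _ _ (fun k => 2 * vnorm (f k) ^+ 2 + 2 * vnorm (g k) ^+ 2)).
  - by move=> k; rewrite sqr_ge0.
  - by move=> k; rewrite addr_ge0// mulr_ge0// sqr_ge0.
  - move=> k; rewrite /vnorm !l2norm_sqr !mulr_sumr -big_split/=; apply: ler_sum => i _.
    rewrite !mxE; have := ler_nrmD (f k i ord0) (- g k i ord0); rewrite nrmN.
    have := nrm_ge0 (f k i ord0 - g k i ord0).
    move: (nrm _) (nrm (f k i ord0)) (nrm (g k i ord0)) => x y t x0 xyt.
    have xy2 : x ^+ 2 <= (y + t) ^+ 2 by rewrite ler_sqr ?nnegrE// (le_trans x0).
    have := sqr_ge0 (y - t); lra.
  - rewrite [X in cvgn X](_ : _ = (fun n => 2 * series (fun k => vnorm (f k) ^+ 2) n + 2 * series (fun k => vnorm (g k) ^+ 2) n)).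
      by apply: is_cvgD; apply: is_cvgMl_tmp.
    by apply/funext => n; rewrite /series/= big_split/= !mulr_sumr.
apply: (cvg_nrm_le (cvgB (hardy2_value_cvg (v := v) fM z1) (hardy2_value_cvg (v := v) gM z1))) => n.
rewrite -[X in nrm X](_ : \sum_(0 <= k < n) z ^+ k * \sum_i v i * (f k - g k) i ord0 = _); last first.
  transitivity (\sum_(0 <= k < n) (z ^+ k * \sum_i v i * f k i ord0) -
                \sum_(0 <= k < n) (z ^+ k * \sum_i v i * g k i ord0)); last by [].
  rewrite -sumrB; apply: eq_bigr => k _; rewrite -mulrBr; congr (_ * _).
  by rewrite -sumrB; apply: eq_bigr => i _; rewrite !mxE mulrBr.
rewrite (le_trans (ler_nrm_sum _ _ _))//.
apply: (@le_trans _ _ (\sum_(0 <= k < n) nrm z ^+ k * ((\sum_i nrm (v i)) * e))).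
  apply: ler_sum => k _; rewrite nrmM nrmX ler_wpM2l ?exprn_ge0 ?nrm_ge0//.
  rewrite (le_trans (ler_nrm_sum _ _ _))// mulr_suml; apply: ler_sum => i _.
  rewrite nrmM ler_wpM2l ?nrm_ge0// (le_trans _ (ltW fge))//.
  by rewrite (le_trans _ (vnorm_hardy2 k fgM))// (nrm_le_l2norm (fun i => (f k - g k) i ord0)).
rewrite -mulr_suml mulrC ler_wpM2l//; last by rewrite big_mkord geometric_sum_le ?nrm_ge0.
by rewrite mulr_ge0// (le_trans (hardy2_norm_ge0 _) (ltW fge)).
Qed.

Lemma poly_disk_eq0 (p : {poly C}) : (forall z, nrm z < 1 -> p.[z] = 0) -> p = 0.
Proof.
move=> p0; apply/eqP; apply: contraT => pN0.
pose s := [seq (k.+2%:R : C)^-1 | k <- iota 0 (size p)].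
have := max_poly_roots pN0 (_ : all (root p) s) (_ : uniq s); rewrite size_map size_iota ltnn.
apply.
  apply/allP => _ /mapP[k _ ->]; rewrite /root p0// nrmV nrm_nat invf_lt1// ?ltr1n//.
rewrite map_inj_uniq ?iota_uniq// => j k /invr_inj/eqP.
by rewrite eqr_nat => /eqP[].
Qed.

(** Suppose [v A(a) = 0] with [v] nonzero and [|a| < 1]. Either [v] annihilates [M], so that [v A]
    vanishes on the disc, hence identically, and [A(1)] is singular; or [v u] is nonzero for some
    [u] in [M], and then no [A f] comes close to the constant [u], because [v] kills [A f] at
    [a]. *)
Lemma outer_root_ge1 (A : 'M[{poly C}]_d) (a : C) :
  is_outer A -> (\det A).[1] != 0 -> (\det A).[a] = 0 -> 1 <= nrm a.
Proof.
move=> [M [Mval Mdense]] A1 Aa; rewrite leNgt; apply/negP => a1.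
have detE z : (\det A).[z] = \det (mxeval A z) by rewrite /mxeval det_map_mx.
move/eqP : Aa; rewrite detE => /det0P[v v0 vA].
pose phi (u : Cd) := \sum_i v ord0 i * u i ord0.
have phiE (u : Cd) : phi u = (v *m u) ord0 ord0 by rewrite mxE.
have [M0|[u uM phiu]] : (forall u, u \in M -> phi u = 0) \/ exists2 u, u \in M & phi u != 0.
  have [|/existsPNP[u uM /eqP]] := pselect (forall u, u \in M -> phi u = 0); first by left.
  by right; exists u.
- move/negP : A1; apply; rewrite detE; apply/det0P; exists v => //.
  apply/rowP => j; pose p := \sum_i v ord0 i *: A i j.
  have -> : (v *m mxeval A 1) ord0 j = p.[1].
    by rewrite mxE horner_sum; apply: eq_bigr => i _; rewrite !mxE hornerZ.
  rewrite [p]poly_disk_eq0 ?horner0 ?mxE// => z z1.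
  pose ej : Cd := delta_mx j ord0.
  (* Applied to the constant basis vector [ej], outerness puts the [j]-th column of [A] into the
     Hardy space of [M]. *)
  have [g gM /(_ z z1) gE] := Mval _ (const_hardyP (memvf ej)).
  have eE : hardy2_value (const_hardy ej) z = ej.
    apply/colP => i; have := const_hardy_value (fun k => (k == i)%:R) (memvf ej) z1.
    do 2 (rewrite (bigD1 i)//= eqxx mul1r big1 ?addr0; last by move=> k /negPf ->; rewrite mul0r).
    by [].
  have := hardy2_value_cvg (v := fun i => v ord0 i) gM z1.
  have -> : series (fun k => z ^+ k * \sum_i v ord0 i * g k i ord0 : C^o) = (fun=> 0).
    apply/funext => n; rewrite /series/= big1// => k _.
    by rewrite -/(phi (g k)) M0 ?mulr0//; case: gM.
  move/(cvg_unique (@norm_hausdorff _ C^o) (cvg_cst _)); rewrite gE eE => ->; rewrite horner_sum; apply: eq_bigr => i _.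
  rewrite hornerZ; congr (_ * _); rewrite mxE (bigD1 j)//= big1 ?addr0.
    by rewrite !mxE !eqxx mulr1.
  by move=> k /negPf kj; rewrite [delta_mx _ _ _ _]mxE kj mulr0.
- have V0 : 0 <= \sum_i nrm (v ord0 i) by apply: sumr_ge0 => i _; rewrite nrm_ge0.
  have p0 : 0 < nrm (phi u) by rewrite nrm_gt0.
  have q0 : 0 < 1 - nrm a by rewrite subr_gt0.
  pose e := nrm (phi u) * (1 - nrm a) / (\sum_i nrm (v ord0 i) + 1).
  have V1 : 0 < \sum_i nrm (v ord0 i) + 1 by rewrite ltr_wpDl.
  have e0 : 0 < e by rewrite divr_gt0// mulr_gt0.
  have [f [g' [_ g'M /(_ a a1) g'E g'u]]] := Mdense _ _ (const_hardyP uM) e0.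
  have := hardy2_value_le (fun i => v ord0 i) g'M (const_hardyP uM) a1 g'u.
  rewrite (const_hardy_value _ uM a1) -/(phi u) -/(phi (hardy2_value g' a)) phiE g'E.
  rewrite mulmxA vA mul0mx mxE sub0r nrmN ler_pdivlMr// leNgt => /negP; apply.
  rewrite /e mulrA ltr_pdivrMr// mulrC ltr_pM2l ?mulr_gt0//.
  by rewrite ltrDl.
Qed.

End Hardy.

(** * The explicit bound for matrix polynomials *)

Section ExplicitBound.
Variables (R : realType) (H : hilbertType R) (T : 'B(H, H)).
Local Notation C := R[i].
Hypothesis T_fin : (ritt_const T < +oo)%E.
Hypothesis T1 : nrm T <= 1.
Local Notation c := (fine (ritt_const T)).

Lemma contraction_power_le n v : nrm ((T ^+ n) v) <= 1 * nrm v.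
Proof. by rewrite mul1r contraction_power. Qed.

Lemma contraction_powerX n : nrm (T ^+ n) <= 1.
Proof. by apply: opnorm_le => // v; exact: contraction_power_le. Qed.

Lemma root_bound_gt0 (a : C) : 0 < root_bound c a.
Proof.
rewrite /root_bound; case: ifPn => [a1|_]; first by rewrite invr_gt0 subr_gt0.
by rewrite ltr_pwDl// divr_ge0 ?ritt_c_ge0 ?nrm_ge0.
Qed.

(** Off the circle, contractivity of [T^n] suffices; on it the bound is that of (i) with [M = 1]. *)
Lemma root_bound_le n (a : C) v : (0 < n)%N -> 1 <= nrm a -> a != 1 ->
  nrm v <= root_bound c a * nrm (a *: v - (T ^+ n) v).
Proof.
move=> n0 a1 a_neq1; rewrite /root_bound; case: ifPn => [a_gt1|].
  rewrite ler_pdivlMl ?subr_gt0// mulrBl mul1r -nrmZ.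
  by rewrite (le_trans _ (ler_nrmB _ _))// lerD2l lerN2 contraction_power.
rewrite -leNgt => a_le1; have a_eq1 : nrm a = 1 by apply/eqP; rewrite eq_le a_le1.
have := power_resolvent_le T_fin ler01 contraction_power_le v n0 a1 a_neq1.
by rewrite a_eq1 divr1 mulr1.
Qed.

Lemma prod_root_bound_le n (r : seq C) v : (0 < n)%N ->
  (forall a, a \in r -> 1 <= nrm a /\ a != 1) ->
  nrm v <= \prod_(a <- r) root_bound c a *
           nrm (poly_calc (\prod_(a <- r) (a%:P - 'X)) (T ^+ n) v).
Proof.
move=> n0; elim: r v => [|a r IH] v rP.
  by rewrite !big_nil poly_calc1 mul1r.
have [a1 a_neq1] := rP a (mem_head _ _).
have {}IH := IH _ (fun b br => rP b (mem_behead (s := a :: r) br)).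
rewrite !big_cons poly_calcM poly_calcB poly_calcC poly_calcX mulrC.
have p0 : 0 <= \prod_(b <- r) root_bound c b.
  by apply: prodr_ge0 => b _; rewrite ltW// root_bound_gt0.
apply: (le_trans (IH v)); rewrite [X in _ <= _ * X]mulrC -?mulrA mulrCA; apply: ler_wpM2l => //.
rewrite mulrC.
exact: (root_bound_le (poly_calc (\prod_(j <- r) (j%:P - 'X)) (T ^+ n) v) n0 a1 a_neq1).
Qed.

Variables (r d : nat) (W : 'M[{poly C}]_(r, d)) (A : 'M[{poly C}]_d).
Variables (c0 : C) (alpha : seq C).
Local Notation m := (mxpoly_norm W).
Local Notation L := (outer_const c A c0 alpha).
Hypothesis W1 : mxnorm (mxeval W 1) < m.
Hypothesis A_outer : is_outer A.
Hypothesis WA : forall zeta : C, nrm zeta = 1 ->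
  (m ^+ 2)%:C%:M - (mxeval W zeta) ^t* *m mxeval W zeta
  = (mxeval A zeta) ^t* *m mxeval A zeta.
Hypothesis detA : \det A = c0 *: \prod_(a <- alpha) (a%:P - 'X).

Lemma horner_detA z : (\det A).[z] = c0 * \prod_(a <- alpha) (a - z).
Proof.
by rewrite detA hornerZ horner_prod; congr (_ * _); apply: eq_bigr => a _; rewrite !hornerE.
Qed.

Lemma outer_const_roots :
  c0 != 0 /\ forall a, a \in alpha -> 1 <= nrm a /\ a != 1.
Proof.
have A1 := complement_det1_neq0 (mxpoly_norm_ge0 W) WA W1.
split=> [|a a_alpha]; first by apply: contra A1 => /eqP c00; rewrite horner_detA c00 mul0r.
have root_a z : a = z -> (\det A).[z] = 0.
  by move=> <-; rewrite horner_detA (big_rem a)//= subrr mul0r mulr0.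
split; first exact: (outer_root_ge1 A_outer A1 (root_a a erefl)).
by apply: contra A1 => /eqP/root_a ->.
Qed.

Lemma outer_const_ge0 : 0 <= L.
Proof.
have adj0 : 0 <= adj_max A.
  apply: (@le_trans _ _ (mxnorm (\adj (mxeval A 1)))); first exact: mxnorm_ge0.
  apply: ub_le_sup; last by exists 1 => //=; rewrite /unit_circle/= nrm1.
  have [_] := mxpoly_norm_has_sup (\adj A); congr has_ubound.
  by apply: eq_imagel => z _; rewrite /mxeval -map_mx_adj.
rewrite mulr_ge0 ?divr_ge0 ?nrm_ge0//.
by apply: prodr_ge0 => a _; rewrite ltW// root_bound_gt0.
Qed.

Lemma outer_const_le n (x : 'I_d -> H) : (0 < n)%N ->
  \sum_k nrm (x k) ^+ 2 <= L ^+ 2 * \sum_k nrm (mxpoly_calc A (T ^+ n) x k) ^+ 2.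
Proof.
move=> n0; have [c00 alphaP] := outer_const_roots.
have nc0 : 0 < nrm c0 by rewrite nrm_gt0.
pose K := \prod_(a <- alpha) root_bound c a / nrm c0.
have K0 : 0 <= K.
  by rewrite divr_ge0 ?nrm_ge0//; apply: prodr_ge0 => a _; rewrite ltW// root_bound_gt0.
have xK k : nrm (x k) <= K * nrm (poly_calc (\det A) (T ^+ n) (x k)).
  have := prod_root_bound_le (x k) n0 alphaP; rewrite detA poly_calcZ => /le_trans; apply.
  set S := poly_calc _ _; rewrite -[(c0 *: S) (x k)]/(c0 *: S (x k)) nrmZ.
  by rewrite /K mulrA divfK// gt_eqF.
have -> : L = K * adj_max A by rewrite /K /outer_const; ring.
clearbody K; apply: (@le_trans _ _ (K ^+ 2 * \sum_k nrm (mxpoly_calc (\adj A) (T ^+ n) (mxpoly_calc A (T ^+ n) x) k) ^+ 2)).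
  rewrite mulr_sumr; apply: ler_sum => k _; rewrite mxpoly_calc_adj -exprMn.
  by rewrite ler_sqr ?nnegrE ?(mulr_ge0 K0) ?nrm_ge0//; exact: xK.
rewrite exprMn -[X in _ <= X]mulrA; apply: ler_wpM2l; first exact: sqr_ge0.
exact: (adj_max_le A _ (contraction_powerX n)).
Qed.

Lemma mxpoly_norm_gt0 : 0 < m.
Proof. exact: le_lt_trans (mxnorm_ge0 _) W1. Qed.

(** As [0^-1 = 0], the final bound is smaller than [m] only once [L = 0] is excluded. A zero [L]
    would contradict [outer_const_le] on a constant nonzero family; its index set is nonempty since
    for [d = 0] all norms are 0, against [|W(1)| < m]. *)
Lemma outer_const_gt0 : (exists x : H, x != 0) -> 0 < L.
Proof.
move=> [x x0]; rewrite lt_def outer_const_ge0 andbT.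
have [k _] : exists k : 'I_d, True.
  apply: contrapT => /forallNP d0; have := W1; rewrite ltNge => /negP; apply.
  apply: (@le_trans _ _ 0); last exact: mxnorm_ge0.
  apply: ge_sup; first by case: (mxpoly_norm_has_sup W).
  move=> _ [z /= _ <-]; apply: l2opnorm_le => // v.
  rewrite mul0r (_ : (fun i => _) = fun=> 0) ?l2norm0//.
  by apply/funext => i; rewrite big1// => k; case: (d0 k).
apply: contraTneq isT => L0; have := outer_const_le (fun=> x) (ltn0Sn 0).
rewrite L0 expr0n mul0r leNgt (bigD1 k)//= ltr_pwDl// ?exprn_gt0 ?nrm_gt0//.
by apply: sumr_ge0 => j _; rewrite sqr_ge0.
Qed.

Lemma explicit_bound n : (exists x : H, x != 0) -> (0 < n)%N ->
  l2opnorm (mxpoly_calc W (T ^+ n)) <= Num.sqrt (m ^+ 2 - L ^- 2).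
Proof.
move=> H0 n0; have L0 := outer_const_gt0 H0.
apply: l2opnorm_le; first exact: sqrtr_ge0.
move=> x; apply: l2norm_le; first exact: sqrtr_ge0.
have h1 := mxpoly_complement_le WA x (contraction_powerX n).
have h2 := outer_const_le x n0.
rewrite mulrC -ler_pdivrMr ?exprn_gt0// in h2.
have s0 : 0 <= \sum_i nrm (mxpoly_calc W (T ^+ n) x i) ^+ 2.
  by apply: sumr_ge0 => i _; rewrite sqr_ge0.
have x0 : 0 <= \sum_k nrm (x k) ^+ 2 by apply: sumr_ge0 => i _; rewrite sqr_ge0.
have key : \sum_i nrm (mxpoly_calc W (T ^+ n) x i) ^+ 2 <= (m ^+ 2 - L ^- 2) * \sum_k nrm (x k) ^+ 2.
  rewrite mulrBl lerBrDr (le_trans _ h1)// lerD2l mulrC.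
  by rewrite mulrC; move: h2; rewrite mulrC.
(* The square root of a negative number is 0 by convention; then [key] holds a fortiori with
   coefficient 0. *)
have [D0|D0] := leP 0 (m ^+ 2 - L ^- 2); first by rewrite sqr_sqrtr.
apply: (le_trans key); apply: ler_wpM2r => //.
by rewrite (le_trans (ltW D0))// sqr_ge0.
Qed.

Lemma explicit_bound_lt : (exists x : H, x != 0) -> Num.sqrt (m ^+ 2 - L ^- 2) < m.
Proof.
move=> H0; have m0 := mxpoly_norm_gt0.
rewrite -[X in _ < X](ger0_norm (ltW m0)) -sqrtr_sqr ltr_sqrt ?exprn_gt0//.
by rewrite gtrBl invr_gt0 exprn_gt0// outer_const_gt0.
Qed.

End ExplicitBound.

(** * Scalar polynomials small on an arc *)

Section ArcPolynomials.
Variable R : realType.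
Local Notation C := R[i].

Lemma bernoulli_le (e : R) n : 0 <= e -> e <= 1 -> 1 - n%:R * e <= (1 - e) ^+ n.
Proof.
move=> e0 e1; elim: n => [|n IH]; first by rewrite mul0r subr0 expr0.
have n0 : 0 <= n%:R :> R by []. have e10 : 0 <= 1 - e by rewrite subr_ge0.
rewrite exprS; apply: (le_trans _ (ler_wpM2l e10 IH)); rewrite -natr1.
have := mulr_ge0 n0 (sqr_ge0 e); nra.
Qed.

(** Divide [(1 + e)^n (1 - e)^n <= 1] by Bernoulli's bound [(1 - e)^n >= 7 / 8]. *)
Lemma expr_1De_le (e : R) n : 0 <= e -> 8 * (n%:R * e) <= 1 -> (1 + e) ^+ n <= 8 / 7.
Proof.
move=> e0 ne; case: n ne => [|n] ne; first by rewrite expr0; lra.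
have n1 : (1 : R) <= n.+1%:R by rewrite ler1n.
have e1 : e <= 1 by nra.
have h := bernoulli_le n.+1 e0 e1.
have p0 : 0 <= (1 + e) ^+ n.+1 by rewrite exprn_ge0// addr_ge0.
have : (1 + e) ^+ n.+1 * (1 - e) ^+ n.+1 <= 1.
  rewrite -exprMn exprn_ile1//; nra.
have := ler_wpM2l p0 h; nra.
Qed.

Lemma nrm_1BX_le (w : C) (e : R) n : 0 <= e -> 8 * (n%:R * e) <= 1 -> nrm (1 - w) <= e ->
  nrm w ^+ n <= 8 / 7 /\ nrm (1 - w ^+ n) <= 1 / 7.
Proof.
move=> e0 ne we.
have w1 : nrm w <= 1 + e.
  have := ler_nrmD 1 (- (1 - w)); rewrite opprB addrCA subrr addr0 nrm1 -opprB nrmN; lra.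
have wk k : (k <= n)%N -> nrm w ^+ k <= 8 / 7.
  move=> kn; apply: (@le_trans _ _ ((1 + e) ^+ k)).
    by rewrite lerXn2r ?nnegrE ?nrm_ge0 ?addr_ge0.
  apply: expr_1De_le => //; apply: le_trans ne; rewrite ler_wpM2l// ler_wpM2r//.
  by rewrite ler_nat.
split; first exact: wk.
rewrite -opprB subrX1 nrmN nrmM -opprB nrmN.
have s : nrm (\sum_(i < n) w ^+ i) <= n%:R * (8 / 7).
  rewrite (le_trans (ler_nrm_sum _ _ _))//.
  rewrite (le_trans (ler_sum _ (G := fun=> 8 / 7) _))//.
    by move=> i _; rewrite nrmX wk// ltnW.
  by rewrite sumr_const card_ord -[X in X <= _]mulr_natl.
have := ler_pM (nrm_ge0 (1 - w)) (nrm_ge0 _) we s; move/le_trans; apply; lra.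
Qed.

Lemma Re_div1B (z : C) : nrm z = 1 -> z != 1 -> complex.Re (z / (1 - z)) = - (1 / 2).
Proof.
move=> z1 z_neq1; have d0 : 1 - z != 0 by rewrite subr_eq0 eq_sym.
have z0 : z != 0 by rewrite -nrm_gt0 z1.
have zJ : z^* = z^-1 by rewrite invC_norm nrmE z1 expr1n invr1 mul1r.
have zz : z / (1 - z) + (z / (1 - z))^* = - 1.
  rewrite rmorphM/= fmorphV/= rmorphB/= rmorph1 zJ; field.
  by rewrite z0 d0 subr_eq0 z_neq1.
have := congr1 (@complex.Re R) zz; rewrite raddfD/=.
case: (z / (1 - z)) => a b /=; lra.
Qed.

(* [h] is the mean of the first [n] partial sums of [z + z^2 + ...]: its real part
   on the circle is [(F_n - 1) / 2] with [F_n] the Fejer kernel. *)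
Lemma fejer_arc (delta : R) : 0 < delta -> exists h : {poly C},
  h.[0] = 0 /\ forall z, nrm z = 1 -> delta <= nrm (z - 1) -> complex.Re h.[z] <= - (1 / 4).
Proof.
(* On the arc [h] is [z / (1 - z)], of real part -1/2, minus a remainder of modulus at most
   [2 / (n delta^2)]; this [n] makes the remainder at most 1/4. *)
move=> d0; pose n := (Num.bound (8 / delta ^+ 2)).+1.
have nd : 8 / delta ^+ 2 <= n%:R.
  apply: (@le_trans _ _ (Num.bound (8 / delta ^+ 2))%:R); last by rewrite ler_nat.
  by apply/ltW/archi_boundP; rewrite divr_ge0// sqr_ge0.
have n0 : n%:R != 0 :> C by rewrite pnatr_eq0.
pose h : {poly C} := n%:R^-1 *: \sum_(j < n) ('X * \sum_(k < j.+1) 'X^k).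
exists h; rewrite /h; split.
  rewrite hornerZ horner_sum big1 ?mulr0// => j _.
  by rewrite hornerM hornerX mul0r.
move=> z z1 zd; have z_neq1 : z != 1.
  by rewrite -subr_eq0 -nrm_gt0 (lt_le_trans d0).
have z10 : 1 - z != 0 by rewrite subr_eq0 eq_sym.
rewrite hornerZ horner_sum; under eq_bigr do rewrite hornerM hornerX horner_sum.
under eq_bigr do under eq_bigr do rewrite hornerXn.
have -> : n%:R^-1 * (\sum_(j < n) z * \sum_(k < j.+1) z ^+ k) =
    z / (1 - z) - z ^+ 2 * (1 - z ^+ n) / (n%:R * (1 - z) ^+ 2).
  have geo k : \sum_(i < k) z ^+ i = (1 - z ^+ k) / (1 - z).
    by rewrite -opprB subrX1 -mulNr opprB mulrC mulKf.
  under eq_bigr do rewrite geo exprS mulrA mulrBr mulr1 mulrBl.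
  rewrite sumrB sumr_const card_ord -mulr_suml -mulr_sumr -mulr_sumr geo -mulr_natl.
  by field; rewrite n0 z10.
rewrite raddfB/= Re_div1B//.
set w := (X in complex.Re X); have : nrm w <= 1 / 4.
  rewrite /w (nrmM (_ * _)) nrmV (nrmM (z ^+ 2)) (nrmX z 2) z1 expr1n mul1r.
  rewrite (nrmM n%:R) (nrmX _ 2) nrm_nat.
  rewrite ler_pdivrMr; last by rewrite mulr_gt0 ?ltr0n// exprn_gt0// nrm_gt0.
  apply: (@le_trans _ _ 2).
    by rewrite (le_trans (ler_nrmD _ _))// nrmN nrm1 nrmX z1 expr1n.
  have d2 : delta ^+ 2 <= nrm (1 - z) ^+ 2 by rewrite ler_sqr ?nnegrE ?nrm_ge0 ?(ltW d0)// nrmBC.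
  move: nd; rewrite ler_pdivrMr ?exprn_gt0// => nd.
  have := ler_wpM2l (ler0n R n) d2; lra.
have := Re_le_nrm (- w); rewrite raddfN/= nrmN; lra.
Qed.

(* With [h] as above and [s > 0] small, [1 + s h] equals 1 at 0 and has modulus
   less than 1 on the arc; its powers are of the form [1 - z p(z)]. *)
Lemma inverse_on_arc (delta e : R) : 0 < delta -> 0 < e -> exists p : {poly C},
  forall z, nrm z = 1 -> delta <= nrm (z - 1) -> nrm (1 - z * p.[z]) <= e.
Proof.
move=> d0 e0; have [h [h0 hRe]] := fejer_arc d0.
pose B := 1 + \sum_(j < size h) nrm h`_j.
have B1 : 1 <= B by rewrite lerDl; apply: sumr_ge0 => j _; rewrite nrm_ge0.
have hB z : nrm z = 1 -> nrm h.[z] <= B.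
  by move=> z1; rewrite (le_trans (nrm_horner_le _ z1))// lerDr.
(* With [Re h <= -1/4] and [|h| <= B], [|1 + s h|^2 <= 1 - s / 2 + s^2 B^2], which for this [s]
   equals [1 - s / 4]. *)
pose s : R := (4 * B ^+ 2)^-1.
have B2 : 0 < B ^+ 2 by rewrite exprn_gt0// (lt_le_trans ltr01).
have s0 : 0 < s by rewrite invr_gt0 mulr_gt0.
have sB : s * B ^+ 2 = 1 / 4 by rewrite /s; field; rewrite gt_eqF// (lt_le_trans ltr01).
have s1 : s <= 1 / 4.
  have : 1 <= B ^+ 2 by rewrite expr_ge1// (le_trans ler01).
  nra.
pose q := 1 - s / 4.
have q0 : 0 <= q by rewrite /q; lra.
have q1 : q < 1 by rewrite /q; lra.
have gq z : nrm z = 1 -> delta <= nrm (z - 1) -> nrm (1 + s%:C * h.[z]) ^+ 2 <= q.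
  move=> z1 zd; rewrite nrm_sqr.
  have := hRe z z1 zd; have := nrm_sqr h.[z].
  have : nrm h.[z] ^+ 2 <= B ^+ 2 by rewrite ler_sqr ?nnegrE ?nrm_ge0 ?hB// (le_trans ler01).
  case: h.[z] => a b /=; rewrite !mul0r subr0 addr0 add0r => h1 h2 h3.
  have -> : (1 + s * a) ^+ 2 + (s * b) ^+ 2 = 1 + 2 * s * a + s * (s * (a ^+ 2 + b ^+ 2)) by ring.
  rewrite -h2; have := ler_wpM2l (ltW s0) (ler_wpM2l (ltW s0) h1); rewrite sB /q; nra.
have [|k kP] := expr_small q0 q1 (_ : 0 < e ^+ 2); first by rewrite exprn_gt0.
pose g : {poly C} := (1 + s%:C *: h) ^+ k.
have : root (1 - g) 0.
  by rewrite /root hornerD hornerN hornerC horner_exp hornerD hornerC hornerZ h0 mulr0 addr0 expr1n subrr.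
move=> /factor_theorem[p pE]; exists p => z z1 zd.
have -> : 1 - z * p.[z] = (1 + s%:C * h.[z]) ^+ k.
  have := congr1 (horner^~ z) pE; rewrite subr0 /= hornerM hornerX mulrC => <-.
  by rewrite hornerD hornerN hornerC horner_exp hornerD hornerC hornerZ opprB addrC subrK.
rewrite -ler_sqr ?nnegrE ?nrm_ge0 ?(ltW e0)// nrmX -exprM mulnC exprM.
apply: le_trans (ltW (kP k (leqnn k))); apply: lerXn2r; rewrite ?nnegrE ?sqr_ge0//.
exact: gq.
Qed.

(* With [p] close to [1/z] on the arc and [N] large, [y = p(S)^N x] behaves like
   [S^-N x], and [S^N y] is close to [x]. Parseval's identity over the N-th roots
   of unity [w] writes the mean of [|S^k y|^2], [k < N], as a sum of contributions
   which are small by the resolvent bound if [w] is far from 1, and which are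
   polynomials in [S] small on the arc if [w] is near 1. *)
Lemma arc_polynomials (delta K : R) : 0 < delta -> 0 <= K ->
  exists (I : finType) (Q : I -> {poly C}),
    (forall z, nrm z = 1 -> delta <= nrm (z - 1) -> \sum_i nrm (Q i).[z] ^+ 2 <= 1 / 2) /\
    (forall (H : hilbertType R) (S : 'B(H, H)), nrm S <= 1 ->
      (forall w y, nrm w = 1 -> delta / 2 <= nrm (w - 1) -> nrm y <= K * nrm (w *: y - S y)) ->
      forall x, nrm x ^+ 2 <= \sum_i nrm (poly_calc (Q i) S x) ^+ 2).
Proof.
(* [N >= 128 K^2] reduces the contribution of the far roots to [|y|^2 / 32]; [N >= 512 / delta^2]
   makes the near polynomials sum to at most 1/4 on the arc. *)
move=> d0 K0; pose B := 128 * K ^+ 2 + 512 / delta ^+ 2.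
have B0 : 0 <= B by apply: addr_ge0; [apply: mulr_ge0|apply: divr_ge0] => //; exact: sqr_ge0.
pose N := (Num.bound B).+1.
have NB : B <= N%:R.
  by apply: (@le_trans _ _ (Num.bound B)%:R); [exact/ltW/archi_boundP|rewrite ler_nat].
have N_gt0 : (0 < N)%N by [].
clearbody N; have N0 : 0 < N%:R :> R by rewrite ltr0n.
have NC0 : N%:R != 0 :> C by rewrite pnatr_eq0 -lt0n.
pose e : R := (8 * N%:R)^-1; have e0 : 0 < e by rewrite invr_gt0 mulr_gt0.
have Ne : 8 * (N%:R * e) <= 1 by rewrite mulrA divff// gt_eqF// mulr_gt0.
have [p pP] := inverse_on_arc d0 e0.
have [a aP] := prim_root_exists R N_gt0.
have a_neq0 t : a ^+ t != 0 by rewrite -nrm_gt0 (prim_root_nrm aP).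
pose D (t : nat) : {poly C} := \sum_(k < N) ((a ^+ t) ^+ k) *: 'X^k.
(* The threshold [delta / 2] serves both cases: a near root stays at distance [delta / 2] from the
   arc, and at a far root the resolvent hypothesis applies. *)
pose near (t : nat) := nrm ((a ^+ t)^-1 - 1) < delta / 2.
(* The coefficients come from [|x|^2 <= 2 |x - S^N y|^2 + 2 |S^N y|^2] and
   [|S^N y|^2 <= |y|^2 / 32 + s / N^2], [s] being the near sum. On the arc the three kinds
   contribute at most 1/8, 1/8 and 1/4. *)
pose Q (i : bool + 'I_N) : {poly C} := match i with
  | inl true => 2%:R *: (1 - ('X * p) ^+ N)
  | inl false => (4%:R^-1) *: p ^+ N
  | inr t => if near t then (2%:R / N%:R) *: (D t * p ^+ N) else 0 end.
exists (bool + 'I_N)%type, Q; split=> [z z1 zd|H S S1 SK x].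
  have [pN zpN] := nrm_1BX_le (ltW e0) Ne (pP z z1 zd).
  rewrite nrmM z1 mul1r in pN; have pN0 : 0 <= nrm p.[z] ^+ N by rewrite exprn_ge0 ?nrm_ge0.
  have pN2 : (nrm p.[z] ^+ N) ^+ 2 <= 2 by nra.
  rewrite big_sumType big_bool/=.
  have -> : (2%:R *: (1 - ('X * p) ^+ N)).[z] = 2%:R * (1 - (z * p.[z]) ^+ N) by rewrite !hornerE.
  have -> : (4%:R^-1 *: p ^+ N).[z] = 4%:R^-1 * p.[z] ^+ N by rewrite !hornerE.
  rewrite (nrmM 2%:R) (nrmM _^-1) nrmX nrmV !nrm_nat.
  have h1 : (2 * nrm (1 - (z * p.[z]) ^+ N)) ^+ 2 <= 1 / 8.
    have := nrm_ge0 (1 - (z * p.[z]) ^+ N); nra.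
  have h2 : (4^-1 * nrm p.[z] ^+ N) ^+ 2 <= 1 / 8 by rewrite exprMn; lra.
  have h3 : \sum_(t < N) nrm (Q (inr t)).[z] ^+ 2 <= 1 / 4.
    apply: (@le_trans _ _ (\sum_(t < N) (128 / (delta ^+ 2 * N%:R ^+ 2)))); last first.
      rewrite sumr_const card_ord -[X in X <= _]mulr_natl mulrCA -div1r.
      have d2 : 0 < delta ^+ 2 by rewrite exprn_gt0.
      have : 512 / delta ^+ 2 <= N%:R.
        by rewrite (le_trans _ NB)// lerDr mulr_ge0// sqr_ge0.
      rewrite ler_pdivrMr// => h; rewrite mulrCA [X in X <= _](_ : _ = 128 / (delta ^+ 2 * N%:R)); last first.
        by field; rewrite !gt_eqF.
      rewrite ler_pdivrMr ?mulr_gt0//; lra.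
    apply: ler_sum => t _; rewrite /Q; case: ifPn => [tn|_]; last first.
      by rewrite horner0 nrm0 expr0n divr_ge0// mulr_ge0// sqr_ge0.
    rewrite hornerZ hornerM horner_exp (nrmM (_ / _)) (nrmM 2%:R) (nrmM (D t).[z]) nrmV !nrm_nat nrmX.
    have DE : nrm (D t).[z] <= 4 / delta.
      have dz : delta / 2 <= nrm ((a ^+ t)^-1 - z).
        have := ler_nrmD (z - (a ^+ t)^-1) ((a ^+ t)^-1 - 1); rewrite addrA subrK (nrmBC z (_^-1)).
        move: tn; rewrite /near; lra.
      rewrite ler_pdivlMr// mulrC; apply: (@le_trans _ _ (2 * nrm ((1 - (a ^+ t * z)) * (D t).[z]))).
        rewrite nrmM mulrA ler_wpM2r ?nrm_ge0//.
        rewrite (_ : 1 - a ^+ t * z = a ^+ t * ((a ^+ t)^-1 - z)); last by rewrite mulrBr divff.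
        by rewrite nrmM (prim_root_nrm aP) mul1r; lra.
      rewrite (_ : (D t).[z] = \sum_(k < N) (a ^+ t * z) ^+ k); last first.
        rewrite horner_sum; apply: eq_bigr => k _.
        by rewrite hornerZ hornerXn exprMn.
      rewrite -opprB mulNr -subrX1 nrmN.
      have := ler_nrmD ((a ^+ t * z) ^+ N) (- 1); rewrite nrmN nrm1 nrmX nrmM z1 (prim_root_nrm aP) mulr1 expr1n.
      lra.
    have D2 : nrm (D t).[z] ^+ 2 <= 16 / delta ^+ 2.
      rewrite (_ : 16 / _ = (4 / delta) ^+ 2); last by field; rewrite gt_eqF.
      by rewrite ler_sqr ?nnegrE ?nrm_ge0// divr_ge0// ltW.
    rewrite (_ : (2 / N%:R * (nrm (D t).[z] * nrm p.[z] ^+ N)) ^+ 2 =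
      4 / N%:R ^+ 2 * (nrm (D t).[z] ^+ 2 * (nrm p.[z] ^+ N) ^+ 2)); last by field; rewrite gt_eqF.
    rewrite (_ : 128 / _ = 4 / N%:R ^+ 2 * (16 / delta ^+ 2 * 2)); last by field; rewrite !gt_eqF.
    rewrite ler_wpM2l ?divr_ge0 ?sqr_ge0//.
    by apply: ler_pM => //; exact: sqr_ge0.
  rewrite /= in h3; move: h1 h2 h3; lra.
pose y := poly_calc (p ^+ N) S x.
pose u t := \sum_(k < N) (a ^+ t) ^+ k *: (S ^+ k) y.
have uD t : u t = poly_calc (D t * p ^+ N) S x.
  rewrite poly_calcM -[RHS]/(poly_calc (D t) S y) poly_calc_sum boundedop_sumE.
  by apply: eq_bigr => k _; rewrite poly_calcZ poly_calcXn.
have SN v : nrm ((S ^+ N) v) <= nrm v.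
  rewrite (le_trans (nrm_opX _ _ _))// ler_piMl ?nrm_ge0//.
  by rewrite exprn_ile1// nrm_ge0.
have far t : ~~ near t -> nrm (u t) ^+ 2 <= (2 * K) ^+ 2 * nrm y ^+ 2.
  rewrite -leNgt => tf; rewrite -exprMn ler_sqr ?nnegrE ?mulr_ge0 ?nrm_ge0//.
  have w1 : nrm (a ^+ t)^-1 = 1 by rewrite nrmV (prim_root_nrm aP) invr1.
  rewrite (le_trans (SK _ (u t) w1 tf))// -mulrA mulrCA ler_wpM2l//.
  have -> : u t = \sum_(k < N) (a ^+ t)^-1 ^- k *: (S ^+ k) y.
    by apply: eq_bigr => k _; rewrite exprVn invrK.
  have -> : S (\sum_(k < N) (a ^+ t)^-1 ^- k *: (S ^+ k) y) = \sum_(k < N) (a ^+ t)^-1 ^- k *: (S ^+ k.+1) y.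
    by rewrite (linear_sum S); apply: eq_bigr => k _; rewrite linearZ/= exprS.
  rewrite (geometric_telescope (fun k => (S ^+ k) y)) ?invr_neq0//.
  rewrite nrmZ nrmM nrmV !nrmX w1 expr1n invr1 !mul1r.
  rewrite (_ : (a ^+ t)^-1 ^+ N = 1); last by rewrite exprVn -exprM mulnC exprM (prim_expr_order aP) expr1n invr1.
  rewrite scale1r (le_trans (ler_nrmD _ _))// nrmN.
  by have := SN y; rewrite expr0 -[(1 : 'B(H, H)) y]/y; lra.
(* Parseval, with [|S^N y| <= |S^k y|] for [k < N]. *)
have mean : N%:R * (N%:R * nrm ((S ^+ N) y) ^+ 2) <= \sum_(t < N) nrm (u t) ^+ 2.
  rewrite (nrm_dft aP (hdot_psd H) (@hdotE _ H) (fun k => (S ^+ k) y)) ler_wpM2l//.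
  rewrite mulr_natl -[X in _ *+ X]card_ord -sumr_const; apply: ler_sum => k _.
  rewrite ler_sqr ?nnegrE ?nrm_ge0//.
  have -> : (S ^+ N) y = (S ^+ (N - k)) ((S ^+ k) y).
    by rewrite -[LHS]/((S ^+ N) y) -{1}(subnK (ltnW (ltn_ord k))) exprD.
  rewrite (le_trans (nrm_opX _ _ _))// ler_piMl ?nrm_ge0//.
  by rewrite exprn_ile1// nrm_ge0.
have split_mean : \sum_(t < N) nrm (u t) ^+ 2 <=
    N%:R * ((2 * K) ^+ 2 * nrm y ^+ 2) + \sum_(t < N | near t) nrm (u t) ^+ 2.
  rewrite (bigID (fun t : 'I_N => near t))/= addrC lerD2r.
  apply: (@le_trans _ _ (\sum_(t < N) ((2 * K) ^+ 2 * nrm y ^+ 2))).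
    rewrite [X in _ <= X](bigID (fun t : 'I_N => near t))/= ler_wpDl//.
      by apply: sumr_ge0 => t _; rewrite mulr_ge0// sqr_ge0.
    by apply: ler_sum => t /far.
  by rewrite sumr_const card_ord -[X in X <= _]mulr_natl.
have nearQ : \sum_(t < N) nrm (poly_calc (Q (inr t)) S x) ^+ 2 =
    4 / N%:R ^+ 2 * \sum_(t < N | near t) nrm (u t) ^+ 2.
  rewrite mulr_sumr [RHS]big_mkcond/=; apply: eq_bigr => t _; case: ifPn => _.
    rewrite poly_calcZ -[X in nrm X]/((2%:R / N%:R) *: poly_calc _ S x) -uD nrmZ (nrmM 2%:R) nrmV !nrm_nat.
    by field; rewrite gt_eqF.
  by rewrite poly_calc0 nrm0 expr0n.
rewrite big_sumType big_bool/= -/(Q _) nearQ.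
have xE : x = poly_calc (1 - ('X * p) ^+ N) S x + (S ^+ N) y.
  rewrite exprMn poly_calcB poly_calc1 poly_calcM poly_calcXn.
  by rewrite -[X in X + _]/(x - (S ^+ N) y) subrK.
have x2 : nrm x ^+ 2 <= 2 * nrm (poly_calc (1 - ('X * p) ^+ N) S x) ^+ 2 + 2 * nrm ((S ^+ N) y) ^+ 2.
  have := ler_nrmD (poly_calc (1 - ('X * p) ^+ N) S x) ((S ^+ N) y); rewrite -xE.
  have := nrm_ge0 x; move: (nrm x) (nrm (poly_calc _ S x)) (nrm ((S ^+ N) y)) => b s t b0 bst.
  have b2 : b ^+ 2 <= (s + t) ^+ 2 by rewrite ler_sqr ?nnegrE// (le_trans b0).
  have := sqr_ge0 (s - t); lra.
have scaleE z q : nrm (poly_calc (z *: q) S x) = nrm z * nrm (poly_calc q S x).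
  by rewrite poly_calcZ -[X in nrm X]/(z *: poly_calc q S x) nrmZ.
rewrite !scaleE nrmV !nrm_nat -/y.
set q1 := nrm (poly_calc (1 - _) S x) in x2 *; set s := \sum_(t < N | near t) nrm (u t) ^+ 2 in split_mean *.
set b := nrm ((S ^+ N) y) in x2 mean *.
have NK : 128 * K ^+ 2 <= N%:R.
  by rewrite (le_trans _ NB)// lerDl divr_ge0// sqr_ge0.
have b2 : b ^+ 2 <= 32^-1 * nrm y ^+ 2 + s / N%:R ^+ 2.
  have N2 : 0 < N%:R ^+ 2 :> R by rewrite exprn_gt0.
  rewrite -(ler_pM2l N2) (_ : N%:R ^+ 2 * (_ + _) = N%:R ^+ 2 * (32^-1 * nrm y ^+ 2) + s).
    have := le_trans mean split_mean.
    have := ler_wpM2l (mulr_ge0 (ltW N0) (sqr_ge0 (nrm y))) NK; lra.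
  by field; rewrite gt_eqF.
rewrite (_ : 4 / N%:R ^+ 2 * s = 4 * (s / N%:R ^+ 2)); last by ring.
have s0 : 0 <= s / N%:R ^+ 2.
  by rewrite divr_ge0 ?sqr_ge0//; apply: sumr_ge0 => t _; rewrite sqr_ge0.
have := sqr_ge0 q1; move: x2 b2; lra.
Qed.

End ArcPolynomials.

(** * The disk algebra *)

Section Tensors.
Variable R : realType.
Local Notation C := R[i].

Definition orthonormal (E : hilbertType R) n (e : 'I_n -> E) :=
  forall i j, hdot (e i) (e j) = (i == j)%:R.

Lemma orthonormalize (E : hilbertType R) (s : seq E) : exists (n : nat) (e : 'I_n -> E),
  orthonormal e /\ forall x, x \in s -> x = \sum_i hdot x (e i) *: e i.
Proof.
have [t [tP st]] := psd_orthonormalize (hdot_psd E) s.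
exists (size t), (fun i => t`_i); split=> [i j|x xs]; first by rewrite tP.
have /= := st x xs; set r := x - _; rewrite hdotE => /complexI/eqP.
rewrite sqrf_eq0 nrm_eq0 subr_eq0 => /eqP.
by [].
Qed.

Lemma nrm_orthonormal (E : hilbertType R) n (e : 'I_n -> E) (v : 'I_n -> C) :
  orthonormal e -> nrm (\sum_i v i *: e i) ^+ 2 = \sum_i nrm (v i) ^+ 2.
Proof.
move=> eP; have fP := hdot_psd E; apply: (@complexI R); rewrite -hdotE rmorph_sum/=.
rewrite (psd_suml fP); apply: eq_bigr => i _; rewrite (psdZl fP) (psd_sumr fP) (bigD1 i)//=.
rewrite (psdZr fP) eP eqxx mulr1 big1 ?addr0 ?nrmCK// => j ji.
by rewrite (psdZr fP) eP eq_sym (negPf ji) mulr0.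
Qed.

Variables (E H : hilbertType R) (EH : hilbert_tensor E H).

Lemma tensor_suml (I : Type) (r : seq I) (v : I -> C) (e : I -> E) h :
  tensor EH (\sum_(i <- r) v i *: e i) h = \sum_(i <- r) v i *: tensor EH (e i) h.
Proof. by rewrite linear_sumlz; apply: eq_bigr => i _; rewrite linearZl_LR. Qed.

Lemma tensor_sumr (I : Type) (r : seq I) (v : I -> C) (h : I -> H) e :
  tensor EH e (\sum_(i <- r) v i *: h i) = \sum_(i <- r) v i *: tensor EH e (h i).
Proof. by rewrite linear_sumr; apply: eq_bigr => i _; rewrite linearZr_LR. Qed.

Lemma nrm_tensor n (e : 'I_n -> E) (h : 'I_n -> H) : orthonormal e ->
  nrm (\sum_i tensor EH (e i) (h i)) ^+ 2 = \sum_i nrm (h i) ^+ 2.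
Proof.
move=> eP; have fP := hdot_psd EH; apply: (@complexI R); rewrite -hdotE rmorph_sum/=.
rewrite (psd_suml fP); apply: eq_bigr => i _; rewrite (psd_sumr fP) (bigD1 i)//=.
rewrite tensor_dot eP eqxx mul1r hdotE big1 ?addr0// => j ji.
by rewrite tensor_dot eP eq_sym (negPf ji) mul0r.
Qed.

(** Orthonormal first factors make the norm of a finite sum of tensors computable by [nrm_tensor];
    by density, operators need only be tested on such sums. *)
Lemma tensor_orthonormal_decomposition (s : seq (E * H)) :
  exists (n : nat) (e : 'I_n -> E) (h : 'I_n -> H), orthonormal e /\
    \sum_(p <- s) tensor EH p.1 p.2 = \sum_i tensor EH (e i) (h i).
Proof.
have [n [e [eP es]]] := orthonormalize [seq p.1 | p <- s].
exists n, e, (fun i => \sum_(p <- s) hdot p.1 (e i) *: p.2); split=> //.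
under [RHS]eq_bigr do rewrite tensor_sumr.
rewrite exchange_big/= !big_seq; apply: eq_bigr => p ps.
by rewrite {1}(es p.1 (map_f _ ps)) tensor_suml.
Qed.

Lemma tensor_le (F : normedModType C) (X : 'B(EH, F)) (k : R) : 0 <= k ->
  (forall n (e : 'I_n -> E) (h : 'I_n -> H), orthonormal e ->
     nrm (X (\sum_i tensor EH (e i) (h i))) ^+ 2 <= k ^+ 2 * \sum_i nrm (h i) ^+ 2) ->
  nrm X <= k.
Proof.
move=> k0 Xk; apply: opnorm_le => // x; apply/ler_addgt0Pr => d d0.
have X0 : 0 <= nrm X by exact: nrm_ge0.
pose d' := d / (nrm X + k + 1).
have K0 : 0 < nrm X + k + 1 by rewrite ltr_wpDl// addr_ge0.
have d'0 : 0 < d' by rewrite divr_gt0.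
have [y [[s _ sy] xy]] : exists y, (exists2 s, [set: seq (E * H)] s & \sum_(p <- s) tensor EH p.1 p.2 = y) /\ nrm (x - y) < d'.
  have : closure [set \sum_(p <- s) tensor EH p.1 p.2 | s in [set: seq (E * H)]] x by rewrite tensor_dense.
  have d'C : 0 < d'%:C :> C by rewrite ltcR.
  move=> /(_ _ (nbhsx_ballx x _ d'C)) [y [ys]]; rewrite -ball_normE/= nrmE ltcR => xy.
  by exists y.
have [n [e [h [eP seh]]]] := tensor_orthonormal_decomposition s.
have Xy : nrm (X y) <= k * nrm y.
  rewrite -ler_sqr ?nnegrE ?mulr_ge0 ?nrm_ge0// exprMn -sy seh nrm_tensor//.
  exact: Xk.
have yx : nrm y <= nrm x + d'.
  by rewrite -[y](subrK x) addrC (le_trans (ler_nrmD _ _))// lerD2l nrmBC ltW.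
have Xxy : nrm (X (x - y)) <= nrm X * d'.
  by rewrite (le_trans (nrm_boundedop _ _))// ler_wpM2l// ltW.
rewrite -[x in X x](subrK y) linearD (le_trans (ler_nrmD _ _))//.
have dE : d = d' * (nrm X + k + 1) by rewrite /d' divfK// gt_eqF.
have := ler_wpM2l k0 yx; rewrite dE; nra.
Qed.

End Tensors.

Section Circle.
Variable R : realType.
Local Notation C := R[i].

Lemma within_disk_nrm (V : normedModType C) (W : C^o -> V) (z : C) (e : R) :
  {within [set z | nrm z <= 1], continuous W} -> nrm z <= 1 -> 0 < e ->
  exists2 d : R, 0 < d & forall w, nrm w <= 1 -> nrm (z - w) < d -> nrm (W z - W w) < e.
Proof.
move=> /subspace_continuousP Wc z1 e0.
have /cvgrPdist_lt/(_ e%:C) := Wc z z1; rewrite ltcR => /(_ e0).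
rewrite near_withinE => /nbhs_normP[_ /= /gt0_complex[d d0 ->] dP]; exists d => // w w1 zw.
by have := dP w; rewrite /ball_ /= !nrmE !ltcR; apply.
Qed.

(** [disk_norm] is a real [sup], which dominates the values only once they are known to be bounded.
    Compactness is used through the angle, on [[-pi, pi]]. *)
Lemma continuous_circle_bounded (V : normedModType C) (W : C^o -> V) :
  {within [set z | nrm z <= 1], continuous W} ->
  exists B : R, forall z, nrm z = 1 -> nrm (W z) <= B.
Proof.
move=> Wc; pose phi (t : R) : C := (cos t +i* sin t)%C.
have phi1 t : nrm (phi t) = 1.
  by apply/eqP; rewrite -(@eqrXn2 _ 2) ?nrm_ge0// nrm_sqr/= cos2Dsin2 expr1n.
pose g t := nrm (W (phi t)).
have gc : continuous g.
  move=> t; apply/cvgrPdist_lt => e e0.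
  have [|d d0 dP] := within_disk_nrm (z := phi t) Wc _ e0; first by rewrite phi1.
  have d2 : 0 < d / 2 by rewrite divr_gt0.
  near=> s; apply: (@le_lt_trans _ _ (nrm (W (phi t) - W (phi s)))).
    have h1 := ler_nrmB (W (phi t)) (W (phi s)); have h2 := ler_nrmB (W (phi s)) (W (phi t)).
    by rewrite nrmBC in h2; rewrite ler_norml h1 andbT lerNl opprB.
  apply: dP; first by rewrite phi1.
  rewrite (le_lt_trans (nrm_le_ReIm _))// [d]splitr; apply: ltrD => /=.
    by near: s; have /cvgrPdist_lt := @continuous_cos R t; apply.
  by near: s; have /cvgrPdist_lt := @continuous_sin R t; apply.
have pi_le : - pi <= pi :> R by have := pi_ge0 R; lra.
have [c _ cP] := EVT_max pi_le (continuous_subspaceT gc).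
exists (g c) => z z1.
have ab : complex.Re z ^+ 2 + complex.Im z ^+ 2 = 1 by rewrite -nrm_sqr z1 expr1n.
have a1 : -1 <= complex.Re z <= 1.
  by rewrite -ler_norml -z1 absRe_le_nrm.
have [t tpi tz] : exists2 t : R, t \in `[- pi, pi] & z = phi t.
  have ca : cos (acos (complex.Re z)) = complex.Re z by rewrite acosK// in_itv.
  have sa : sin (acos (complex.Re z)) = `|complex.Im z|.
    by rewrite sin_acos// -sqrtr_sqr; congr Num.sqrt; rewrite -ab addrAC subrr add0r.
  have a0 := acos_ge0 a1; have api := acos_lepi a1.
  have [b0|b0] := leP 0 (complex.Im z).
    exists (acos (complex.Re z)); first by rewrite in_itv/= api andbT; lra.
    by rewrite /phi ca sa ger0_norm//; case: (z).
  exists (- acos (complex.Re z)); first by rewrite in_itv/=; apply/andP; split; lra.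
  by rewrite /phi cosN sinN ca sa ltr0_norm// opprK; case: (z).
by rewrite tz; exact: cP.
Unshelve. all: by end_near. Qed.

End Circle.

Section DiskAlgebraCalculus.
Variable R : realType.
Local Notation C := R[i].

Lemma oppolyE (E F : hilbertType R) N (P : 'I_N -> 'B(E, F)) z x :
  oppoly P z x = \sum_(j < N) z ^+ j *: P j x.
Proof. by rewrite boundedop_sumE. Qed.

Lemma oppoly_le (E F : hilbertType R) N (P : 'I_N -> 'B(E, F)) z :
  nrm z = 1 -> nrm (oppoly P z) <= \sum_j nrm (P j).
Proof.
move=> z1; rewrite (le_trans (ler_nrm_sum _ _ _))//; apply: ler_sum => j _.
by rewrite nrmZ nrmX z1 expr1n mul1r.
Qed.

Lemma disk_norm_ge (E F : hilbertType R) (W : C -> 'B(E, F)) (B : R) z :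
  (forall z, nrm z = 1 -> nrm (W z) <= B) -> nrm z = 1 -> nrm (W z) <= disk_norm W.
Proof.
move=> WB z1; apply: ub_le_sup; last by exists z.
by exists B => _ [w w1 <-]; exact: WB.
Qed.

(* On vectors [\sum_l e_l (x) h_l] with [e] orthonormal an operator polynomial
   acts as the matrix polynomial of its coordinates, so von Neumann's inequality
   applies; the scalar polynomials [Q] are carried along as extra rows. *)
Lemma oppoly_calc_le (E F H : hilbertType R) (EH : hilbert_tensor E H)
    (FH : hilbert_tensor F H) N (P : 'I_N -> 'B(E, F)) (S : 'B(H, H)) (Y : 'B(EH, FH))
    (I : finType) (Q : I -> {poly C}) (m : R) n (e : 'I_n -> E) (h : 'I_n -> H) :
  is_oppoly_calc P S Y -> nrm S <= 1 -> 0 <= m ->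
  (forall z, nrm z = 1 -> nrm (oppoly P z) ^+ 2 + \sum_q nrm (Q q).[z] ^+ 2 <= m) ->
  orthonormal e ->
  nrm (Y (\sum_l tensor EH (e l) (h l))) ^+ 2
    + \sum_l \sum_q nrm (poly_calc (Q q) S (h l)) ^+ 2 <= m * \sum_l nrm (h l) ^+ 2.
Proof.
move=> YP S1 m0 Pm eP.
have [r [f [fP fs]]] := orthonormalize [seq P p.1 (e p.2) | p : 'I_N * 'I_n].
have PE j l : P j (e l) = \sum_i hdot (P j (e l)) (f i) *: f i.
  by apply: fs; apply/mapP; exists (j, l); rewrite ?mem_enum.
pose w i l : {poly C} := \sum_(j < N) hdot (P j (e l)) (f i) *: 'X^j.
have wE i l v : poly_calc (w i l) S v = \sum_(j < N) hdot (P j (e l)) (f i) *: (S ^+ j) v.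
  rewrite poly_calc_sum boundedop_sumE; apply: eq_bigr => j _.
  by rewrite poly_calcZ poly_calcXn.
have YE : Y (\sum_l tensor EH (e l) (h l)) = \sum_i tensor FH (f i) (\sum_l poly_calc (w i l) S (h l)).
  rewrite (linear_sum Y).
  transitivity (\sum_l \sum_i \sum_(j < N) hdot (P j (e l)) (f i) *: tensor FH (f i) ((S ^+ j) (h l))).
    apply: eq_bigr => l _; apply: (etrans (YP (e l) (h l))); rewrite exchange_big/=; apply: eq_bigr => j _.
    by rewrite {1}PE tensor_suml.
  rewrite exchange_big/=; apply: eq_bigr => i _; rewrite linear_sumr; apply: eq_bigr => l _.
  by rewrite wE tensor_sumr.
(* Each coordinate [l'] gets its own copy of the family: the row [(l', q)] has [Q q] in column [l']
   and zeros elsewhere. *)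
pose WW (k : 'I_r + 'I_n * I) l := match k with
  | inl i => w i l | inr p => if p.1 == l then Q p.2 else 0 end.
have := @von_neumann _ H _ _ WW m m0 _ S h S1.
rewrite big_sumType/= YE nrm_tensor// -(pair_bigA _ (fun l' q => nrm (\sum_l poly_calc (if l' == l then Q q else 0) S (h l)) ^+ 2))/=.
have diagE (V : zmodType) l' q (G : {poly C} -> 'I_n -> V) : (forall l, G 0 l = 0) ->
    \sum_l G (if l' == l then Q q else 0) l = G (Q q) l'.
  by move=> G0; rewrite (bigD1 l')//= eqxx big1 ?addr0// => l; rewrite eq_sym => /negPf ->.
under [X in _ + X]eq_bigr => l' _ do under eq_bigr => q _ do
  rewrite (diagE _ _ _ (fun p l => poly_calc p S (h l))) ?poly_calc0//.
apply=> z v z1; rewrite big_sumType/=.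
have G0 l : (0 : {poly C}).[z] * v l = 0 by rewrite horner0 mul0r.
rewrite -(pair_bigA _ (fun l' q => nrm (\sum_l (if l' == l then Q q else 0).[z] * v l) ^+ 2))/=.
under [X in _ + X]eq_bigr => l' _ do under eq_bigr => q _ do
  rewrite (diagE _ l' q (fun p l => p.[z] * v l) G0) nrmM exprMn.
apply: le_trans (ler_wpM2r _ (Pm z z1)); last by apply: sumr_ge0 => l _; rewrite sqr_ge0.
rewrite mulrDl; apply: lerD; last first.
  rewrite exchange_big/= mulr_suml le_eqVlt; apply/orP; left; apply/eqP; apply: eq_bigr => q _.
  by rewrite mulr_sumr.
rewrite -(nrm_orthonormal v eP) -exprMn.
have -> : \sum_i nrm (\sum_l (w i l).[z] * v l) ^+ 2 = nrm (oppoly P z (\sum_l v l *: e l)) ^+ 2.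
  rewrite -(nrm_orthonormal (fun i => \sum_l (w i l).[z] * v l) fP); congr (nrm _ ^+ 2).
  rewrite (linear_sum (oppoly P z)).
  under eq_bigr do rewrite scaler_suml; rewrite exchange_big/=; apply: eq_bigr => l _.
  rewrite linearZ/= oppolyE scaler_sumr.
  under [RHS]eq_bigr do rewrite PE scaler_sumr scaler_sumr.
  rewrite [RHS]exchange_big/=; apply: eq_bigr => i _.
  rewrite horner_sum mulr_suml scaler_suml; apply: eq_bigr => j _.
  by rewrite hornerZ hornerXn !scalerA; congr (_ *: _); ring.
by rewrite ler_sqr ?nnegrE ?mulr_ge0 ?nrm_ge0// nrm_boundedop.
Qed.

End DiskAlgebraCalculus.

(** * The uniform strict bound for functions in the disk algebra *)

Section DiskCalcBound.
Variables (R : realType) (H : hilbertType R) (T : 'B(H, H)).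
Local Notation C := R[i].
Hypothesis T_fin : (ritt_const T < +oo)%E.
Hypothesis T1 : nrm T <= 1.
Local Notation c := (fine (ritt_const T)).

(* [disk_calc] is 0 when no operator satisfies [is_disk_calc], so its existence is
   not an issue. The polynomials [Q] of [arc_polynomials] are added to [W] as rows
   with a weight [tau] so small that, near 1, they do not exceed the gap between
   [|W|] and its maximum. *)
Lemma disk_calc_power_le (E F : hilbertType R) (EH : hilbert_tensor E H)
    (FH : hilbert_tensor F H) (W : C^o -> 'B(E, F)) :
  disk_algebra W -> nrm (W 1) < disk_norm W ->
  exists2 k : R, k < disk_norm W &
    forall n, (0 < n)%N -> nrm (disk_calc EH FH W (T ^+ n)) <= k.
Proof.
move=> [Wc _]; set m := disk_norm W => W1m.
have [B WB] := continuous_circle_bounded Wc.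
have Wm z : nrm z = 1 -> nrm (W z) <= m by exact: disk_norm_ge WB.
pose eta := (m - nrm (W 1)) / 2.
have eta0 : 0 < eta by rewrite divr_gt0// subr_gt0.
have W10 := nrm_ge0 (W 1).
have eta_m : 2 * eta <= m by rewrite /eta; lra.
have [|delta delta0 deltaP] := within_disk_nrm (z := 1) Wc _ eta0; first by rewrite nrm1.
have Wnear z : nrm z = 1 -> nrm (z - 1) < delta -> nrm (W z) <= m - eta.
  move=> z1; rewrite nrmBC => /deltaP; rewrite z1 => /(_ (lexx _)).
  have := ler_nrmB (W z) (W 1); rewrite nrmBC /eta; lra.
have d20 : 0 < delta / 2 by rewrite divr_gt0.
have c0 := ritt_c_ge0 T.
(* The bound of (i) with [M = 1] at distance [delta / 2] from 1, the same for all powers of [T]. *)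
pose K := 1 + c / (delta / 2).
have K0 : 0 <= K by rewrite addr_ge0// divr_ge0// ltW.
have [I [Q [Qarc QK]]] := arc_polynomials delta0 K0.
pose L := 1 + \sum_q (\sum_(j < size (Q q)) nrm (Q q)`_j) ^+ 2.
have L1 : 1 <= L by rewrite lerDl; apply: sumr_ge0 => q _; rewrite sqr_ge0.
have QL z : nrm z = 1 -> \sum_q nrm (Q q).[z] ^+ 2 <= L.
  move=> z1; rewrite (le_trans (_ : _ <= \sum_q (\sum_(j < size (Q q)) nrm (Q q)`_j) ^+ 2)) ?lerDr//.
  apply: ler_sum => q _; rewrite ler_sqr ?nnegrE ?nrm_ge0 ?nrm_horner_le//.
  by apply: sumr_ge0 => j _; rewrite nrm_ge0.
(* Near 1 the weighted rows contribute at most [tau^2 L = tau eta <= eta^2], which the drop from [m]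
   to [m - eta] compensates because [2 eta <= m]. *)
pose tau := eta / L.
have L0 : 0 < L by rewrite (lt_le_trans ltr01).
have tau0 : 0 < tau by rewrite divr_gt0.
have tauL : tau * L = eta by rewrite /tau divfK// gt_eqF.
have tau_eta : tau <= eta by rewrite -tauL ler_peMr// ltW.
have m0 : 0 < m by rewrite (le_lt_trans W10).
(* The tolerance [s] is spent on [P - W] and on [Y - X], and once more as the final gap. It must
   satisfy [(m + s)^2 - tau^2 / 2 <= (m - 2 s)^2], which [12 m s = tau^2] ensures. *)
pose s := tau ^+ 2 / (12 * m).
have sE : 12 * m * s = tau ^+ 2 by rewrite mulrC divfK// gt_eqF// mulr_gt0.
have s0 : 0 < s by rewrite divr_gt0 ?exprn_gt0// mulr_gt0.
have s_small : 48 * s <= m.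
  have : tau * tau <= (m / 2) * (m / 2) by apply: ler_pM; rewrite ?(ltW tau0)//; lra.
  rewrite -expr2 -sE => h; rewrite -(ler_pM2l m0); lra.
exists (m - s); first by rewrite gtrBl.
move=> n n0; rewrite /disk_calc; case: xgetP => [X _ XW|_]; last by rewrite nrm0; lra.
have [N [P [Y [YP PW YX]]]] := XW s s0.
have Tn1 := contraction_powerX T1 n.
have Pz z : nrm z = 1 -> nrm (oppoly P z) <= nrm (W z) + s.
  move=> z1; have PWz : nrm (oppoly P z - W z) <= s.
    apply: le_trans (ltW PW); apply: (@disk_norm_ge _ _ _ _ (\sum_j nrm (P j) + B)) z1 => w w1.
    by rewrite (le_trans (ler_nrmD _ _))// nrmN lerD ?oppoly_le ?WB.
  by rewrite -[oppoly P z](subrK (W z)) addrC (le_trans (ler_nrmD _ _))// lerD2l.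
pose Q' q : {poly C} := tau%:C *: Q q.
have Q'z z : \sum_q nrm (Q' q).[z] ^+ 2 = tau ^+ 2 * \sum_q nrm (Q q).[z] ^+ 2.
  rewrite mulr_sumr; apply: eq_bigr => q _.
  by rewrite hornerZ nrmM exprMn nrm_real gtr0_norm.
have m20 : 0 <= (m + s) ^+ 2 + tau ^+ 2 / 2.
  by rewrite addr_ge0 ?divr_ge0 ?sqr_ge0.
have PQ z : nrm z = 1 ->
    nrm (oppoly P z) ^+ 2 + \sum_q nrm (Q' q).[z] ^+ 2 <= (m + s) ^+ 2 + tau ^+ 2 / 2.
  move=> z1; rewrite Q'z; have Pz1 := Pz z z1; have P0 := nrm_ge0 (oppoly P z).
  have [zd|zd] := leP delta (nrm (z - 1)).
    apply: lerD; last first.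
      by rewrite -[tau ^+ 2 / 2]mulr1 -mulrA ler_wpM2l ?sqr_ge0// mulr1 -[2^-1]div1r Qarc.
    rewrite ler_sqr ?nnegrE ?addr_ge0 ?(ltW m0) ?(ltW s0)// (le_trans Pz1)// lerD2r.
    exact: Wm.
  have h1 : nrm (oppoly P z) <= m + s - eta by have := Wnear z z1 zd; lra.
  have h2 : nrm (oppoly P z) ^+ 2 <= (m + s - eta) ^+ 2.
    by rewrite ler_sqr ?nnegrE// (le_trans P0).
  have h3 : tau ^+ 2 * (\sum_q nrm (Q q).[z] ^+ 2) <= eta ^+ 2.
    apply: (@le_trans _ _ (tau * (tau * L))); last by rewrite tauL expr2 ler_wpM2r// ltW.
    by rewrite expr2 -mulrA !ler_wpM2l ?(ltW tau0)// QL.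
  have := sqr_ge0 tau; have := mulr_ge0 (ltW eta0) (ltW s0).
  have := ler_wpM2l (ltW eta0) eta_m; nra.
have Sres w y : nrm w = 1 -> delta / 2 <= nrm (w - 1) ->
    nrm y <= K * nrm (w *: y - (T ^+ n) y).
  move=> w1 wd; have w10 : 0 < nrm (w - 1) by rewrite (lt_le_trans d20).
  have w_neq1 : w != 1 by rewrite -subr_eq0 -nrm_gt0.
  have w1' : 1 <= nrm w by rewrite w1.
  have := power_resolvent_le T_fin ler01 (contraction_power_le T1) y n0 w1' w_neq1.
  rewrite w1 divr1 mulr1 => /le_trans; apply; rewrite ler_wpM2r ?nrm_ge0// lerD2l.
  by rewrite ler_wpM2l// lef_pV2 ?posrE.
have k0 : 0 <= m - s - s by lra.
have Yk : nrm Y <= m - s - s.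
  apply: tensor_le => // d e h eP.
  have := oppoly_calc_le h YP Tn1 m20 PQ eP.
  have hQ : tau ^+ 2 * \sum_l nrm (h l) ^+ 2 <= \sum_l \sum_q nrm (poly_calc (Q' q) (T ^+ n) (h l)) ^+ 2.
    rewrite mulr_sumr; apply: ler_sum => l _.
    have -> : \sum_q nrm (poly_calc (Q' q) (T ^+ n) (h l)) ^+ 2 =
        tau ^+ 2 * \sum_q nrm (poly_calc (Q q) (T ^+ n) (h l)) ^+ 2.
      rewrite mulr_sumr; apply: eq_bigr => q _; rewrite poly_calcZ.
      rewrite -[X in nrm X]/(tau%:C *: poly_calc (Q q) (T ^+ n) (h l)).
      by rewrite nrmZ exprMn nrm_real gtr0_norm.
    by rewrite ler_wpM2l ?sqr_ge0// QK.
  have hs0 : 0 <= \sum_l nrm (h l) ^+ 2 by apply: sumr_ge0 => l _; rewrite sqr_ge0.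
  have coef : (m + s) ^+ 2 + tau ^+ 2 / 2 - tau ^+ 2 <= (m - s - s) ^+ 2.
    rewrite -sE; have := mulr_ge0 (ltW s0) (ltW s0); nra.
  have := ler_wpM2r hs0 coef; lra.
rewrite -[X](subrK Y) (le_trans (ler_nrmD _ _))// nrmBC; have := ltW YX; lra.
Qed.

End DiskCalcBound.

Theorem theoremC (R : realType) (H : hilbertType R) (T : 'B(H, H))
    (H_neq0 : exists x : H, x != 0) (T_ritt : is_ritt T) :
  let C := ritt_const T in
  let M := power_bound T in
  let Cr := fine C in
  let pos := [set n : nat | (0 < n)%N] in
  (* (i) *)
  (forall zeta : R[i], nrm zeta = 1 -> zeta != 1 ->
    (ereal_sup [set inverse_norm (zeta *: (1 : 'B(H, H)) - T ^+ n)%R | n in pos]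
       <= 1 + C * M * ((nrm (zeta - 1)%R)^-1)%:E)%E) /\
  (* (ii) *)
  (ereal_sup [set ritt_const (T ^+ k)%R | k in pos] <= C * M + 2%:E)%E /\
  (nrm T <= 1 ->
    (ereal_sup [set ritt_const (T ^+ k)%R | k in pos] <= C + 2%:E)%E) /\
  (* (iii) *)
  (nrm T <= 1 ->
    [/\ forall (E F : hilbertType R) (EH : hilbert_tensor E H)
          (FH : hilbert_tensor F H) (W : R[i]^o -> 'B(E, F)),
          disk_algebra W -> nrm (W 1) < disk_norm W ->
          (ereal_sup [set (nrm (disk_calc EH FH W (T ^+ n)%R))%:E | n in pos]
             < (disk_norm W)%:E)%E,
        forall (r d : nat) (W : 'M[{poly R[i]}]_(r, d)) (A : 'M[{poly R[i]}]_d)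
          (c : R[i]) (alpha : seq R[i]),
          let m := mxpoly_norm W in
          let L := outer_const Cr A c alpha in
          mxnorm (mxeval W 1) < m ->
          is_outer A ->
          (forall zeta : R[i], nrm zeta = 1 ->
             (m ^+ 2)%:C%:M - (mxeval W zeta) ^t* *m mxeval W zeta
             = (mxeval A zeta) ^t* *m mxeval A zeta) ->
          \det A = c *: \prod_(a <- alpha) (a%:P - 'X) ->
          [/\ c != 0,
              forall a, a \in alpha -> 1 <= nrm a /\ a != 1,
              (ereal_sup [set (l2opnorm (mxpoly_calc W (T ^+ n)%R))%:E | n in pos]
                 <= (Num.sqrt (m ^+ 2 - L ^- 2))%:E)%E
            & Num.sqrt (m ^+ 2 - L ^- 2) < m] &
        (ereal_sup [set (nrm ((1 : 'B(H, H)) - T ^+ n)%R)%:E | n in pos]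
           <= (displacement_bound Cr)%:E)%E]).
Proof.
move=> C M Cr pos; have [_ T_fin] := T_ritt.
split; [|split; [|split]].
- by move=> zeta z1 z_neq1; exact: power_resolvent_sup.
- exact: ritt_const_power_sup.
- by move=> T1; exact: ritt_const_power_contraction_sup.
move=> T1; split.
- move=> E F EH FH W Wd W1.
  (* The bound [k] does not depend on [n], so the supremum itself is strictly smaller. *)
  have [k km Wk] := disk_calc_power_le T_fin T1 EH FH Wd W1.
  apply: (@le_lt_trans _ _ k%:E); last by rewrite lte_fin.
  by apply: ge_ereal_sup => _ [n n0 <-]; rewrite lee_fin; exact: Wk.
- move=> r d W A c alpha m L W1 A_outer WA detA.
  have [c0 alphaP] := outer_const_roots W1 A_outer WA detA.
  split=> //; last exact: (explicit_bound_lt T_fin T1 W1 A_outer WA detA H_neq0).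
  apply: ge_ereal_sup => _ [n n0 <-]; rewrite lee_fin.
  exact: (explicit_bound T_fin T1 W1 A_outer WA detA H_neq0 n0).
- by apply: ge_ereal_sup => _ [n n0 <-]; rewrite lee_fin; exact: displacement_le.
Qed.
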